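(* Let $M$ be a compact quotient of $H_7\times\mathbb{R}$ by a lattice of maximal rank. Then there exists a complex structure on $M$ which does not admit any SKT Hermitian structure, but which has balanced Hermitian metrics and $k$-th Gauduchon metrics for $k=1$ and $2$.
   Context: $H_{2n+1}$ denotes the generalized real Heisenberg group of dimension $2n+1$. On a complex manifold $(M,J)$ of complex dimension $n$ (here $n=4$), a $J$-Hermitian metric $g$ with fundamental form $\Omega(\cdot,\cdot)=g(J\cdot,\cdot)$ is: SKT if $\partial\overline{\partial}\Omega=0$; balanced if $d(\Omega^{n-1})=0$; $k$-th Gauduchon ($1\le k\le n-1$) if $\partial\overline{\partial}\Omega^k\wedge\Omega^{n-k-1}=0$. *)

(* Defs.v *)
From HB Require Import structures.
From mathcomp Require Import all_boot all_order all_algebra.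
From mathcomp Require Import generic_quotient complex.
From mathcomp Require Import all_classical all_reals all_analysis.

Set Implicit Arguments.
Unset Strict Implicit.
Unset Printing Implicit Defensive.

Import Order.TTheory GRing.Theory Num.Theory.
Import numFieldNormedType.Exports.

Local Open Scope classical_set_scope.
Local Open Scope ring_scope.
Local Open Scope complex_scope.
Local Open Scope quotient_scope.

(* The Lie group G = H_7 x R is diffeomorphic to R^8 through the coordinates  *)
(* (x_0, x_1, x_2, y_0, y_1, y_2, z, t), where (x, y, z) stands for the       *)
(* matrix [1 x z; 0 I_3 y^T; 0 0 1] of H_7 and t for the factor R.            *)
(* M is the quotient of G by the left translations by a lattice Gamma; as     *)
(* G -> M is a smooth covering with deck group Gamma, a tensor field on M is  *)
(* a tensor field on G invariant under the left translations by Gamma.        *)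

Section Group.
Variable R : realType.
Local Notation G := 'rV[R]_8.

Definition hx (p : G) : 'rV[R]_3 := \row_i p 0 (inord i).
Definition hy (p : G) : 'rV[R]_3 := \row_i p 0 (inord (3 + i)).
Definition hz (p : G) : R := p 0 (inord 6).
Definition ht (p : G) : R := p 0 (inord 7).

Definition hbil (p q : G) : R := (hx p *m (hy q)^T) 0 0.

Definition hmul (p q : G) : G :=
  p + q + hbil p q *: delta_mx 0 (inord 6).

Definition hone : G := 0.

Definition hinv (p : G) : G :=
  - p + hbil p p *: delta_mx 0 (inord 6).

Definition heis_mx (p : G) : 'M[R]_(1 + (3 + 1)) :=
  block_mx 1 (row_mx (hx p) (hz p)%:M) 0 (block_mx 1%:M (hy p)^T 0 1).

Let hxD p q : hx (p + q) = hx p + hx q.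
Proof. by apply/rowP => i; rewrite !mxE. Qed.
Let hyD p q : hy (p + q) = hy p + hy q.
Proof. by apply/rowP => i; rewrite !mxE. Qed.
Let hxN p : hx (- p) = - hx p.
Proof. by apply/rowP => i; rewrite !mxE. Qed.
Let hyN p : hy (- p) = - hy p.
Proof. by apply/rowP => i; rewrite !mxE. Qed.
Let hx6 a : hx (a *: delta_mx 0 (inord 6)) = 0.
Proof.
apply/rowP => i; rewrite !mxE /=.
by case: i => -[|[|[|//]]] /= _; rewrite -(inj_eq val_inj) /= !inordK // mulr0.
Qed.
Let hy6 a : hy (a *: delta_mx 0 (inord 6)) = 0.
Proof.
apply/rowP => i; rewrite !mxE /=.
by case: i => -[|[|[|//]]] /= _; rewrite -(inj_eq val_inj) /= !inordK // mulr0.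
Qed.

Lemma hxM p q : hx (hmul p q) = hx p + hx q.
Proof. by rewrite !hxD hx6 addr0. Qed.
Lemma hyM p q : hy (hmul p q) = hy p + hy q.
Proof. by rewrite !hyD hy6 addr0. Qed.
Lemma hzM p q : hz (hmul p q) = hz p + hz q + hbil p q.
Proof. by rewrite /hz !mxE !eqxx mulr1. Qed.
Lemma htM p q : ht (hmul p q) = ht p + ht q.
Proof.
by rewrite /ht !mxE eqxx /= -(inj_eq val_inj) /= !inordK //= mulr0 addr0.
Qed.

Lemma heis_mxM p q : heis_mx (hmul p q) = heis_mx p *m heis_mx q.
Proof.
rewrite /heis_mx mulmx_block !mulmx0 !mul0mx !addr0 !add0r.
rewrite mulmx_block !mulmx0 !mul0mx !addr0 !add0r !mulmx1 !mul1mx.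
rewrite mul_row_block !mulmx0 !addr0 !mulmx1 add_row_mx hxM hyM hzM.
congr (block_mx _ (row_mx _ _) _ (block_mx _ _ _ _)); first by rewrite addrC.
  rewrite (mx11_scalar (hx p *m _)) -/(hbil p q) -!raddfD /=.
  by congr (_%:M); rewrite [hbil p q + _]addrC addrA [hz q + _]addrC.
by rewrite linearD /= addrC.
Qed.

Let hbilMl p q r : hbil (hmul p q) r = hbil p r + hbil q r.
Proof. by rewrite /hbil hxM mulmxDl mxE. Qed.
Let hbilMr p q r : hbil p (hmul q r) = hbil p q + hbil p r.
Proof. by rewrite /hbil hyM linearD mulmxDr mxE. Qed.

Lemma hmulA p q r : hmul p (hmul q r) = hmul (hmul p q) r.
Proof.
rewrite {1 3}/hmul hbilMl hbilMr /hmul !scalerDl -!addrA; congr (_ + _).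
congr (_ + _); rewrite [RHS]addrCA; congr (_ + _).
by rewrite addrC -addrA.
Qed.

Lemma hmul1g p : hmul hone p = p.
Proof.
rewrite /hmul /hone /hbil add0r.
have -> : hx 0 = 0 by apply/rowP => i; rewrite !mxE.
by rewrite mul0mx mxE scale0r addr0.
Qed.

Lemma hmulVg p : hmul (hinv p) p = hone.
Proof.
rewrite /hmul /hinv {2}/hbil hxD hx6 hxN addr0 mulNmx mxE -/(hbil p p).
by rewrite scaleNr [- p + _ + _]addrAC addNr add0r subrr.
Qed.

End Group.

Section Quotient.
Variable R : realType.
Local Notation G := 'rV[R]_8.

Record discrete_subgroup := DiscreteSubgroup {
  dsg_set :> set G;
  dsg1 : dsg_set (hone R);
  dsgM : forall p q, dsg_set p -> dsg_set q -> dsg_set (hmul p q);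
  dsgV : forall p, dsg_set p -> dsg_set (hinv p);
  dsg_discrete : forall p, dsg_set p -> \forall q \near p, dsg_set q -> q = p
}.

Variable Gamma : discrete_subgroup.

Definition same_orbit (p q : G) : bool :=
  `[< exists2 c, dsg_set Gamma c & q = hmul c p >].

Lemma same_orbit_refl : reflexive same_orbit.
Proof.
by move=> p; apply/asboolP; exists (hone R); [exact: dsg1|rewrite hmul1g].
Qed.

Lemma same_orbit_sym : symmetric same_orbit.
Proof.
suff h p q : same_orbit p q -> same_orbit q p.
  by move=> p q; apply/idP/idP; exact: h.
move=> /asboolP[c Gc ->]; apply/asboolP; exists (hinv c); first exact: dsgV.
by rewrite hmulA hmulVg hmul1g.
Qed.

Lemma same_orbit_trans : transitive same_orbit.
Proof.
move=> q p r /asboolP[c Gc ->] /asboolP[c' Gc' ->]; apply/asboolP.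
by exists (hmul c' c); [exact: dsgM|rewrite hmulA].
Qed.

Canonical orbit_equiv :=
  EquivRel same_orbit same_orbit_refl same_orbit_sym same_orbit_trans.

Definition nilmanifold : topologicalType :=
  quotient_topology {eq_quot orbit_equiv}.

End Quotient.

Section Smooth.
Variable R : realType.
Local Notation G := 'rV[R]_8.

Definition ebase (i : 'I_8) : G := delta_mx 0 i.

Fixpoint Ck_on (k : nat) (U : set G) (f : G -> R) : Prop :=
  (forall x, U x -> {for x, continuous f}) /\
  if k is k'.+1 then
    forall i, (forall x, U x -> derivable f x (ebase i)) /\
              Ck_on k' U (fun x => 'D_(ebase i) f x)
  else True.

(* C^infinity on an open set U *)
Definition smooth_on (U : set G) (f : G -> R) : Prop := forall k, Ck_on k U f.

Definition smooth_map_on (U : set G) (f : G -> G) : Prop :=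
  forall j, smooth_on U (fun x => f x 0 j).

Definition smooth_mx (A : G -> 'M[R]_8) : Prop :=
  forall i j, smooth_on setT (fun x => A x i j).

End Smooth.

(* Tangent vectors of G are row vectors in the coordinate basis.  A field J   *)
(* of endomorphisms maps v at x to v *m J x, a field g of bilinear forms      *)
(* maps (u, v) at x to bil (g x) u v.                                         *)
Section Structures.
Variable R : realType.
Local Notation G := 'rV[R]_8.

Definition bil (g : 'M[R]_8) (u v : G) : R := (u *m g *m v^T) 0 0.

(* differential of the left translation by c *)
Definition dleft (c x v : G) : G := 'D_v (hmul c) x.

Definition endo_invariant (Gamma : set G) (J : G -> 'M[R]_8) : Prop :=
  forall c, Gamma c -> forall x v,
    dleft c x v *m J (hmul c x) = dleft c x (v *m J x).

Definition bil_invariant (Gamma : set G) (g : G -> 'M[R]_8) : Prop :=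
  forall c, Gamma c -> forall x u v,
    bil (g (hmul c x)) (dleft c x u) (dleft c x v) = bil (g x) u v.

(* multiplication by i on C^4 = R^4 (+) i R^4 *)
Definition J0 : 'M[R]_8 := (block_mx 0 1%:M (- 1%:M) 0 : 'M[R]_(4 + 4)).

Definition has_holomorphic_charts (J : G -> 'M[R]_8) : Prop :=
  forall x : G, exists (U V : set G) (phi psi : G -> G),
    [/\ open U, U x & open V] /\
    [/\ forall y, U y -> V (phi y) /\ psi (phi y) = y,
        forall w, V w -> U (psi w) /\ phi (psi w) = w,
        smooth_map_on U phi, smooth_map_on V psi &
        forall y v, U y -> 'D_(v *m J y) phi y = 'D_v phi y *m J0].

Definition complex_structure (Gamma : set G) (J : G -> 'M[R]_8) : Prop :=
  [/\ smooth_mx J, forall x, J x *m J x = - 1%:M,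
      endo_invariant Gamma J & has_holomorphic_charts J].

Definition hermitian_metric (Gamma : set G) (J g : G -> 'M[R]_8) : Prop :=
  [/\ smooth_mx g,
      forall x u v, bil (g x) u v = bil (g x) v u,
      forall x v, v != 0 -> 0 < bil (g x) v v,
      forall x u v, bil (g x) (u *m J x) (v *m J x) = bil (g x) u v &
      bil_invariant Gamma g].

End Structures.

(* Complex-valued exterior forms on R^8: a : ext R is the form                *)
(* \sum_S a S dx_S, where dx_S = dx_{i_1} /\ ... /\ dx_{i_k} for              *)
(* S = {i_1 < ... < i_k}.                                                     *)
Section Forms.
Variable R : realType.
Local Notation G := 'rV[R]_8.

Definition ext := {ffun {set 'I_8} -> R[i]}.
Definition form := G -> ext.

Definition ext1 : ext := [ffun S => (S == finset.set0)%:R].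

Definition covec (a : 'I_8 -> R[i]) : ext :=
  [ffun S : {set 'I_8} => \sum_(i | S == [set i]%SET) a i].

(* dx_S /\ dx_T = shuffle_sign S T dx_(S :|: T) for disjoint S and T *)
Definition shuffle_sign (S T : {set 'I_8}) : R[i] :=
  (-1) ^+ #|[set u : 'I_8 * 'I_8 |
             [&& u.1 \in S, u.2 \in T & (u.2 < u.1)%N]]%SET|.

Definition wedge (a b : ext) : ext :=
  [ffun U : {set 'I_8} => \sum_(S : {set 'I_8} | S \subset U)
     shuffle_sign S (U :\: S)%SET * a S * b (U :\: S)%SET].

Definition wedge_pow (k : nat) (a : form) : form :=
  fun x => iter k (wedge (a x)) ext1.

Definition partial (i : 'I_8) (f : G -> R[i]) (x : G) : R[i] :=
  ('D_(ebase R i) (fun y => complex.Re (f y)) x) +i*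
  ('D_(ebase R i) (fun y => complex.Im (f y)) x).

Definition extd (a : form) : form := fun x =>
  \sum_(i < 8) wedge (covec (fun j => (j == i)%:R))
                     [ffun S => partial i (fun y => a y S) x].

(* the (1,0) and (0,1) parts (dx_k -+ i dx_k o J) / 2 of dx_k *)
Definition dx10 (J : 'M[R]_8) (k : 'I_8) : ext :=
  covec (fun j => ((j == k)%:R - 'i%C * (J j k)%:C) / 2%:R).
Definition dx01 (J : 'M[R]_8) (k : 'I_8) : ext :=
  covec (fun j => ((j == k)%:R + 'i%C * (J j k)%:C) / 2%:R).

(* (p,q) component: expand each dx_k = dx10 k + dx01 k in dx_S and keep the   *)
(* products of p factors of type (1,0) and q factors of type (0,1)            *)
Definition ext_bidegree (J : 'M[R]_8) (p q : nat) (a : ext) : ext :=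
  [ffun U => \sum_(S : {set 'I_8})
     \sum_(T : {set 'I_8} | [&& T \subset S, #|T| == p & #|S :\: T|%SET == q])
       a S * (\big[wedge/ext1]_(k in S)
                (if k \in T then dx10 J k else dx01 J k)) U].

Definition bidegree (J : G -> 'M[R]_8) (p q : nat) (a : form) : form :=
  fun x => ext_bidegree (J x) p q (a x).

Definition del (J : G -> 'M[R]_8) (a : form) : form := fun x =>
  \sum_(p < 5) \sum_(q < 5) bidegree J p.+1 q (extd (bidegree J p q a)) x.

Definition delbar (J : G -> 'M[R]_8) (a : form) : form := fun x =>
  \sum_(p < 5) \sum_(q < 5) bidegree J p q.+1 (extd (bidegree J p q a)) x.

(* Omega(u, v) = g(J u, v) *)
Definition fundamental_form (J g : G -> 'M[R]_8) : form := fun x =>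
  [ffun S : {set 'I_8} =>
    \sum_(i < 8) \sum_(j < 8 | (i < j)%N && (S == [set i; j]%SET))
      (bil (g x) (ebase R i *m J x) (ebase R j))%:C].

Definition SKT (J g : G -> 'M[R]_8) : Prop :=
  forall x, del J (delbar J (fundamental_form J g)) x = 0.

Definition balanced (J g : G -> 'M[R]_8) : Prop :=
  forall x, extd (wedge_pow (4 - 1) (fundamental_form J g)) x = 0.

Definition gauduchon (k : nat) (J g : G -> 'M[R]_8) : Prop :=
  forall x, wedge (del J (delbar J (wedge_pow k (fundamental_form J g))) x)
                  (wedge_pow (4 - k - 1) (fundamental_form J g) x) = 0.

End Forms.

(* Main.v *)
From HB Require Import structures.
Require Import Defs.
From mathcomp Require Import all_boot all_order all_algebra.
From mathcomp Require Import generic_quotient complex ring lra.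
From mathcomp Require Import all_classical all_reals all_analysis.
Set Implicit Arguments.
Unset Strict Implicit.
Unset Printing Implicit Defensive.
Import Order.TTheory GRing.Theory Num.Theory.
Import numFieldNormedType.Exports.
Local Open Scope ring_scope.
Local Open Scope complex_scope.

(** The complex structure comes from the Lie algebra of H_7 x R.  In the frame
    of left-invariant fields E_k, the structure J maps X_j to eps_j Y_j and Z
    to T, with eps = (1, 1, -1).  It is integrable: the functions
    x_j + i eps_j y_j (j = 0, 1, 2) and z + i (t - sum_j eps_j x_j^2 / 2) form
    a global holomorphic chart ([chart_holomorphic]).

    In the dual coframe dx_j, dy_j, zeta = dz - sum_j x_j dy_j, dt, the only
    form that is not closed is zeta, with d zeta = - sigma for
    sigma = sum_j dx_j /\ dy_j.  A form a with constant coefficients in the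
    coframe thus has d a = - sigma /\ iota_Z a.  If moreover a is of type
    (r+1, r+1) and iota_Z a = u /\ lambda for a horizontal form u of type
    (r, r) and a 1-form lambda, splitting lambda into its types gives
    del delbar a = ((lambda(Z) + i lambda(T)) / 2) sigma^2 /\ u
    ([deldelbarframe]).

    Existence.  Let Omega = F + zeta /\ dt with F = sum_j w_j dx_j /\ dy_j; it
    is positive when w_j and eps_j have the same sign.  Then d Omega^3 is a
    multiple of sigma /\ F^2, that is, of the second elementary symmetric
    function of the w_j, which vanishes for w = (2, 2, -1): this metric is
    balanced.  Also del delbar Omega /\ Omega^2 and del delbar Omega^2 /\ Omega
    are multiples of sigma^2 /\ F, that is, of w_0 + w_1 + w_2, which vanishes
    for w = (1, 1, -2): this metric is first and second Gauduchon.  Both need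
    signs eps_j that are not all equal.

    No SKT metric.  Let g be a Gamma-invariant Hermitian metric, with
    coefficients in the frame that are arbitrary smooth Gamma-invariant
    functions.  In the coframe, d is the operator above plus sum_k dx_k /\ E_k,
    where E_k differentiates the coefficients.  Modulo the divergences
    sum_k E_k v_k of Gamma-invariant functions, del delbar Omega is thus
    computed as if the coefficients were constant: it is
    (i / 2) g(T, T) sigma^2.  If del delbar Omega = 0 then g(T, T), which is
    bounded below by a positive constant on the compact quotient, is a
    divergence ([not_SKT]).

    This is impossible ([no_positive_divergence]).  An invariant measure would
    make the mean of a divergence vanish; here the same conclusion comes from
    the amenability of the nilpotent group.  By compactness, E_k v_k is close
    to a difference quotient of v_k along the flow of E_k, a right translation.
    Averaging functions over long pieces of the orbits of these flows, the
    central one first, removes the differences one after the other, up to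
    arbitrarily small errors; a positive lower bound of their sum cannot survive
    ([no_positive_sum_diff]). *)

(** * The exterior algebra of R^8 *)

Section ExteriorAlgebra.
Variable R : realType.
Local Notation C := R[i].
Local Notation ext := (ext R).
Local Notation set0 := (finset.set0).
Implicit Types (S T U V : {set 'I_8}) (a b c : ext).

Definition transp_sign (i j : 'I_8) : C := if (j < i)%N then -1 else 1.

Lemma prod_setUd (F : 'I_8 -> C) S T : [disjoint S & T] ->
  \prod_(i in (S :|: T)%SET) F i = \prod_(i in S) F i * \prod_(i in T) F i.
Proof.
by move=> dST; rewrite -bigU//; apply: eq_bigl => i; rewrite !inE.
Qed.

(** A product over pairs is multiplicative in each set, which reduces the
    associativity of the wedge product to bookkeeping on index sets. *)
Lemma shuffle_sign_prod S T :
  shuffle_sign R S T = \prod_(i in S) \prod_(j in T) transp_sign i j.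
Proof.
rewrite /shuffle_sign -prodr_const pair_big_dep /= big_mkcond [RHS]big_mkcond /=.
apply: eq_bigr => -[i j] _; rewrite inE /= /transp_sign.
by case: (i \in S); case: (j \in T); case: (j < i)%N.
Qed.

Lemma shuffle_signUl S T U : [disjoint S & T] ->
  shuffle_sign R (S :|: T)%SET U = shuffle_sign R S U * shuffle_sign R T U.
Proof. by move=> dST; rewrite !shuffle_sign_prod prod_setUd. Qed.

Lemma shuffle_signUr S T U : [disjoint T & U] ->
  shuffle_sign R S (T :|: U)%SET = shuffle_sign R S T * shuffle_sign R S U.
Proof.
move=> dTU; rewrite !shuffle_sign_prod -big_split /=.
by apply: eq_bigr => i _; rewrite prod_setUd.
Qed.

Lemma shuffle_sign0l S : shuffle_sign R set0 S = 1.
Proof. by rewrite shuffle_sign_prod big_set0. Qed.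

Lemma shuffle_sign0r S : shuffle_sign R S set0 = 1.
Proof. by rewrite shuffle_sign_prod big1// => i _; rewrite big_set0. Qed.

Lemma transp_sign_sqr i j : transp_sign i j * transp_sign i j = 1.
Proof. by rewrite /transp_sign; case: ifP; rewrite ?mulrNN mulr1. Qed.

Lemma transp_signC i j : i != j -> transp_sign i j = - transp_sign j i.
Proof.
by rewrite /transp_sign -(inj_eq val_inj) /=; case: ltngtP; rewrite ?opprK.
Qed.

Lemma wedgeA : associative (@wedge R).
Proof.
move=> a b c; apply/ffunP => U; rewrite !ffunE.
(* Both sides run over the splittings of U into three sets: on the right, the
   middle set is T = V \ S. *)
under [RHS]eq_bigr => V VU do rewrite ffunE mulr_sumr mulr_suml.
rewrite (exchange_big_dep (fun S => S \subset U)) /=; last first.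
  by move=> V S VU SV; apply: fintype.subset_trans VU.
apply: eq_bigr => S SU; rewrite ffunE mulr_sumr.
rewrite [RHS](reindex_onto (fun T => S :|: T)%SET (fun V => V :\: S)%SET) /=; last first.
  move=> V /andP[VU SV]; apply/setP => i; rewrite !inE.
  by have := fintype.subsetP SV i; case: (i \in S) => //= ->.
have eqS T : (T \subset U :\: S) = [&& (S :|: T)%SET \subset U, S \subset (S :|: T)%SET & ((S :|: T) :\: S)%SET == T].
  rewrite finset.subUset SU finset.subsetUl /= finset.subsetD.
  congr (_ && _); apply/idP/eqP => [dTS|<-].
    apply/setP => i; rewrite !inE; case: (boolP (i \in S)) => //= iS.
    by apply/esym/negbTE; apply: contraL iS => iT; rewrite (disjointFr dTS).
  by rewrite finset.disjoints_subset; apply/fintype.subsetP => i; rewrite !inE => /andP[].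
apply: eq_big => [T|T]; first by rewrite eqS andbA.
move=> TUS; have := TUS; rewrite eqS => /and3P[STU _ /eqP STS].
have := TUS; rewrite finset.subsetD => /andP[TU dTS].
have dST : [disjoint S & T] by rewrite disjoint_sym.
rewrite STS; have -> : (U :\: (S :|: T) = U :\: S :\: T)%SET by rewrite finset.setDDl.
set W := (_ :\: T)%SET.
have UST : (U :\: S = T :|: W)%SET.
  by rewrite /W; apply/setP => i; rewrite !inE; have := fintype.subsetP TUS i; rewrite !inE; case: (i \in T) => //= ->.
have dTW : [disjoint T & W] by rewrite /W finset.disjoints_subset; apply/fintype.subsetP => i; rewrite !inE => ->.
rewrite {1}UST shuffle_signUr// shuffle_signUl//.
by ring.
Qed.

Lemma wedge1l : left_id (ext1 R) (@wedge R).
Proof.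
move=> a; apply/ffunP => U; rewrite ffunE (bigD1 set0) ?finset.sub0set//= big1 ?addr0.
  by rewrite finset.setD0 shuffle_sign0l ffunE eqxx !mul1r.
by move=> S /andP[_ /negbTE S0]; rewrite ffunE S0 mulr0 mul0r.
Qed.

Lemma wedge1r : right_id (ext1 R) (@wedge R).
Proof.
move=> a; apply/ffunP => U; rewrite ffunE (bigD1 U)//= big1 ?addr0.
  by rewrite finset.setDv shuffle_sign0r ffunE eqxx mulr1 mul1r.
move=> S /andP[SU SU']; rewrite !ffunE (_ : _ == _ = false) ?mulr0//.
by apply/negbTE; apply: contraNneq SU' => /eqP; rewrite finset.setD_eq0 finset.eqEsubset SU.
Qed.

Lemma wedgeDl : left_distributive (@wedge R) +%R.
Proof.
move=> a b c; apply/ffunP => U; rewrite !ffunE -big_split /=.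
by apply: eq_bigr => S _; rewrite ffunE mulrDr mulrDl.
Qed.

Lemma wedgeDr : right_distributive (@wedge R) +%R.
Proof.
move=> a b c; apply/ffunP => U; rewrite !ffunE -big_split /=.
by apply: eq_bigr => S _; rewrite ffunE mulrDr.
Qed.

Lemma ext1_neq0 : ext1 R != 0 :> ext.
Proof.
by apply/eqP => /ffunP /(_ set0) /eqP; rewrite !ffunE eqxx oner_eq0.
Qed.

(** An alias of the type of exterior forms that carries the algebra structure
    whose product is the wedge product. *)
Definition Lam := ext.
HB.instance Definition _ := GRing.Lmodule.copy Lam
  {ffun {set 'I_8} -> (C^o : lmodType C)}.
HB.instance Definition _ := GRing.Zmodule_isNzRing.Build Lam
  wedgeA wedge1l wedge1r wedgeDl wedgeDr ext1_neq0.

Lemma lam_mulE (a b : Lam) : a * b = wedge a b.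
Proof. by []. Qed.

Lemma wedgeZl (k : C) (a b : Lam) : k *: (a * b) = k *: a * b.
Proof.
apply/ffunP => U; rewrite !ffunE scaler_sumr; apply: eq_bigr => S _.
by rewrite ffunE /GRing.scale /=; ring.
Qed.
HB.instance Definition _ := GRing.Lmodule_isLalgebra.Build C Lam wedgeZl.

Lemma wedgeZr (k : C) (a b : Lam) : k *: (a * b) = a * (k *: b).
Proof.
apply/ffunP => U; rewrite !ffunE scaler_sumr; apply: eq_bigr => S _.
by rewrite ffunE /GRing.scale /=; ring.
Qed.
HB.instance Definition _ := GRing.Lalgebra_isAlgebra.Build C Lam wedgeZr.

Lemma lam0E U : (0 : Lam) U = 0. Proof. by rewrite ffunE. Qed.

Lemma lamNE (a : Lam) U : (- a) U = - a U. Proof. by rewrite ffunE. Qed.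

Lemma lamDE (a b : Lam) U : (a + b) U = a U + b U.
Proof. by rewrite ffunE. Qed.

Lemma lamZE (k : C) (a : Lam) U : (k *: a) U = k * a U.
Proof. by rewrite ffunE. Qed.

End ExteriorAlgebra.

(** * Covectors, contractions and substitutions *)

Section ExteriorGenerators.
Variable R : realType.
Local Notation C := R[i].
Local Notation Lam := (Lam R).
Local Notation set0 := (finset.set0).
Implicit Types (S T U V : {set 'I_8}) (a b c : Lam) (i j k : 'I_8).

Definition cov (v : 'I_8 -> C) : Lam := covec v.
Definition dx i : Lam := cov (fun j => (j == i)%:R).

(** dx_i /\ dx_S = insert_sign i S dx_(S + i) for i outside S. *)
Definition insert_sign i S : C := \prod_(k in S) transp_sign R i k.

Lemma insert_sign_sqr i S : insert_sign i S * insert_sign i S = 1.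
Proof. by rewrite -big_split big1 //= => k _; rewrite transp_sign_sqr. Qed.

Lemma insert_signU1 i j S : j \notin S ->
  insert_sign i (j |: S)%SET = transp_sign R i j * insert_sign i S.
Proof. by move=> jS; rewrite /insert_sign big_setU1. Qed.

Lemma insert_signD1 i j S : j \in S ->
  insert_sign i S = transp_sign R i j * insert_sign i (S :\ j)%SET.
Proof. by move=> jS; rewrite /insert_sign (big_setD1 j). Qed.

Lemma cov_wedgeE v b U :
  (cov v * b) U = \sum_(i in U) v i * insert_sign i (U :\ i)%SET * b (U :\ i)%SET.
Proof.
rewrite lam_mulE ffunE /cov /covec.
under eq_bigr => S SU do rewrite /cov /covec ffunE mulr_sumr mulr_suml.
rewrite (exchange_big_dep predT)//= [RHS]big_mkcond /=; apply: eq_bigr => i _.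
case: ifP => iU.
  rewrite (big_pred1 [set i]%SET) => [|S]; last first.
    by rewrite andb_idl// => /eqP ->; rewrite finset.sub1set.
  by rewrite shuffle_sign_prod big_set1 -[X in X * _]mulrC.
rewrite big1 // => S /andP[SU /eqP SE].
by move: SU; rewrite SE finset.sub1set iU.
Qed.

Lemma dx_wedgeE i b U :
  (dx i * b) U =
    if i \in U then insert_sign i (U :\ i)%SET * b (U :\ i)%SET else 0.
Proof.
rewrite cov_wedgeE big_mkcond /= (bigD1 i)//= big1 ?addr0.
  by case: ifP; rewrite ?eqxx ?mul1r.
by move=> j /negbTE ->; case: ifP; rewrite ?mul0r.
Qed.

Lemma covE v S : cov v S = \sum_(i | S == [set i]%SET) v i.
Proof. by rewrite ffunE. Qed.

Lemma cov_sum v : cov v = \sum_i v i *: dx i.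
Proof.
apply/ffunP => S; rewrite sum_ffunE ffunE big_mkcond; apply: eq_bigr => i _.
rewrite !ffunE; case: eqP => [->|SN].
  rewrite (bigD1 i)//= eqxx big1 ?addr0; last by move=> j /andP[_ /negbTE ->].
  by rewrite /GRing.scale /= mulr1.
rewrite big1 ?scaler0// => j /eqP SE.
by case: eqP => // ji; rewrite SE ji in SN.
Qed.

(** Computed on the coefficients: removing i and j from U in the two orders
    gives signs that differ by the transposition of i and j. *)
Lemma dx_anticomm_mul i j b : i != j -> dx i * (dx j * b) = - (dx j * (dx i * b)).
Proof.
move=> ij; apply/ffunP => U; rewrite lamNE !dx_wedgeE.
rewrite !finset.in_setD1 ij [j == i]eq_sym ij /=.
case: ifP => iU; last by case: ifP => jU; rewrite ?mulr0 oppr0.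
case: ifP => jU; last by rewrite mulr0 oppr0.
have -> : (U :\ i :\ j = U :\ j :\ i)%SET by rewrite !finset.setDDl finset.setUC.
rewrite (@insert_signD1 i j (U :\ i)) ?inE 1?eq_sym ?ij//.
rewrite (@insert_signD1 j i (U :\ j)) ?inE ?ij//.
have -> : (U :\ i :\ j = U :\ j :\ i)%SET by rewrite !finset.setDDl finset.setUC.
by rewrite (transp_signC _ ij); ring.
Qed.

Lemma dx_sqr_mul i b : dx i * (dx i * b) = 0.
Proof.
apply/ffunP => U; rewrite !dx_wedgeE !inE eqxx /= mulr0 lam0E.
by case: ifP.
Qed.

Lemma dx_anticomm i j : dx i * dx j = - (dx j * dx i).
Proof.
have [->|ij] := eqVneq i j.
  by have := dx_sqr_mul j 1; rewrite !mulr1 => ->; rewrite oppr0.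
by have := dx_anticomm_mul 1 ij; rewrite !mulr1.
Qed.

Lemma dx_sqr i : dx i * dx i = 0.
Proof. by have := dx_sqr_mul i 1; rewrite !mulr1. Qed.

Lemma cov_anticomm v w : cov v * cov w = - (cov w * cov v).
Proof.
rewrite (cov_sum v) (cov_sum w) !mulr_suml -sumrN.
under eq_bigr do rewrite mulr_sumr.
rewrite exchange_big /=; apply: eq_bigr => j _; rewrite mulr_sumr -sumrN.
apply: eq_bigr => i _.
by rewrite -!scalerAl -!scalerAr dx_anticomm !scalerN !scalerA mulrC.
Qed.

Lemma cov_sqr v : cov v * cov v = 0.
Proof.
have /eqP := cov_anticomm v v; rewrite -addr_eq0 -mulr2n -scaler_nat scaler_eq0.
by rewrite pnatr_eq0 /= => /eqP.
Qed.

(** The contraction with the i-th coordinate vector field. *)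
Definition contr i a : Lam :=
  [ffun S : {set 'I_8} =>
     if i \in S then 0 else insert_sign i S * a (i |: S)%SET].

Lemma contrE i a S :
  contr i a S = if i \in S then 0 else insert_sign i S * a (i |: S)%SET.
Proof. by rewrite ffunE. Qed.

Lemma contr_is_linear i : linear (contr i).
Proof.
move=> k a b; apply/ffunP => S; rewrite !ffunE; case: ifP => _.
  by rewrite scaler0 addr0.
by rewrite /GRing.scale /=; ring.
Qed.

HB.instance Definition _ i := GRing.isLinear.Build C Lam Lam _ (contr i)
  (contr_is_linear i).

Lemma contr1 i : contr i 1 = 0.
Proof.
apply/ffunP => S; rewrite !ffunE; case: ifP => // iS.
rewrite (_ : _ == _ = false) ?mulr0//.
by apply/negbTE/finset.set0Pn; exists i; rewrite !inE eqxx.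
Qed.

(** The Leibniz rule of the contraction with a coordinate field, an
    antiderivation; together with [contr1] it determines the contraction. *)
Lemma contr_dx i j b :
  contr i (dx j * b) = (i == j)%:R *: b - dx j * contr i b.
Proof.
apply/ffunP => S; rewrite lamDE lamNE lamZE !contrE !dx_wedgeE !contrE !inE.
have [->|ij] := eqVneq i j.
  rewrite /= mul1r; case: ifP => jS.
    by rewrite mulrA insert_sign_sqr mul1r finset.setD1K// subrr.
  by rewrite finset.setU1K ?jS// mulrA insert_sign_sqr mul1r subr0.
rewrite /= mul0r add0r.
case: ifP => iS; first by case: ifP; rewrite ?mulr0 oppr0.
case: ifP => jS; last by rewrite mulr0 oppr0.
have -> : ((i |: S) :\ j = i |: (S :\ j))%SET.
  by apply/setP => k; rewrite !inE; case: eqP => // -> /=; rewrite eq_sym (negbTE ij).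
rewrite insert_signU1 ?inE ?ij ?iS ?andbF//.
by rewrite (@insert_signD1 i j S)// (transp_signC _ ij); ring: (transp_sign_sqr R j i).
Qed.

Lemma contr_cov i v b : contr i (cov v * b) = v i *: b - cov v * contr i b.
Proof.
rewrite (cov_sum v) !mulr_suml linear_sum /=.
under eq_bigr do rewrite -scalerAl linearZ /= contr_dx scalerBr.
rewrite big_split /= sumrN; congr (_ - _); last first.
  by apply: eq_bigr => j _; rewrite scalerAl.
rewrite (bigD1 i)//= eqxx scale1r big1 ?addr0// => j.
by rewrite eq_sym => /negbTE ->; rewrite scale0r scaler0.
Qed.

Lemma contr_contr i b : contr i (contr i b) = 0.
Proof.
apply/ffunP => S; rewrite !ffunE.
by case: ifP => //; rewrite !inE eqxx mulr0.
Qed.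

(** The monomial dx_S. *)
Definition dxs S : Lam := [ffun U => (U == S)%:R].

Lemma dxsE S U : dxs S U = (U == S)%:R. Proof. by rewrite ffunE. Qed.

Lemma dxs0 : dxs set0 = 1.
Proof. by apply/ffunP => U; rewrite !ffunE. Qed.

Lemma dxs_sum a : a = \sum_S a S *: dxs S.
Proof.
apply/ffunP => S; rewrite sum_ffunE (bigD1 S)//= big1 ?addr0.
  by rewrite !ffunE eqxx /GRing.scale /= mulr1.
by move=> T TS; rewrite !ffunE eq_sym (negbTE TS) scaler0.
Qed.

Lemma dx_dxs i S : dx i * dxs S =
  if i \in S then 0 else insert_sign i S *: dxs (i |: S)%SET.
Proof.
apply/ffunP => U; rewrite dx_wedgeE ffunE.
case: (boolP (i \in S)) => iS.
  rewrite ffunE; case: ifP => // iU; rewrite (_ : _ == _ = false) ?mulr0//.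
  by apply/negbTE/eqP => US; rewrite -US !inE eqxx in iS.
rewrite !ffunE; case: ifP => iU; last first.
  rewrite (_ : _ == _ = false) ?scaler0//.
  by apply/negbTE/eqP => US; rewrite US !inE eqxx in iU.
have -> : (U == (i |: S)%SET) = (U :\ i == S)%SET.
  apply/eqP/eqP => [->|<-]; first by rewrite finset.setU1K.
  by rewrite finset.setD1K.
by case: eqP => [->|]; rewrite ?mulr0 ?scaler0.
Qed.

Lemma dxE i S : dx i S = (S == [set i]%SET)%:R.
Proof.
rewrite -[dx i]mulr1 -dxs0 dx_dxs inE /insert_sign big_set0 scale1r.
by rewrite finset.setU0 ffunE.
Qed.

(** The exterior algebra is generated by the dx_i, so that a linear property
    may be proved by adding one factor on the left. *)
Lemma Lam_ind (P : Lam -> Prop) :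
  (forall (k : C) a b, P a -> P b -> P (k *: a + b)) -> P 1 ->
  (forall i a, P a -> P (dx i * a)) -> forall a, P a.
Proof.
move=> Plin P1 Pdx.
have P0 : P 0 by have := Plin (-1) 1 1 P1 P1; rewrite scaleN1r addNr.
have PZ (k : C) a : P a -> P (k *: a) by move=> Pa; rewrite -[_ *: _]addr0; apply: Plin.
move=> a; rewrite (dxs_sum a); apply: (big_ind P) => //.
  by move=> b c Pb Pc; rewrite -[b]scale1r; apply: Plin.
move=> S _; apply/PZ.
have [n] := ubnP #|S|; elim: n S => // n IH S; rewrite ltnS => Sn.
have [->|/finset.set0Pn[i iS]] := eqVneq S set0; first by rewrite dxs0.
have := dx_dxs i (S :\ i)%SET; rewrite !inE eqxx /= finset.setD1K// => E.
(* dx_S is, up to a sign that squares to 1, dx_i /\ dx_(S - i). *)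
rewrite -[dxs S]scale1r -(insert_sign_sqr i (S :\ i)%SET) -scalerA -E.
by apply/PZ/Pdx/IH; rewrite (leq_trans _ Sn)// (cardsD1 i S) iS.
Qed.

(** The algebra endomorphisms that substitute m i for dx_i.  As a property of F
    rather than a construction, it lets different formulas for the same
    substitution be identified ([dx_morph_uniq]). *)
Definition dx_morph (m : 'I_8 -> Lam) (F : Lam -> Lam) :=
  [/\ linear F, F 1 = 1 & forall i b, F (dx i * b) = m i * F b].

(** Linearity is used below as a predicate on plain functions, because the maps
    at hand come from various constructions; this bundles it on the fly. *)
Lemma linear_fun_sum (F : Lam -> Lam) (I : finType) (f : I -> Lam) :
  linear F -> F (\sum_i f i) = \sum_i F (f i).
Proof.
move=> Flin; pose h := GRing.isLinear.Build C Lam Lam _ F Flin.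
exact: (linear_sum (HB.pack F h : {linear Lam -> Lam})).
Qed.

Lemma linear_funZ (F : Lam -> Lam) (k : C) a : linear F -> F (k *: a) = k *: F a.
Proof.
move=> Flin; pose h := GRing.isLinear.Build C Lam Lam _ F Flin.
exact: (linearZ_LR (HB.pack F h : {linear Lam -> Lam})).
Qed.

Lemma dx_morphM m F : dx_morph m F -> forall a b, F (a * b) = F a * F b.
Proof.
move=> [Flin F1 Fdx] a b; elim/Lam_ind : a => [k a c IHa IHc||i a IH].
- by rewrite mulrDl -scalerAl !Flin mulrDl -scalerAl IHa IHc.
- by rewrite F1 !mul1r.
- by rewrite -mulrA !Fdx IH mulrA.
Qed.

Lemma dx_morph_uniq m F G : dx_morph m F -> dx_morph m G -> F =1 G.
Proof.
move=> [Flin F1 Fdx] [Glin G1 Gdx]; elim/Lam_ind => [k a c IHa IHc||i a IH].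
- by rewrite Flin Glin IHa IHc.
- by rewrite F1 G1.
- by rewrite Fdx Gdx IH.
Qed.

Lemma dx_morph_dx m F i : dx_morph m F -> F (dx i) = m i.
Proof. by move=> [_ F1 Fdx]; rewrite -[dx i]mulr1 Fdx F1 mulr1. Qed.

Lemma dx_morph_cov m F v : dx_morph m F -> F (cov v) = \sum_i v i *: m i.
Proof.
move=> Fm; rewrite cov_sum; have [Flin _ _] := Fm.
rewrite linear_fun_sum//; apply: eq_bigr => i _.
by rewrite linear_funZ// (dx_morph_dx _ Fm).
Qed.

Lemma dx_morph_comp m m' F G : dx_morph m F -> dx_morph m' G ->
  dx_morph (G \o m) (G \o F).
Proof.
move=> [Flin F1 Fdx] Gm; have [Glin G1 _] := Gm; split.
- by move=> k a b; rewrite /= Flin Glin.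
- by rewrite /= F1 G1.
- by move=> i b; rewrite /= Fdx (dx_morphM Gm).
Qed.

Lemma eq_dx_morph m m' F : m =1 m' -> dx_morph m F -> dx_morph m' F.
Proof. by move=> mm' [? ? Fdx]; split=> // i b; rewrite Fdx mm'. Qed.

Section Substitution.
Variable m : 'I_8 -> Lam.
Hypothesis m_anti : forall i j, m i * m j = - (m j * m i).
Hypothesis m_sqr : forall i, m i * m i = 0.

(** In an increasing list, moving m i to its place costs one sign for each
    smaller index, and meets m i itself when i belongs to S. *)
Let prod_insert_seq i S (r : seq 'I_8) : sorted ltn (map val r) -> i \in r ->
  m i * \prod_(k <- r | k \in S) m k =
  if i \in S then 0 else
    (\prod_(k <- r | k \in S) transp_sign R i k) *:
      \prod_(k <- r | k \in (i |: S)%SET) m k.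
Proof.
elim: r => // j r IH /= pr; rewrite inE => ijr.
have sr : sorted ltn (map val r) by exact: path_sorted pr.
have jr k : k \in r -> (j < k)%N.
  by move=> kr; have /allP := order_path_min ltn_trans pr; apply; apply: map_f.
have [ij|nij] := eqVneq i j.
  rewrite -ij !big_cons !inE eqxx /=.
  case: ifP => iS; first by rewrite mulrA m_sqr mul0r.
  rewrite [X in X *: _]big1_seq ?scale1r; last first.
    move=> k /andP[_ kr]; rewrite /transp_sign ltnNge ltnW ?ij ?jr//.
  congr (_ * _); rewrite big_seq_cond [RHS]big_seq_cond; apply: eq_bigl => k.
  apply: andb_id2l => kr.
  by rewrite !inE; case: eqP => // ki; have := jr _ kr; rewrite ki ij ltnn.
have ir : i \in r by move: ijr; rewrite (negbTE nij).
rewrite !big_cons !inE [j == i]eq_sym (negbTE nij) /=.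
case: ifP => jS; last exact: IH.
rewrite mulrA m_anti mulNr -mulrA IH//; case: ifP => iS.
  by rewrite mulr0 oppr0.
by rewrite /transp_sign jr// -scalerAr mulN1r scaleNr.
Qed.

Lemma prod_insert i S : m i * \prod_(k in S) m k =
  if i \in S then 0 else insert_sign i S *: \prod_(k in (i |: S)%SET) m k.
Proof.
apply: prod_insert_seq; last exact: mem_index_enum.
by rewrite [index_enum _]unlock -enumT val_enum_ord iota_ltn_sorted.
Qed.

(** Universal property of the exterior algebra: an anticommuting family extends
    to an algebra endomorphism. *)
Definition subst_dx a : Lam := \sum_S a S *: \prod_(k in S) m k.

Lemma subst_dx_linear : linear subst_dx.
Proof.
move=> k a b; rewrite /subst_dx scaler_sumr -big_split; apply: eq_bigr => S _.
by rewrite /= !ffunE scalerDl scalerA.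
Qed.

Lemma subst_dxP : dx_morph m subst_dx.
Proof.
have H S : subst_dx (dxs S) = \prod_(k in S) m k.
  rewrite /subst_dx (bigD1 S)//=; rewrite ffunE eqxx scale1r [X in _ + X]big1 ?addr0// => T TS.
  by rewrite ffunE (negbTE TS) scale0r.
split; first exact: subst_dx_linear.
  by rewrite -dxs0 H big_set0.
move=> i b; have slin := subst_dx_linear.
rewrite (dxs_sum b) mulr_sumr !(linear_fun_sum _ slin) mulr_sumr.
apply: eq_bigr => S _; rewrite -(scalerAr (b S) (dx i) (dxs S)).
apply: (etrans (linear_funZ (b S) (dx i * dxs S) slin)); apply/esym.
apply: (etrans (congr1 ( *%R (m i)) (linear_funZ (b S) (dxs S) slin))).
rewrite -(scalerAr (b S) (m i)); congr (_ *: _); apply/esym.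
rewrite H prod_insert dx_dxs; case: ifP => iS; last first.
  by apply: (etrans (linear_funZ _ _ slin)); rewrite H.
rewrite -[X in subst_dx X](scale0r (0 : Lam)).
by apply: (etrans (linear_funZ _ _ slin)); rewrite scale0r.
Qed.

End Substitution.

(** The algebra endomorphism that substitutes dx_i - xi for dx_i.  It has this
    simple form because xi /\ xi = 0. *)
Definition shear (xi : 'I_8 -> C) i a : Lam := a - cov xi * contr i a.

Lemma shearP xi i : dx_morph (fun j => dx j - (i == j)%:R *: cov xi) (shear xi i).
Proof.
split.
- move=> k a b; rewrite /shear linearP mulrDr -scalerAr scalerBr.
  by rewrite opprD addrACA.
- by rewrite /shear contr1 mulr0 subr0.
move=> j b; rewrite /shear contr_dx mulrBr mulrBl mulrBr.
rewrite -!scalerAl -scalerAr !mulrBr (mulrA (cov xi) (cov xi)) cov_sqr mul0r subr0.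
by rewrite (mulrA (dx j)) (mulrA (cov xi)) (cov_anticomm xi) mulNr opprK opprD addrA addrAC.
Qed.

End ExteriorGenerators.

#[global] Opaque cov dx dxs contr.

(** * Bidegrees *)

Section Bidegree.
Variable R : realType.
Local Notation C := R[i].
Local Notation Lam := (Lam R).
Implicit Types (J : 'M[R]_8) (S T U : {set 'I_8}) (a b c : Lam) (s t : C).

(** A polynomial function that vanishes at all s has more roots than its degree
    allows in characteristic 0. *)
Lemma coef_eq0_of_vanish n (c : 'I_n -> C) :
  (forall s, \sum_(i < n) s ^+ i * c i = 0) -> forall i, c i = 0.
Proof.
move=> H i; pose p := \poly_(j < n) (if insub j is Some j' then c j' else 0).
have pE j : p`_(val j) = c j by rewrite coef_poly ltn_ord valK.
suff p0 : p = 0 by rewrite -pE p0 coef0.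
apply/eqP; apply: contraT => pN0.
have := @max_poly_roots _ p [seq k%:R | k <- iota 0 (size p)] pN0.
rewrite size_map size_iota ltnn map_inj_uniq ?iota_uniq; last exact: mulrIn (oner_neq0 _).
apply=> //; apply/allP => _ /mapP[k _ ->]; apply/rootP.
rewrite horner_poly -[RHS](H k%:R); apply: eq_bigr => j _.
by rewrite valK mulrC.
Qed.

Lemma coef2_eq0_of_vanish m n (A : 'I_m -> 'I_n -> Lam) :
  (forall s t, \sum_(p < m) \sum_(q < n) (s ^+ p * t ^+ q) *: A p q = 0) ->
  forall p q, A p q = 0.
Proof.
move=> H p q; apply/ffunP => S; rewrite lam0E.
suff E : forall t, \sum_(q < n) t ^+ q * A p q S = 0 by exact: (coef_eq0_of_vanish E).
move=> t; apply: (@coef_eq0_of_vanish _ (fun p => \sum_(q < n) t ^+ q * A p q S)) => s.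
have /ffunP/(_ S) := H s t; rewrite lam0E sum_ffunE => E; rewrite -[RHS]E.
apply: eq_bigr => p' _; rewrite sum_ffunE mulr_sumr; apply: eq_bigr => q' _.
by rewrite lamZE mulrA.
Qed.

Lemma prod_eq0_of_mem (I : eqType) (r : seq I) (F : I -> Lam) i :
  i \in r -> F i = 0 -> \prod_(j <- r) F j = 0.
Proof.
move=> + Fi0; elim: r => // j r IH; rewrite inE big_cons => /orP[/eqP <-|/IH ->].
  by rewrite Fi0 mul0r.
by rewrite mulr0.
Qed.

(** The expansion of a product of sums, kept in the order of the indices since
    the factors do not commute. *)
Lemma prodD_in S (F G : 'I_8 -> Lam) :
  \prod_(k in S) (F k + G k) =
  \sum_(T : {set 'I_8} | T \subset S) \prod_(k in S) (if k \in T then F k else G k).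
Proof.
rewrite big_mkcond.
rewrite (eq_bigr (fun k => (if k \in S then F k else 0) + (if k \in S then G k else 1))).
  rewrite bigA_distr [RHS]big_mkcond; apply: eq_bigr => T _.
  case: ifPn => [TS|/fintype.subsetPn[k kT kS]].
    rewrite [RHS]big_mkcond; apply: eq_bigr => k _.
    by case: ifP => kT; case: ifP => // kS; rewrite (fintype.subsetP TS k kT) in kS.
  by apply: (@prod_eq0_of_mem _ _ _ k); rewrite ?mem_index_enum// kT (negbTE kS).
by move=> k _; case: ifP => _; rewrite ?add0r.
Qed.

(** The substitution that multiplies the (1,0) forms by s and the (0,1) forms
    by t.  It is the generating function of the projections on the types,
    sum_(p, q) s^p t^q pi_(p,q) ([type_scaling_expand]): identities between the
    projections follow from identities between algebra endomorphisms, which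
    only need a check on the dx_k. *)
Definition type_scaling J s t : Lam -> Lam :=
  subst_dx (fun k => s *: (dx10 J k : Lam) + t *: (dx01 J k : Lam)).

Let alpha s t : C := (s + t) / 2.
Let beta s t : C := 'i%C * (t - s) / 2.

Lemma cov_linear (k : C) (v w : 'I_8 -> C) :
  cov (fun j => k * v j + w j) = k *: cov v + cov w.
Proof.
apply/ffunP => S; rewrite lamDE lamZE !covE mulr_sumr -big_split /=.
by [].
Qed.

Lemma type_scaling_dx J s t k :
  s *: (dx10 J k : Lam) + t *: (dx01 J k : Lam) =
  cov (fun j => alpha s t * (j == k)%:R + beta s t * (J j k)%:C).
Proof.
apply/ffunP => S; rewrite lamDE !lamZE covE /dx10 /dx01 /covec !ffunE !mulr_sumr -big_split /=; apply: eq_bigr => i _.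
by rewrite /alpha /beta; field.
Qed.

Lemma type_scalingP J s t :
  dx_morph (fun k => cov (fun j => alpha s t * (j == k)%:R + beta s t * (J j k)%:C))
    (type_scaling J s t).
Proof.
rewrite /type_scaling.
pose m k : Lam := cov (fun j => alpha s t * (j == k)%:R + beta s t * (J j k)%:C).
rewrite -/m (_ : (fun k => _) = m :> ('I_8 -> Lam)); last first.
  by apply/boolp.funext => k; exact: type_scaling_dx.
by apply: subst_dxP => [i j|i]; [exact: cov_anticomm|exact: cov_sqr].
Qed.

Lemma type_scaling_cov J s t v : type_scaling J s t (cov v) =
  cov (fun j => alpha s t * v j + beta s t * \sum_k (J j k)%:C * v k).
Proof.
rewrite (dx_morph_cov _ (type_scalingP J s t)).
apply/ffunP => S; rewrite sum_ffunE covE.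
under eq_bigr do rewrite lamZE covE mulr_sumr.
rewrite exchange_big; apply: eq_bigr => i _ /=.
rewrite mulr_sumr (bigD1 i)//= [in RHS](bigD1 i)//= addrA eqxx; congr (_ + _). by rewrite mulr1; ring.
apply: eq_bigr => k; rewrite eq_sym => /negbTE ->.
by rewrite mulr0 add0r; ring.
Qed.

Lemma type_scaling_expand J s t a : type_scaling J s t a =
  \sum_(p < 9) \sum_(q < 9) (s ^+ p * t ^+ q) *: (ext_bidegree J p q a : Lam).
Proof.
have E p q : (ext_bidegree J p q a : Lam) = \sum_(S : {set 'I_8})
     \sum_(T : {set 'I_8} | [&& T \subset S, #|T| == p & #|S :\: T|%SET == q])
       a S *: \prod_(k in S) (if k \in T then dx10 J k : Lam else dx01 J k).
  apply/ffunP => U; rewrite ffunE sum_ffunE; apply: eq_bigr => S _.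
  by rewrite sum_ffunE; apply: eq_bigr => T _; rewrite lamZE.
rewrite /type_scaling /subst_dx.
under [RHS]eq_bigr => p _.
  under eq_bigr => q _ do rewrite E scaler_sumr.
  rewrite exchange_big; over.
rewrite exchange_big; apply: eq_bigr => S _ /=.
rewrite prodD_in scaler_sumr.
under [RHS]eq_bigr => p _.
  under eq_bigr => q _ do rewrite scaler_sumr big_mkcondr.
  rewrite exchange_big; over.
rewrite exchange_big; apply: eq_bigr => T TS /=.
have lt9 U : (#|U| < 9)%N by rewrite ltnS (leq_trans (max_card _))// card_ord.
rewrite (bigD1 (Ordinal (lt9 T)))//= [X in _ + X]big1 ?addr0; last first.
  move=> p; rewrite -val_eqE /= eq_sym => /negbTE pT; rewrite big1// => q _.
  by rewrite pT.
rewrite (bigD1 (Ordinal (lt9 (S :\: T)%SET)))//= [X in _ + X]big1 ?addr0; last first.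
  by move=> q; rewrite -val_eqE /= eq_sym => /negbTE ->; rewrite andbF.
rewrite !eqxx /= scalerA mulrC -scalerA; congr (_ *: _).
transitivity (\prod_(k in S) ((if k \in T then s else t) *:
    (if k \in T then dx10 J k : Lam else dx01 J k))).
  by apply: eq_bigr => k _; case: ifP.
rewrite scaler_prod; congr (_ *: _).
rewrite (bigID (mem T)) /=; congr (_ * _).
  rewrite -prodr_const; apply: eq_big => k /=; last by move=> /andP[_ ->].
  by rewrite andb_idl//; apply: (fintype.subsetP TS).
rewrite -prodr_const; apply: eq_big => k /=; last by move=> /andP[_ /negbTE ->].
by rewrite !inE andbC.
Qed.

Definition has_type J p q a :=
  forall s t, type_scaling J s t a = (s ^+ p * t ^+ q) *: a.

(** Comparison of the coefficients of s^p t^q in [type_scaling_expand]. *)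
Lemma has_type_bidegree J p q p' q' a : has_type J p q a ->
  (p < 9)%N -> (q < 9)%N -> (p' < 9)%N -> (q' < 9)%N ->
  ext_bidegree J p' q' a = if (p' == p) && (q' == q) then a else 0.
Proof.
move=> aT p9 q9 p'9 q'9.
apply/eqP; rewrite -subr_eq0; apply/eqP.
pose A (i j : 'I_9) : Lam :=
  (ext_bidegree J i j a : Lam) - if (val i == p) && (val j == q) then a else 0.
apply: (@coef2_eq0_of_vanish _ _ A _ (Ordinal p'9) (Ordinal q'9)) => s t.
under eq_bigr do (under eq_bigr do rewrite scalerBr; rewrite sumrB).
rewrite sumrB -type_scaling_expand aT (bigD1 (Ordinal p9))//= [X in _ - (_ + X)]big1 ?addr0.
  rewrite (bigD1 (Ordinal q9))//= [X in _ - (_ + X)]big1 ?addr0 ?eqxx ?subrr//.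
  by move=> j; rewrite -val_eqE /= => /negbTE ->; rewrite ?andbF scaler0.
move=> i; rewrite -val_eqE /= => /negbTE ->; rewrite big1// => j _.
by rewrite scaler0.
Qed.

Lemma has_type_lin J p q (k : C) a b :
  has_type J p q a -> has_type J p q b -> has_type J p q (k *: a + b).
Proof.
move=> aT bT s t; have [lin _ _] := type_scalingP J s t.
by rewrite lin aT bT scalerDr !scalerA [k * _]mulrC.
Qed.

Lemma has_type0 J p q : has_type J p q 0.
Proof.
move=> s t; have [lin _ _] := type_scalingP J s t.
by rewrite -[0](scale0r (0 : Lam)) (linear_funZ _ _ lin) !scale0r scaler0.
Qed.

Lemma has_type1 J : has_type J 0 0 1.
Proof. by move=> s t; have [_ -> _] := type_scalingP J s t; rewrite mulr1 scale1r. Qed.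

Lemma has_typeZ J p q (k : C) a : has_type J p q a -> has_type J p q (k *: a).
Proof. by move=> aT; rewrite -[_ *: _]addr0; apply: has_type_lin (has_type0 _ _ _). Qed.

Lemma has_typeD J p q a b :
  has_type J p q a -> has_type J p q b -> has_type J p q (a + b).
Proof. by move=> aT bT; rewrite -[a]scale1r; apply: has_type_lin. Qed.

Lemma has_typeM J p q p' q' a b : has_type J p q a -> has_type J p' q' b ->
  has_type J (p + p') (q + q') (a * b).
Proof.
move=> aT bT s t; rewrite (dx_morphM (type_scalingP J s t)) aT bT.
by rewrite -scalerAl -scalerAr scalerA; congr (_ *: _); rewrite !exprD; ring.
Qed.

Lemma covZ (k : C) (v : 'I_8 -> C) : cov (fun j => k * v j) = k *: cov v.
Proof.
by apply/ffunP => S; rewrite lamZE !covE mulr_sumr.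
Qed.

Lemma has_type10 J v : (forall j, \sum_k (J j k)%:C * v k = 'i%C * v j) ->
  has_type J 1 0 (cov v).
Proof.
move=> Jv s t; rewrite type_scaling_cov expr1 expr0 mulr1 -covZ; congr cov.
apply/boolp.funext => j; rewrite Jv /alpha /beta mulrA -mulrDl; congr (_ * _).
by field: (sqr_i R).
Qed.

Lemma has_type01 J v : (forall j, \sum_k (J j k)%:C * v k = - 'i%C * v j) ->
  has_type J 0 1 (cov v).
Proof.
move=> Jv s t; rewrite type_scaling_cov expr1 expr0 mul1r -covZ; congr cov.
apply/boolp.funext => j; rewrite Jv /alpha /beta mulrA -mulrDl; congr (_ * _).
by field: (sqr_i R).
Qed.

(** Naturality of the types: a substitution that intertwines two complex
    structures intertwines the generating functions, hence each projection. *)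
Lemma bidegree_morph J J' n F p q a : dx_morph n F ->
  (forall s t k, type_scaling J s t (n k) = F (type_scaling J' s t (dx R k))) ->
  (p < 9)%N -> (q < 9)%N ->
  ext_bidegree J p q (F a) = F (ext_bidegree J' p q a).
Proof.
move=> Fn H p9 q9; have [Flin _ _] := Fn.
apply/eqP; rewrite -subr_eq0; apply/eqP.
pose A (i j : 'I_9) : Lam :=
  (ext_bidegree J i j (F a) : Lam) - F (ext_bidegree J' i j a).
apply: (@coef2_eq0_of_vanish _ _ A _ (Ordinal p9) (Ordinal q9)) => s t.
under eq_bigr do (under eq_bigr do rewrite scalerBr; rewrite sumrB).
rewrite sumrB -type_scaling_expand; apply/eqP; rewrite subr_eq0; apply/eqP.
have E : type_scaling J s t \o F =1 F \o type_scaling J' s t.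
  apply: (dx_morph_uniq (dx_morph_comp Fn (type_scalingP J s t))).
  have := dx_morph_comp (type_scalingP J' s t) Fn; apply: eq_dx_morph => k /=.
  by rewrite -(dx_morph_dx k (type_scalingP J' s t)) H.
have /= -> := E a; rewrite type_scaling_expand (linear_fun_sum _ Flin).
apply: eq_bigr => i _; rewrite (linear_fun_sum _ Flin); apply: eq_bigr => j _.
exact: linear_funZ.
Qed.

Lemma ext_bidegree_linear J p q : linear (ext_bidegree J p q : Lam -> Lam).
Proof.
move=> k a b; apply/ffunP => U; rewrite lamDE lamZE !ffunE mulr_sumr -big_split.
apply: eq_bigr => S _; rewrite mulr_sumr -big_split /=; apply: eq_bigr => T _.
by rewrite lamDE lamZE mulrDl mulrA.
Qed.

End Bidegree.

(** * The left-invariant frame, complex structure and metrics *)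

Section LeftInvariantFrame.
Variable R : realType.
Local Notation C := R[i].
Local Notation Lam := (Lam R).
Local Notation G := 'rV[R]_8.
Implicit Types (x c p v : G) (i j k : 'I_8).

Definition iz : 'I_8 := inord 6.
Definition it : 'I_8 := inord 7.

(** The coefficient of dy_j in the 1-form x . dy, that is x_j, at the index of
    y_j, and 0 at the other indices. *)
Definition xdy x i : R := if (3 <= i < 6)%N then x 0 (inord (i - 3)) else 0.

(** The k-th row is the left-invariant field E_k at x: e_k, except for
    E_(y_j) = e_(y_j) + x_j e_z.  It is also the matrix of the differential of
    the left translation by x.  As the second summand squares to 0,
    [frame] is additive in x ([frameM]), which makes its inverse and the
    invariance properties immediate. *)
Definition frame x : 'M[R]_8 := 1%:M + \matrix_(i, k) (xdy x i * (k == iz)%:R).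

Lemma xdyD x y i : xdy (x + y) i = xdy x i + xdy y i.
Proof. by rewrite /xdy; case: ifP; rewrite ?mxE ?addr0. Qed.

Lemma xdyN x i : xdy (- x) i = - xdy x i.
Proof. by rewrite /xdy; case: ifP; rewrite ?mxE ?oppr0. Qed.

Lemma xdy_iz x : xdy x iz = 0.
Proof. by rewrite /xdy inordK. Qed.

Lemma xdy_ebase_iz (k : R) i : xdy (k *: delta_mx 0 (inord 6)) i = 0.
Proof.
rewrite /xdy; case: ifP => // /andP[i3 i6]; rewrite !mxE.
have lt3 : (i - 3 < 6)%N by rewrite (leq_ltn_trans (leq_subr _ _)).
rewrite (_ : (inord (i - 3) == inord 6 :> 'I_8) = false) ?andbF ?mulr0//.
apply/negbTE; rewrite -(inj_eq val_inj) /= !inordK ?neq_ltn ?lt3//.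
exact: ltn_trans lt3 _.
Qed.

Lemma frameM x y : frame x *m frame y = frame (x + y).
Proof.
rewrite /frame mulmxDl mulmxDr mulmxDr !mul1mx mulmx1.
rewrite (_ : _ *m \matrix_(_, _) _ = 0) ?addr0; last first.
  apply/matrixP => i k; rewrite !mxE big1// => l _; rewrite !mxE.
  by have [->|] := eqVneq l iz; rewrite ?xdy_iz ?(mul0r, mulr0).
rewrite -addrA; congr (_ + _); apply/matrixP => i k.
by rewrite !mxE xdyD mulrDl addrC.
Qed.

Lemma frame0 : frame 0 = 1%:M.
Proof.
apply/matrixP => i k; rewrite !mxE /xdy.
by case: ifP; rewrite ?mxE mul0r addr0.
Qed.

Lemma frameK x : frame (- x) *m frame x = 1%:M.
Proof. by rewrite frameM addNr frame0. Qed.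

Lemma frameVK x : frame x *m frame (- x) = 1%:M.
Proof. by rewrite frameM subrr frame0. Qed.

Lemma mul_frame v x : v *m frame x = v + (\sum_i v 0 i * xdy x i) *: delta_mx 0 iz.
Proof.
rewrite mulmxDr mulmx1; congr (_ + _); apply/rowP => k; rewrite !mxE /=.
by rewrite mulr_suml; apply: eq_bigr => i _; rewrite mxE mulrA.
Qed.

Lemma hbilE c v : hbil c v = \sum_i v 0 i * xdy c i.
Proof.
rewrite /hbil mxE !big_ord_recl !big_ord0 !mxE /xdy /=.
rewrite !mulr0 !add0r !addr0 !addrA.
by congr (_ + _ + _); rewrite mulrC; congr (v 0 _ * c 0 _); apply: val_inj; rewrite /= ?inordK.
Qed.

Lemma hmul_frame c v : hmul c v = c + v *m frame c.
Proof. by rewrite mul_frame addrA -hbilE. Qed.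

Lemma frame_hmul c x : frame (hmul c x) = frame c *m frame x.
Proof.
rewrite frameM /frame; congr (_ + _); apply/matrixP => i k; rewrite !mxE.
by rewrite /hmul xdyD xdy_ebase_iz addr0.
Qed.

(** J maps E_i to Jsign i E_(partner i): X_0, X_1 to Y_0, Y_1, but X_2 to -Y_2,
    and Z to T.  The sign at index 2 is what makes balanced and Gauduchon
    metrics possible. *)
Definition partner i : 'I_8 := inord (nth 0%N [:: 3; 4; 5; 0; 1; 2; 7; 6]%N i).
Definition Jsign i : R := nth 0 [:: 1; 1; -1; -1; -1; 1; 1; -1] i.

Lemma ord8P (P : 'I_8 -> Prop) :
  P (inord 0) -> P (inord 1) -> P (inord 2) -> P (inord 3) ->
  P (inord 4) -> P (inord 5) -> P (inord 6) -> P (inord 7) -> forall i, P i.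
Proof.
move=> ? ? ? ? ? ? ? ? i; rewrite -(inord_val i).
by case: i => -[|[|[|[|[|[|[|[|//]]]]]]]].
Qed.

Lemma sum_ord8 (V : zmodType) (f : 'I_8 -> V) :
  \sum_i f i = f (inord 0) + f (inord 1) + f (inord 2) +
    f (inord 3) + f (inord 4) + f (inord 5) + f (inord 6) + f (inord 7).
Proof.
rewrite !big_ord_recl big_ord0 addr0 !addrA.
by do ![congr (_ + _)|congr f]; apply: val_inj; rewrite /= inordK.
Qed.

Lemma partnerK i : partner (partner i) = i.
Proof. by apply: val_inj; elim/ord8P : i; rewrite /partner /= !inordK//= !inordK. Qed.

Lemma Jsign_partner i : Jsign (partner i) = - Jsign i.
Proof. by elim/ord8P : i; rewrite /Jsign /partner !inordK //= opprK. Qed.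

Lemma Jsign_sqr i : Jsign i * Jsign i = 1.
Proof. by elim/ord8P : i; rewrite /Jsign !inordK //= ?mulrNN mulr1. Qed.

Lemma eq_partner i j : (i == partner j) = (j == partner i).
Proof. by apply/eqP/eqP => ->; rewrite partnerK. Qed.

Definition Jframe : 'M[R]_8 := \matrix_(i, j) (Jsign i *+ (j == partner i)).

Lemma row_mulJframe n (A : 'M[R]_(n, 8)) (i : 'I_n) j :
  (A *m Jframe) i j = - Jsign j * A i (partner j).
Proof.
rewrite !mxE (bigD1 (partner j))//= big1 ?addr0 => [|k kj].
  by rewrite mxE partnerK eqxx mulr1n Jsign_partner mulrC.
by rewrite mxE eq_partner (negbTE kj) mulr0.
Qed.

Lemma mulJframe n (A : 'M[R]_(8, n)) i (j : 'I_n) :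
  (Jframe *m A) i j = Jsign i * A (partner i) j.
Proof.
rewrite !mxE (bigD1 (partner i))//= big1 ?addr0 => [|k /negbTE kj].
  by rewrite mxE eqxx mulr1n.
by rewrite mxE kj mul0r.
Qed.

Lemma Jframe_sqr : Jframe *m Jframe = - 1%:M.
Proof.
apply/matrixP => i j; rewrite mulJframe !mxE partnerK Jsign_partner eq_sym.
by case: eqVneq; rewrite ?mulr0n ?mulr0 ?oppr0// mulr1n mulrN Jsign_sqr.
Qed.

Definition Jfield x : 'M[R]_8 := frame (- x) *m Jframe *m frame x.

Lemma Jfield_sqr x : Jfield x *m Jfield x = - 1%:M.
Proof.
rewrite /Jfield -!mulmxA (mulmxA (frame x) (frame (- x))) frameVK mul1mx.
by rewrite (mulmxA Jframe) Jframe_sqr mulNmx mul1mx mulmxN frameK.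
Qed.

Variable m : 'I_8 -> R.

(** The metric in which the E_i are orthogonal with squared lengths m i. *)
Definition gfield x : 'M[R]_8 :=
  frame (- x) *m diag_mx (\row_i m i) *m (frame (- x))^T.

Lemma bil_gfield x u v : bil (gfield x) u v =
  \sum_i m i * (u *m frame (- x)) 0 i * (v *m frame (- x)) 0 i.
Proof.
rewrite /bil /gfield !mulmxA -mulmxA -trmx_mul mxE; apply: eq_bigr => i _.
by rewrite mul_mx_diag mxE [(_^T) _ _]mxE [(\row__ _) _ _]mxE [_ * m i]mulrC.
Qed.

Lemma gfield_sym x u v : bil (gfield x) u v = bil (gfield x) v u.
Proof. by rewrite !bil_gfield; apply: eq_bigr => i _; rewrite mulrAC. Qed.

Hypothesis m_gt0 : forall i, 0 < m i.
Hypothesis m_partner : forall i, m (partner i) = m i.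

Lemma gfield_pos x v : v != 0 -> 0 < bil (gfield x) v v.
Proof.
move=> v0; have w0 : v *m frame (- x) != 0.
  by apply: contraNneq v0 => E; rewrite -[v]mulmx1 -(frameK x) mulmxA E mul0mx.
have [i wi] : exists i, (v *m frame (- x)) 0 i != 0.
  apply/existsP; apply: contraNT w0; rewrite negb_exists => /forallP w0.
  by apply/eqP/rowP => i; rewrite [RHS]mxE; apply/eqP; have := w0 i; rewrite negbK.
rewrite bil_gfield (bigD1 i)//= ltr_wpDr//.
  apply: sumr_ge0 => j _; rewrite -mulrA mulr_ge0 ?(ltW (m_gt0 _))//.
  by rewrite -expr2 sqr_ge0.
by rewrite -mulrA mulr_gt0// -expr2 exprn_even_gt0.
Qed.

Lemma gfield_J x u v : bil (gfield x) (u *m Jfield x) (v *m Jfield x) = bil (gfield x) u v.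
Proof.
have E w : w *m Jfield x *m frame (- x) = w *m frame (- x) *m Jframe.
  by rewrite /Jfield !mulmxA -[_ *m frame x *m _]mulmxA frameVK mulmx1.
rewrite !bil_gfield !E (reindex_inj (can_inj partnerK)) /=.
apply: eq_bigr => i _; rewrite !row_mulJframe partnerK m_partner Jsign_partner opprK.
by ring: (Jsign_sqr i).
Qed.

Lemma frameC x y : frame x *m frame y = frame y *m frame x.
Proof. by rewrite !frameM addrC. Qed.

Lemma frameN_hmul c x : frame (- hmul c x) = frame (- c) *m frame (- x).
Proof.
rewrite frameM /frame; congr (_ + _); apply/matrixP => i k; rewrite !mxE.
by rewrite !(xdyN, xdyD) xdy_ebase_iz addr0 opprD.
Qed.

Lemma Jfield_invariant c x v :
  v *m frame c *m Jfield (hmul c x) = v *m Jfield x *m frame c.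
Proof.
rewrite /Jfield frameN_hmul frame_hmul (frameC c x) !mulmxA.
by rewrite -[v *m _ *m _]mulmxA frameVK mulmx1.
Qed.

Lemma gfield_invariant c x u v :
  bil (gfield (hmul c x)) (u *m frame c) (v *m frame c) = bil (gfield x) u v.
Proof.
rewrite !bil_gfield; apply: eq_bigr => i _.
by rewrite frameN_hmul !mulmxA -![_ *m frame c *m _]mulmxA frameVK !mulmx1.
Qed.

End LeftInvariantFrame.

(** * Left-invariant forms *)

(** Products of linear combinations of three commuting elements of square zero,
    for the (1,1) forms dx_j /\ dy_j.  Stating them in any algebra keeps the
    exterior algebra folded. *)
Lemma square_zero_mul (K : comNzRingType) (A : algType K) (s0 s1 s2 : A)
    (a0 a1 a2 b0 b1 b2 : K) :
  s0 * s0 = 0 -> s1 * s1 = 0 -> s2 * s2 = 0 ->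
  s1 * s0 = s0 * s1 -> s2 * s0 = s0 * s2 -> s2 * s1 = s1 * s2 ->
  (a0 *: s0 + a1 *: s1 + a2 *: s2) * (b0 *: s0 + b1 *: s1 + b2 *: s2) =
  (a0 * b1 + a1 * b0) *: (s0 * s1) + (a0 * b2 + a2 * b0) *: (s0 * s2) +
  (a1 * b2 + a2 * b1) *: (s1 * s2).
Proof.
move=> s00 s11 s22 s10 s20 s21; rewrite !(mulrDl, mulrDr) -!scalerAl -!scalerAr.
rewrite s00 s11 s22 s10 s20 s21 !scaler0 !scalerA !scalerDl add0r !addr0.
by rewrite [X in X + _]addrACA -[LHS]addrA [X in _ + X]addrACA addrA.
Qed.

Lemma square_zero_mul3 (K : comNzRingType) (A : algType K) (s0 s1 s2 : A)
    (a0 a1 a2 b0 b1 b2 c0 c1 c2 : K) :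
  s0 * s0 = 0 -> s1 * s1 = 0 -> s2 * s2 = 0 ->
  s1 * s0 = s0 * s1 -> s2 * s0 = s0 * s2 -> s2 * s1 = s1 * s2 ->
  (a0 *: s0 + a1 *: s1 + a2 *: s2) * (b0 *: s0 + b1 *: s1 + b2 *: s2) *
    (c0 *: s0 + c1 *: s1 + c2 *: s2) =
  ((a0 * b1 + a1 * b0) * c2 + (a0 * b2 + a2 * b0) * c1 +
   (a1 * b2 + a2 * b1) * c0) *: (s0 * s1 * s2).
Proof.
move=> s00 s11 s22 s10 s20 s21; rewrite square_zero_mul//.
rewrite !(mulrDl, mulrDr) -!scalerAl -!scalerAr.
have -> : s0 * s1 * s0 = 0 by rewrite -mulrA s10 mulrA s00 mul0r.
have -> : s0 * s2 * s0 = 0 by rewrite -mulrA s20 mulrA s00 mul0r.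
have -> : s1 * s2 * s1 = 0 by rewrite -mulrA s21 mulrA s11 mul0r.
have -> : s1 * s2 * s0 = s0 * s1 * s2 by rewrite -mulrA s20 mulrA s10.
have -> : s0 * s2 * s1 = s0 * s1 * s2 by rewrite -mulrA s21 mulrA.
rewrite -![_ * _ * s1]mulrA -![_ * _ * s2]mulrA s11 s22 !mulr0 !scaler0 !scalerA.
by rewrite !addr0 !add0r -!scalerDl; congr (_ *: _); ring.
Qed.

Lemma square_add_square_zero (K : comNzRingType) (A : algType K) (F e : A) :
  e * F = F * e -> e * e = 0 -> (F + e) * (F + e) = F * F + 2 *: (F * e).
Proof.
move=> eF e0; rewrite mulrDl !mulrDr e0 addr0 eF -addrA.
by rewrite -{1 2}[F * e]scale1r -scalerDl.
Qed.

Lemma cube_add_square_zero (K : comNzRingType) (A : algType K) (F e : A) :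
  e * F = F * e -> e * e = 0 ->
  (F + e) * ((F + e) * (F + e)) = F * (F * F) + 3 *: (F * F * e).
Proof.
move=> eF e0; rewrite square_add_square_zero// mulrDl !mulrDr -!scalerAr.
rewrite (mulrA e F e) eF -(mulrA F e e) e0 mulr0 scaler0 addr0.
rewrite !mulrA eF -(mulrA F e F) eF mulrA -addrA; congr (_ + _).
by rewrite -[X in _ + X]scale1r -scalerDl natr1.
Qed.

Lemma mul_square_eq0 (K : comNzRingType) (A : algType K) (k : K) (s F e : A) :
  s * F = 0 ->
  ((k *: s) * (F * F + 2 *: (F * e)) = 0) * ((k *: (s * (2 *: F))) * e = 0).
Proof.
move=> sF; split; rewrite -?scalerAl ?mulrDr -!scalerAr ?mulrA sF ?mul0r.
  by rewrite ?mul0r !scaler0 ?addr0 ?scaler0.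
by rewrite !scaler0 mul0r ?scaler0.
Qed.

Section InvariantForms.
Variable R : realType.
Local Notation C := R[i].
Local Notation Lam := (Lam R).
Local Notation G := 'rV[R]_8.
Local Notation Jc := (Jframe R).
Local Notation dx := (dx R).
Implicit Types (x : G) (i j k : 'I_8) (a b c u v : Lam).

(** Forms of even degree in the horizontal directions: they commute with all
    forms, and iota_Z passes through them. *)
Definition central_horizontal u :=
  (forall c, u * c = c * u) /\ (forall c, contr iz (u * c) = u * contr iz c).

Lemma central_horizontal_lin (k : C) u v : central_horizontal u -> central_horizontal v -> central_horizontal (k *: u + v).
Proof.
move=> [uC uI] [vC vI]; split=> c.
  by rewrite mulrDl mulrDr -scalerAl -scalerAr uC vC.
by rewrite !mulrDl -!scalerAl linearP /= uI vI.
Qed.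

Lemma central_horizontal1 : central_horizontal 1.
Proof. by split=> c; rewrite !mul1r ?mulr1. Qed.

Lemma central_horizontal0 : central_horizontal 0.
Proof. by split=> c; rewrite !mul0r ?mulr0 ?linear0. Qed.

Lemma central_horizontalZ (k : C) u : central_horizontal u -> central_horizontal (k *: u).
Proof. by move=> uI; rewrite -[_ *: _]addr0; apply: central_horizontal_lin central_horizontal0. Qed.

Lemma central_horizontalM u v : central_horizontal u -> central_horizontal v -> central_horizontal (u * v).
Proof.
move=> [uC uI] [vC vI]; split=> c.
  by rewrite -mulrA vC mulrA uC mulrA.
by rewrite -!mulrA uI vI.
Qed.

Lemma contr_central_horizontal u : central_horizontal u -> contr iz u = 0.
Proof. by move=> [_ uI]; rewrite -[u]mulr1 uI contr1 mulr0. Qed.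

Lemma dx_dx_central i j c : dx i * dx j * c = c * (dx i * dx j).
Proof.
elim/Lam_ind : c => [k a b IHa IHb||k a IH]; last 2 first.
- by rewrite mulr1 mul1r.
- rewrite -(mulrA (dx k)) -IH !mulrA; congr (_ * a).
  by rewrite -mulrA (dx_anticomm _ j k) mulrN mulrA (dx_anticomm _ i k) mulNr opprK.
- by rewrite mulrDr mulrDl -scalerAr -scalerAl IHa IHb.
Qed.

(** The area form of the complex line spanned by the frame vectors of index i
    and [partner i]. *)
Definition dxx i : Lam := dx i * dx (partner i).

Lemma dxx_central i c : dxx i * c = c * dxx i.
Proof. exact: dx_dx_central. Qed.

Lemma dxx_partner i : dxx (partner i) = - dxx i.
Proof. by rewrite /dxx partnerK dx_anticomm. Qed.

Lemma dxx_sqr i : dxx i * dxx i = 0.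
Proof.
rewrite /dxx mulrA -(mulrA (dx i)) (dx_anticomm _ _ i) mulrN mulrA dx_sqr.
by rewrite mul0r oppr0 mul0r.
Qed.

Lemma central_horizontal_dxx i : i != iz -> partner i != iz -> central_horizontal (dxx i).
Proof.
move=> /negbTE iN /negbTE pN; split=> [c|c]; first exact: dxx_central.
rewrite /dxx -mulrA !contr_dx [iz == i]eq_sym iN [iz == partner i]eq_sym pN.
by rewrite !scale0r !sub0r mulrN opprK mulrA.
Qed.

Lemma type_scaling_dx1 (s t : C) i : type_scaling Jc s t (dx i) =
  ((s + t) / 2) *: dx i - ('i%C * (t - s) / 2 * (Jsign R i)%:C) *: dx (partner i).
Proof.
rewrite (dx_morph_dx i (type_scalingP Jc s t)) -scaleNr.
rewrite -(covZ (- _) (fun j => (j == partner i)%:R)) -cov_linear; congr cov; apply/boolp.funext => j; congr (_ + _); rewrite !mxE eq_partner.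
have [->|] := eqVneq j (partner i); last by rewrite mulr0n !mulr0.
by rewrite mulr1n mulr1 Jsign_partner rmorphN mulrN.
Qed.

(** On the plane of dx_i and its partner, scaling the types by s and t is a
    linear map of determinant s t. *)
Lemma dxx_type i : has_type Jc 1 1 (dxx i).
Proof.
move=> s t; rewrite /dxx (dx_morphM (type_scalingP Jc s t)) !type_scaling_dx1.
rewrite partnerK Jsign_partner rmorphN mulrN scaleNr opprK !expr1.
set al := (s + t) / 2; set be := 'i%C * (t - s) / 2 * _.
rewrite mulrDr !mulrBl -!scalerAl -!scalerAr !dx_sqr !scaler0 subr0 add0r.
rewrite [dx (partner i) * dx i]dx_anticomm !scalerN opprK.
rewrite !scalerA -scalerDl; congr (_ *: _).
have := Jsign_sqr R i; move/(congr1 (real_complex R)); rewrite rmorphM rmorph1 => J2.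
by rewrite /al /be; field: (sqr_i R) J2.
Qed.

(** The 2-form of an antisymmetric matrix of coefficients; the factor 1/2
    compensates for each pair of indices being met twice. *)
Definition form2 (W : 'M[C]_8) : Lam :=
  2^-1 *: \sum_i \sum_j W i j *: (dx i * dx j).

Lemma dx_morph_form2 (P : 'M[C]_8) F W :
  dx_morph (fun k => cov (fun j => P j k)) F -> F (form2 W) = form2 (P *m W *m P^T).
Proof.
move=> Fm; have [Flin _ _] := Fm.
rewrite /form2 (linear_funZ _ _ Flin); congr (_ *: _).
have E : forall k, F (dx k) = \sum_i P i k *: dx i.
  by move=> k; rewrite (dx_morph_dx k Fm) cov_sum.
transitivity (\sum_k \sum_l \sum_i \sum_j (P i k * W k l * P j l) *: (dx i * dx j)).
  rewrite (linear_fun_sum _ Flin); apply: eq_bigr => k _.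
  rewrite (linear_fun_sum _ Flin); apply: eq_bigr => l _.
  rewrite (linear_funZ _ _ Flin) (dx_morphM Fm) (E k) (E l).
  rewrite mulr_suml scaler_sumr; apply: eq_bigr => i _.
  rewrite mulr_sumr scaler_sumr; apply: eq_bigr => j _.
  by rewrite -scalerAl -scalerAr !scalerA; congr (_ *: _); ring.
under eq_bigr do rewrite exchange_big; rewrite exchange_big /=.
apply: eq_bigr => i _.
under eq_bigr do rewrite exchange_big; rewrite exchange_big /=.
apply: eq_bigr => j _; rewrite exchange_big mxE scaler_suml /=.
apply: eq_bigr => l _; rewrite !mxE mulr_suml scaler_suml.
by apply: eq_bigr => k _.
Qed.

Local Notation JC := (map_mx (real_complex R) Jc).

Lemma JC_sqr : JC *m JC = - 1%:M.
Proof. by rewrite -map_mxM Jframe_sqr map_mxN map_mx1. Qed.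

(** The scaling of types acts on 1-forms by Q = al + be J, so on the matrix by
    W -> Q W Q^T, which is (s t) W when J W J^T = W. *)
Lemma form2_type W : JC *m W *m JC^T = W -> has_type Jc 1 1 (form2 W).
Proof.
move=> JW s t; rewrite !expr1.
pose al : C := (s + t) / 2; pose be : C := 'i%C * (t - s) / 2.
have JW' : W *m JC^T = - (JC *m W).
  by rewrite -[in RHS]JW !mulmxA JC_sqr !mulNmx opprK mul1mx.
pose Q := al%:M + be *: JC.
have Qm : dx_morph (fun k => cov (fun j => Q j k)) (type_scaling Jc s t).
  apply: (eq_dx_morph _ (type_scalingP Jc s t)) => k; congr cov; apply/boolp.funext => j.
  by rewrite !mxE -[al *+ _]mulr_natr.
rewrite (dx_morph_form2 _ Qm) (_ : Q *m W *m Q^T = (s * t) *: W); last first.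
  have QW : Q *m W = al *: W + be *: (JC *m W).
    by rewrite mulmxDl mul_scalar_mx -scalemxAl.
  rewrite QW linearD linearZ /= tr_scalar_mx mulmxDr mul_mx_scalar -scalemxAr.
  rewrite mulmxDl -!scalemxAl JW JW'; move: (JC *m W) => X.
  by apply/matrixP => i j; rewrite !mxE /al /be; field: (sqr_i R).
rewrite /form2 !scaler_sumr; apply: eq_bigr => i _.
rewrite !scaler_sumr; apply: eq_bigr => j _.
by rewrite mxE !scalerA; congr (_ *: _); ring.
Qed.

Lemma contr_dx_dx k i j :
  contr k (dx i * dx j) = (k == i)%:R *: dx j - (k == j)%:R *: dx i.
Proof.
have E : contr k (dx j) = (k == j)%:R *: 1.
  by have := contr_dx k j (1 : Lam); rewrite mulr1 contr1 mulr0 subr0.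
by rewrite contr_dx E -scalerAr mulr1.
Qed.

Lemma contr_form2 W : W^T = - W -> contr iz (form2 W) = cov (fun j => W iz j).
Proof.
move=> Wa; have WE i j : W j i = - W i j.
  by have /matrixP/(_ i j) := Wa; rewrite !mxE.
rewrite /form2 linearZ linear_sum /=.
have E i : contr iz (\sum_j W i j *: (dx i * dx j)) =
    \sum_j (W i j * (iz == i)%:R) *: dx j - (W i iz) *: dx i.
  rewrite linear_sum /=.
  transitivity (\sum_j ((W i j * (iz == i)%:R) *: dx j - (W i j * (iz == j)%:R) *: dx i)).
    apply: eq_bigr => j _; rewrite linearZ /= contr_dx_dx scalerBr.
    by apply: (congr2 (fun b c : Lam => b - c)); apply: scalerA.
  rewrite big_split sumrN /=; congr (_ - _).
  rewrite (bigD1 iz)//= eqxx mulr1 big1 ?addr0// => j.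
  by rewrite eq_sym => /negbTE ->; rewrite mulr0 scale0r.
under eq_bigr do rewrite E.
rewrite sumrB exchange_big /= cov_sum.
have E2 j : \sum_i (W i j * (iz == i)%:R) *: dx j = W iz j *: dx j.
  rewrite (bigD1 iz)//= eqxx mulr1 big1 ?addr0// => i.
  by rewrite eq_sym => /negbTE ->; rewrite mulr0 scale0r.
under eq_bigr do rewrite E2.
rewrite -sumrB scaler_sumr; apply: eq_bigr => j _.
rewrite [W j iz]WE scaleNr opprK -scalerDl scalerA; congr (_ *: _).
by field.
Qed.

(** hor w = sum_j w_j dx_j /\ partner(dx_j).  Since the partner of dx_j is
    dy_j for j < 3, whatever the sign in J, this is sum_j w_j dx_j /\ dy_j, and
    [sigma] is the exterior derivative of - zeta. *)
Definition hor (w : 'I_3 -> C) : Lam := \sum_(j < 3) w j *: dxx (inord j).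
Definition sigma : Lam := hor (fun=> 1).

Lemma central_horizontal_hor w : central_horizontal (hor w).
Proof.
rewrite /hor; elim/big_rec : _ => [|j u _ uI]; first exact: central_horizontal0.
apply: central_horizontal_lin uI; apply: central_horizontal_dxx; rewrite -(inj_eq val_inj);
  by case: j => -[|[|[|//]]] /= _; rewrite /partner /= !inordK//= !inordK.
Qed.

Lemma hor_type w : has_type Jc 1 1 (hor w).
Proof.
rewrite /hor; elim/big_rec : _ => [|j u _ uT]; first exact: has_type0.
exact: has_type_lin (dxx_type _) uT.
Qed.

(** The exterior derivative of a form with constant coefficients in the
    left-invariant coframe, where dx_6 stands for zeta. *)
Definition dframe a : Lam := - sigma * contr iz a.

Lemma dframe_linear : linear dframe.
Proof. by move=> k a b; rewrite /dframe linearP /= mulrDr -scalerAr. Qed.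

(** The part of [dframe] that changes the type (p, q) into (r p, s q): with the
    successor in one place and the identity in the other, it is del or delbar. *)
Definition proj_dframe (r s : nat -> nat) a : Lam :=
  \sum_(p < 5) \sum_(q < 5)
    ext_bidegree Jc (r p) (s q) (dframe (ext_bidegree Jc p q a)).

Definition delframe a : Lam := proj_dframe S id a.
Definition delbarframe a : Lam := proj_dframe id S a.

Let bideg_dframe0 p q : ext_bidegree Jc p q (dframe 0) = 0 :> Lam.
Proof.
have E : dframe 0 = 0 by rewrite /dframe linear0 mulr0.
rewrite E -[X in ext_bidegree _ _ _ X](scale0r (0 : Lam)).
by apply: (etrans (linear_funZ _ _ (ext_bidegree_linear _ _ _))); rewrite scale0r.
Qed.

Lemma proj_dframe_type r s p q a : has_type Jc p q a -> (p < 5)%N -> (q < 5)%N ->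
  proj_dframe r s a = ext_bidegree Jc (r p) (s q) (dframe a).
Proof.
move=> aT p5 q5; have lt9 (i : 'I_5) : (i < 9)%N by exact: ltn_trans (ltn_ord i) _.
have E (i j : 'I_5) : ext_bidegree Jc i j a =
    if (val i == p) && (val j == q) then a else 0.
  by apply: has_type_bidegree; rewrite ?lt9// (ltn_trans _ (isT : (5 < 9)%N)).
rewrite /proj_dframe (bigD1 (Ordinal p5))//= [X in _ + X]big1 ?addr0; last first.
  move=> i; rewrite -val_eqE /= => /negbTE ip; apply: big1 => j _.
  by rewrite E ip bideg_dframe0.
rewrite (bigD1 (Ordinal q5))//= [X in _ + X]big1 ?addr0.
  by rewrite (E (Ordinal p5) (Ordinal q5)) /= !eqxx.
move=> j; rewrite -val_eqE /= => /negbTE jq.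
by rewrite (E (Ordinal p5)) /= jq andbF bideg_dframe0.
Qed.

Lemma sum_Jc (v : 'I_8 -> C) j :
  \sum_k (Jc j k)%:C * v k = (Jsign R j)%:C * v (partner j).
Proof.
rewrite (bigD1 (partner j))//= big1 ?addr0 => [|k /negbTE kj].
  by rewrite mxE eqxx mulr1n.
by rewrite mxE kj mulr0n mul0r.
Qed.

Lemma covD (v w : 'I_8 -> C) : cov (fun j => v j + w j) = cov v + cov w.
Proof. by apply/ffunP => S; rewrite lamDE !covE -big_split. Qed.

Lemma cov_split (lam : 'I_8 -> C) : exists l10 l01 : 'I_8 -> C,
  [/\ cov lam = cov l10 + cov l01, has_type Jc 1 0 (cov l10),
      has_type Jc 0 1 (cov l01) & l01 iz = (lam iz + 'i%C * lam it) / 2].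
Proof.
have J2 j : (Jsign R j)%:C * (Jsign R j)%:C = 1 :> C.
  by rewrite -rmorphM Jsign_sqr rmorph1.
have JN j : (Jsign R (partner j))%:C = - (Jsign R j)%:C :> C.
  by rewrite Jsign_partner rmorphN.
exists (fun j => 2^-1 * (lam j - 'i%C * ((Jsign R j)%:C * lam (partner j)))).
exists (fun j => 2^-1 * (lam j + 'i%C * ((Jsign R j)%:C * lam (partner j)))).
split.
- by rewrite -covD; congr cov; apply/boolp.funext => j; field.
- apply: has_type10 => j; rewrite sum_Jc partnerK JN.
  have := J2 j; move: (Jsign R j)%:C (lam j) (lam (partner j)) => s l l' s2.
  by field: (sqr_i R) s2.
- apply: has_type01 => j; rewrite sum_Jc partnerK JN.
  have := J2 j; move: (Jsign R j)%:C (lam j) (lam (partner j)) => s l l' s2.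
  by field: (sqr_i R) s2.
rewrite mulrC; congr ((_ + _ * _) / _).
rewrite /Jsign inordK//= rmorph1 mul1r; congr lam.
by apply: val_inj; rewrite /partner /= !inordK.
Qed.

(** With lambda = l10 + l01, delbar a = - sigma /\ u /\ l01 for reasons of
    type.  Its contraction with Z only sees l01(Z) = (lambda(Z) + i lambda(T)) / 2,
    as u and sigma are horizontal. *)
Lemma deldelbarframe r u (lam : 'I_8 -> C) a : (r < 3)%N ->
  central_horizontal u -> has_type Jc r r u -> has_type Jc r.+1 r.+1 a ->
  contr iz a = u * cov lam ->
  delframe (delbarframe a) =
    ((lam iz + 'i%C * lam it) / 2) *: (sigma * sigma * u).
Proof.
move=> r3 uI uT aT ca.
have lt5 : (r.+2 < 5)%N by rewrite !ltnS.
have lt5' : (r.+1 < 5)%N by exact: ltnW.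
have lt9 : (r.+2 < 9)%N by exact: ltn_trans lt5 _.
have lt9' : (r.+1 < 9)%N by exact: ltnW.
have [l10 [l01 [lE T10 T01 <-]]] := cov_split lam.
have sT : has_type Jc r.+1 r.+1 (- sigma * u).
  rewrite -scaleN1r -[r.+1]add1n -scalerAl; apply: has_typeZ.
  by apply: has_typeM uT; exact: hor_type.
have E1 : dframe a = - sigma * u * cov l10 + - sigma * u * cov l01.
  by rewrite /dframe ca lE mulrA mulrDr.
have T1 : has_type Jc r.+2 r.+1 (- sigma * u * cov l10).
  by rewrite -[r.+2]addn1 -[X in has_type _ _ X]addn0; apply: has_typeM.
have T2 : has_type Jc r.+1 r.+2 (- sigma * u * cov l01).
  by rewrite -[r.+2]addn1 -[X in has_type _ X]addn0; apply: has_typeM.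
have E2 : delbarframe a = - sigma * u * cov l01.
  rewrite /delbarframe (proj_dframe_type _ _ aT)// E1.
  rewrite -[X in ext_bidegree _ _ _ (X + _)]scale1r.
  apply: (etrans (ext_bidegree_linear _ _ _ _ _ _)).
  rewrite (has_type_bidegree T1)//.
  rewrite (has_type_bidegree T2)//.
  by rewrite !eqxx ltn_eqF// scaler0 add0r.
have sI := central_horizontal_hor (fun=> 1); have [sC sH] := sI; have [uC uH] := uI.
have E3 : dframe (- sigma * u * cov l01) = l01 iz *: (sigma * sigma * u).
  rewrite /dframe -!mulrA !mulNr linearN /= sH uH -[cov l01]mulr1 contr_cov contr1.
  by rewrite mulr0 subr0 mulrN opprK -!scalerAr mulr1.
rewrite E2 /delframe (proj_dframe_type _ _ T2)// E3.
have sgT : has_type Jc 1 1 sigma by exact: hor_type.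
have ssuT : has_type Jc r.+2 r.+2 (sigma * sigma * u).
  exact: (has_typeM (has_typeM sgT sgT) uT).
have T3 := has_typeZ (l01 iz) ssuT.
by rewrite (has_type_bidegree T3)// !eqxx.
Qed.

Lemma sum_ord3 (f : 'I_3 -> Lam) :
  \sum_(j < 3) f j = f (inord 0) + f (inord 1) + f (inord 2).
Proof.
rewrite !big_ord_recl big_ord0 addr0 addrA.
by congr (f _ + f _ + f _); apply: val_inj; rewrite /= inordK.
Qed.

Lemma hor_mul3 (w1 w2 w3 : 'I_3 -> C) :
  let i0 := inord 0 : 'I_3 in let i1 := inord 1 : 'I_3 in let i2 := inord 2 : 'I_3 in
  hor w1 * hor w2 * hor w3 =
   ((w1 i0 * w2 i1 + w1 i1 * w2 i0) * w3 i2 +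
    (w1 i0 * w2 i2 + w1 i2 * w2 i0) * w3 i1 +
    (w1 i1 * w2 i2 + w1 i2 * w2 i1) * w3 i0) *:
   (dxx (inord 0) * dxx (inord 1) * dxx (inord 2)).
Proof.
move=> i0 i1 i2.
have E w : hor w =
    w i0 *: dxx (inord 0) + w i1 *: dxx (inord 1) + w i2 *: dxx (inord 2).
  by rewrite /hor sum_ord3 !inordK.
rewrite !E; apply: square_zero_mul3; rewrite ?dxx_sqr//; exact: dxx_central.
Qed.

Lemma contr_dxx_iz : contr iz (dxx iz) = dx it.
Proof.
have p67 : partner iz = it by apply: val_inj; rewrite /partner /= !inordK.
rewrite /dxx p67 contr_dx_dx eqxx scale1r (_ : (iz == it) = false) ?scale0r ?subr0//.
by apply/negbTE; rewrite -(inj_eq val_inj) /= !inordK.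
Qed.

Section ConstantMetric.
Variable w : 'I_3 -> C.
Let F : Lam := hor w.
Let eta : Lam := dxx iz.
(** The fundamental form of a diagonal metric for which Z and T are unit
    vectors. *)
Definition Omega_frame : Lam := hor w + dxx iz.
Local Notation Om := Omega_frame.

Let etaF : eta * F = F * eta. Proof. by case: (central_horizontal_hor w) => ->. Qed.

Let Om2 : Om * Om = F * F + 2 *: (F * eta).
Proof. exact: square_add_square_zero etaF (dxx_sqr _). Qed.

Let Om3 : Om * (Om * Om) = F * (F * F) + 3 *: (F * F * eta).
Proof. exact: cube_add_square_zero etaF (dxx_sqr _). Qed.

Let e1 : C := w (inord 0) + w (inord 1) + w (inord 2).
Let e2 : C := w (inord 0) * w (inord 1) + w (inord 0) * w (inord 2) +
  w (inord 1) * w (inord 2).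

(** As zeta /\ dt squares to zero, iota_Z Omega^3 = 3 F^2 /\ dt, and
    sigma /\ F^2 = 2 e2(w) times the volume form of the horizontal space. *)
Lemma dframe_Omega3 : e2 = 0 -> dframe (Om * (Om * (Om * 1))) = 0.
Proof.
move=> e20; have FI := central_horizontal_hor w; have [FFC FFH] := central_horizontalM FI FI.
have s2 : sigma * (F * F) = 0.
  rewrite mulrA /sigma /F hor_mul3 /=.
  rewrite (_ : _ + _ + _ = 2 * e2); last by rewrite /e2; ring.
  by rewrite e20 mulr0 scale0r.
rewrite mulr1 Om3 /dframe linearD linearZ /= FFH contr_dxx_iz.
rewrite (contr_central_horizontal (central_horizontalM FI (central_horizontalM FI FI))) add0r -scalerAr mulNr mulrA s2.
by rewrite mul0r oppr0 scaler0.
Qed.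

Lemma Omega_frame_type : has_type Jc 1 1 Om.
Proof. exact: has_typeD (hor_type _) (dxx_type _). Qed.

(** del delbar Omega and del delbar Omega^2 are multiples of sigma^2 and of
    sigma^2 /\ F; after the wedge product with the complementary power of Omega,
    the factor sigma^2 /\ F = 2 e1(w) vol remains. *)
Lemma ddc_Omega_wedge (k : nat) : e1 = 0 -> k = 1%N \/ k = 2%N ->
  delframe (delbarframe (iter k ( *%R Om) 1)) * iter (4 - k - 1) ( *%R Om) 1 = 0.
Proof.
move=> e10 k12; have FI := central_horizontal_hor w; have [FC FH] := FI.
have s2 : sigma * sigma * F = 0.
  rewrite /sigma /F hor_mul3 /=.
  rewrite (_ : _ + _ + _ = 2 * e1); last by rewrite /e1; ring.
  by rewrite e10 mulr0 scale0r.
have T := Omega_frame_type; have T2 := has_typeM T T.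
case: k12 => -> /=; rewrite !mulr1.
  have -> := @deldelbarframe 0 1 (fun j => (j == it)%:R) Om _ central_horizontal1 (@has_type1 _ _) T.
  - rewrite Om2 [sigma * sigma * 1]mulr1; exact: (mul_square_eq0 _ eta s2).1.
  - by [].
  - by rewrite mul1r linearD /= (contr_central_horizontal FI) add0r contr_dxx_iz.
have FT : has_type Jc 1 1 (2 *: F) by exact/has_typeZ/hor_type.
have -> := @deldelbarframe 1 (2 *: F) (fun j => (j == it)%:R) (Om * Om) _ (central_horizontalZ _ FI) FT T2.
- exact: (mul_square_eq0 _ Om s2).2.
- by [].
rewrite Om2 linearD linearZ /= !FH (contr_central_horizontal FI) mulr0 add0r contr_dxx_iz.
by rewrite -scalerAl.
Qed.

End ConstantMetric.

End InvariantForms.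

(** * Forms in the left-invariant coframe *)

Section FramedForms.
Variable R : realType.
Local Notation C := R[i].
Local Notation Lam := (Lam R).
Local Notation G := 'rV[R]_8.
Local Notation Jc := (Jframe R).
Local Notation dx := (dx R).
Implicit Types (x : G) (i j k : 'I_8) (a b c u : Lam).

(** The form at x whose coefficients in the left-invariant coframe are those of
    a: the substitution of zeta = dz - x . dy for dz. *)
Definition framed x a : Lam := shear (fun i => (xdy x i)%:C) iz a.

Lemma framedP x :
  dx_morph (fun k => cov (fun j => (frame (- x) j k)%:C)) (framed x).
Proof.
apply: (eq_dx_morph _ (shearP _ _)) => k.
rewrite -scaleNr -covZ -covD; congr cov; apply/boolp.funext => j.
rewrite !mxE xdyN rmorphD rmorphM rmorphN !rmorph_nat mulrC mulrN mulNr.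
by rewrite [k == iz]eq_sym.
Qed.

Lemma dx_dx_at i j (S : {set 'I_8}) : (dx i * dx j) S =
  if (i != j) && (S == [set i; j]%SET) then transp_sign R i j else 0.
Proof.
rewrite dx_wedgeE.
rewrite dxE.
have [iS|iS] := boolP (i \in S); last first.
  case: ifP => // /andP[_ /eqP SE]; by rewrite SE !inE eqxx in iS.
have [SE|SN] := eqVneq (S :\ i)%SET [set j]%SET.
  have ij : i != j by apply/eqP => ijE; have := finset.setD11 i S; rewrite SE inE ijE eqxx.
  rewrite ij SE -[X in _ == (X : {set 'I_8})]/([set i] :|: [set j])%SET -SE.
  by rewrite finset.setD1K// eqxx SE /insert_sign big_set1 mulr1.
rewrite mulr0; case: ifP => // /andP[ij /eqP SE].
by move: SN; rewrite SE finset.setU1K ?inE// eqxx.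
Qed.

(** The definition of the fundamental form sums over i < j; the antisymmetry of
    J g turns it into half of the sum over all pairs. *)
Lemma fundamental_formE (J g : G -> 'M[R]_8) x :
  (J x *m g x)^T = - (J x *m g x) ->
  fundamental_form J g x = form2 (map_mx (real_complex R) (J x *m g x)).
Proof.
move=> Jga; set W := J x *m g x.
have Wa i j : W j i = - W i j.
  by have /matrixP/(_ i j) := Jga; rewrite !mxE.
have bilE i j : bil (g x) (ebase R i *m J x) (ebase R j) = W i j.
  rewrite /bil -mulmxA /ebase trmx_delta -rowE -colE !mxE.
  by apply: eq_bigr => k _; rewrite !mxE.
apply/ffunP => S; rewrite ffunE lamZE sum_ffunE.
pose f i j : C := if (i < j)%N && (S == [set i; j]%SET) then (W i j)%:C else 0.
have E i : (\sum_j (map_mx (real_complex R) W i j) *: (dx i * dx j)) S =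
    \sum_j f i j + \sum_j f j i.
  rewrite sum_ffunE -big_split /=; apply: eq_bigr => j _.
  rewrite lamZE dx_dx_at mxE /f /transp_sign (finset.setUC [set j]%SET).
  rewrite -(inj_eq val_inj) /=; case: ltngtP => //= ij.
  - rewrite add0r; case: ifP; rewrite ?mulr0//.
    by rewrite mulrN1 [in RHS]Wa rmorphN.
  - by rewrite addr0; case: ifP; rewrite ?mulr0 ?mulr1.
  - by rewrite mulr0 addr0.
under [in RHS]eq_bigr do rewrite E.
rewrite big_split /= [X in _ + X]exchange_big /=.
have half (z : C) : 2^-1 * (z + z) = z by field.
rewrite half; apply: eq_bigr => i _.
by rewrite big_mkcond; apply: eq_bigr => j _; rewrite /f bilE.
Qed.

Lemma dx_morph_mx_cov (P : 'M[C]_8) F (v : 'I_8 -> C) :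
  dx_morph (fun k => cov (fun j => P j k)) F ->
  F (cov v) = cov (fun j => \sum_k P j k * v k).
Proof.
move=> Fm; rewrite (dx_morph_cov _ Fm); apply/ffunP => S.
rewrite sum_ffunE covE; under eq_bigr do rewrite lamZE covE mulr_sumr.
rewrite exchange_big; apply: eq_bigr => i _ /=.
by apply: eq_bigr => k _; rewrite mulrC.
Qed.

Lemma framed_mxP x :
  dx_morph (fun k => cov (fun j => map_mx (real_complex R) (frame (- x)) j k)) (framed x).
Proof. by apply: (eq_dx_morph _ (framedP x)) => k; congr cov; apply/boolp.funext => j; rewrite [RHS]mxE. Qed.

(** [framed x] intertwines the constant structure of the Lie algebra with the
    structure at x, so it preserves types. *)
Lemma bidegree_framed x p q a : (p < 9)%N -> (q < 9)%N ->
  ext_bidegree (Jfield x) p q (framed x a) = framed x (ext_bidegree Jc p q a).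
Proof.
move=> p9 q9; apply: (bidegree_morph a (framedP x)) => // s t k.
rewrite (dx_morph_dx k (type_scalingP Jc s t)) (dx_morph_mx_cov _ (framed_mxP x)).
rewrite type_scaling_cov; congr cov; apply/boolp.funext => j.
have FJ : Jfield x *m frame (- x) = frame (- x) *m Jc.
  by rewrite /Jfield -!mulmxA frameVK mulmx1.
have -> : \sum_l (Jfield x j l)%:C * (frame (- x) l k)%:C =
    \sum_l (frame (- x) j l)%:C * (Jc l k)%:C.
  have /matrixP/(_ j k)/(congr1 (real_complex R)) := FJ.
  rewrite !mxE !rmorph_sum => E; rewrite -[RHS](eq_bigr _ (fun l _ => rmorphM _ _ _)).
  by rewrite -[LHS](eq_bigr _ (fun l _ => rmorphM _ _ _)).
under [RHS]eq_bigr do rewrite mxE mulrDr.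
rewrite big_split /=; congr (_ + _); last first.
  by rewrite mulr_sumr; apply: eq_bigr => l _; rewrite mulrCA.
rewrite (bigD1 k)//= eqxx mulr1 mulrC big1 ?addr0// => l /negbTE ->.
by rewrite !mulr0.
Qed.

Lemma framed_fundamental_form (J g : G -> 'M[R]_8) x :
  (J x *m g x)^T = - (J x *m g x) ->
  fundamental_form J g x = framed x (form2 (map_mx (real_complex R)
    (frame x *m (J x *m g x) *m (frame x)^T))).
Proof.
move=> Jga; rewrite fundamental_formE// (dx_morph_form2 _ (framed_mxP x)).
congr form2; rewrite map_trmx -!map_mxM; congr (map_mx _ _).
by rewrite !mulmxA frameK mul1mx -!mulmxA -trmx_mul frameK trmx1 mulmx1.
Qed.

Lemma framedM x a b : framed x (a * b) = framed x a * framed x b.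
Proof. exact: dx_morphM (framedP x) a b. Qed.

Lemma framed1 x : framed x 1 = 1.
Proof. by case: (framedP x). Qed.

Lemma framed_linear x : linear (framed x).
Proof. by case: (framedP x). Qed.

End FramedForms.

(** * Directional derivatives and smooth functions *)

Local Open Scope classical_set_scope.

Section DirectionalDerivatives.
Variables (R : realType) (V : normedModType R).
Implicit Types (f : V -> R) (x y u v : V).

(** The mean value theorem between 0 and k of either sign: flows are followed in
    both directions. *)
Lemma mvt_sym (phi dphi : R -> R) (k : R) :
  (forall s : R, is_derive s 1 phi (dphi s)) ->
  exists2 xi, `|xi| <= `|k| & phi k - phi 0 = dphi xi * k.
Proof.
move=> D; have cphi : continuous phi.
  move=> s; apply/differentiable_continuous/derivable1_diffP.
  exact: (@ex_derive _ _ _ _ _ _ _ (D s)).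
have wc a b : {within `[a, b], continuous phi} by exact: continuous_subspaceT.
have [k0|k0] := leP 0 k.
  have [xi] := MVT_segment k0 (fun z _ => D z) (wc 0 k).
  rewrite in_itv /= => /andP[xi0 xik] ->; exists xi; last by rewrite subr0.
  by rewrite !ger0_norm.
have [xi] := MVT_segment (ltW k0) (fun z _ => D z) (wc k 0).
rewrite in_itv /= => /andP[kxi xi0] E; exists xi.
  by rewrite !ler0_norm ?(ltW k0)// lerN2.
by rewrite -opprB E sub0r mulrN opprK.
Qed.

Lemma is_derive_line f y u : (forall x, derivable f x u) ->
  forall s : R, is_derive s 1 (fun s : R => f (y + s *: u)) ('D_u f (y + s *: u)).
Proof.
move=> df s; have E : (fun h : R => h^-1 *: (((fun s : R => f (y + s *: u)) \o shift s) (h *: 1) -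
    f (y + s *: u))) = (fun h => h^-1 *: ((f \o shift (y + s *: u)) (h *: u) - f (y + s *: u))).
  apply/funext => h /=; congr (_ *: (f _ - _)).
  have -> : h *: (1 : R) = h by exact: mulr1.
  by rewrite scalerDl addrCA.
apply: DeriveDef; first by rewrite /derivable E; exact: df.
by rewrite /derive E.
Qed.

(** The directional derivative is additive as soon as one of the two
    derivatives is continuous: the increment in the direction u is taken at a
    moving base point, and the mean value theorem evaluates it. *)
Lemma is_derive_add f x u v (c d : R) :
  (forall y, derivable f y u) -> {for x, continuous (fun y => 'D_u f y)} ->
  is_derive x v f d -> is_derive x (c *: u + v) f (c * 'D_u f x + d).
Proof.
move=> df cf [dv dE].
suff H : (fun h => h^-1 *: ((f \o shift x) (h *: (c *: u + v)) - f x)) @ 0^'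
    --> c * 'D_u f x + d.
  by apply: DeriveDef; [exact: cvgP H|exact: cvg_lim H].
have -> : (fun h => h^-1 *: ((f \o shift x) (h *: (c *: u + v)) - f x)) =
    (fun h => h^-1 * (f (x + h *: v + (h * c) *: u) - f (x + h *: v))) +
    (fun h => h^-1 *: ((f \o shift x) (h *: v) - f x)).
  apply/funext => h; change (h^-1 * (f (h *: (c *: u + v) + x) - f x) =
    h^-1 * (f (x + h *: v + (h * c) *: u) - f (x + h *: v)) +
    h^-1 * (f (h *: v + x) - f x)).
  rewrite -mulrDr [h *: v + x]addrC addrA addrNK scalerDr scalerA.
  by rewrite [_ + _ + x]addrC [(h * c) *: u + _]addrC addrA.
apply: cvgD; last by rewrite -dE; exact: dv.
apply/cvgrPdist_lt => e e0.
have e1 : 0 < e / (`|c| + 1) by rewrite divr_gt0// ltr_wpDl.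
have /cvgrPdist_lt/(_ _ e1)/nbhs_ballP[del /= del0 Hd] := cf.
pose K := `|v| + `|c| * `|u| + 1.
have K0 : 0 < K by rewrite ltr_wpDl// addr_ge0// mulr_ge0.
near=> h.
have hN0 : h != 0 by near: h; exact: nbhs_dnbhs_neq.
have hs : `|h| < del / K by near: h; apply: dnbhs0_lt; rewrite divr_gt0.
have [xi xile] := mvt_sym (h * c) (@is_derive_line f (x + h *: v) u df).
rewrite scale0r addr0 => ->.
rewrite [h^-1 * _](_ : _ = c * 'D_u f (x + h *: v + xi *: u)); last by field.
rewrite -mulrBr normrM.
have /Hd/= : ball x del (x + h *: v + xi *: u).
  rewrite -ball_normE /= -addrA opprD addNKr.
  rewrite normrN (le_lt_trans (ler_normD _ _))// !normrZ.
  rewrite (@le_lt_trans _ _ (`|h| * K))//; last by rewrite -ltr_pdivlMr.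
  rewrite /K mulrDr mulrDr ler_wpDr ?mulr1// lerD2l mulrA -normrM.
  by rewrite ler_wpM2r.
move=> /ltW H; rewrite (@le_lt_trans _ _ (`|c| * (e / (`|c| + 1))))//.
  by rewrite ler_wpM2l.
by rewrite mulrCA gtr_pMr// ltr_pdivrMr ?mul1r ?ltrDl// ltr_wpDl.
Unshelve. all: by end_near.
Qed.

End DirectionalDerivatives.

Section Smooth.
Variable R : realType.
Local Notation G := 'rV[R]_8.
Implicit Types (f g : G -> R) (x v : G) (i j k : 'I_8) (n : nat).

Definition smooth f := smooth_on setT f.
Local Notation Ck n f := (Ck_on n setT f).

Lemma Ck_continuous n f : Ck n f -> continuous f.
Proof. by case: n => [|n] [fc _] x; exact: fc. Qed.

Lemma Ck_derivable n f i x : Ck n.+1 f -> derivable f x (ebase R i).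
Proof. by move=> [_ /(_ i)[fd _]]; exact: fd. Qed.

Lemma Ck_derive n f i : Ck n.+1 f -> Ck n (fun x => 'D_(ebase R i) f x).
Proof. by move=> [_ /(_ i)[]]. Qed.

Lemma CkW n f : Ck n.+1 f -> Ck n f.
Proof.
elim: n f => [|n IH] f [fc fd]; split=> // i; split; first by case: (fd i).
by apply: IH; case: (fd i).
Qed.

Lemma Ck_cst n (c : R) : Ck n (fun=> c).
Proof.
elim: n c => [|n IH] c; split=> //.
- by move=> x _; exact: cst_continuous.
- by move=> x _; exact: cst_continuous.
move=> i; split=> [x _|]; first exact: derivable_cst.
rewrite (_ : (fun x : G => _ : R) = (fun=> 0)); first exact: IH.
by apply/funext => x; exact: derive_cst.
Qed.

Lemma CkD n f g : Ck n f -> Ck n g -> Ck n (fun x => f x + g x).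
Proof.
elim: n f g => [|n IH] f g Cf Cg;
  have cf := Ck_continuous Cf; have cg := Ck_continuous Cg; split=> //.
- by move=> x _; apply: (continuousD (cf x) (cg x)).
- by move=> x _; apply: (continuousD (cf x) (cg x)).
move=> i; split=> [x _|].
  by exact: (derivableD (Ck_derivable Cf) (Ck_derivable Cg)).
rewrite (_ : (fun x : G => _ : R) = (fun x => 'D_(ebase R i) f x + 'D_(ebase R i) g x)).
  by apply: IH; exact: Ck_derive.
by apply/funext => x; exact: (deriveD (Ck_derivable Cf) (Ck_derivable Cg)).
Qed.

Lemma CkM n f g : Ck n f -> Ck n g -> Ck n (fun x => f x * g x).
Proof.
elim: n f g => [|n IH] f g Cf Cg;
  have cf := Ck_continuous Cf; have cg := Ck_continuous Cg; split=> //.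
- by move=> x _; apply: (continuousM (cf x) (cg x)).
- by move=> x _; apply: (continuousM (cf x) (cg x)).
move=> i; split=> [x _|].
  by exact: (derivableM (Ck_derivable Cf) (Ck_derivable Cg)).
rewrite (_ : (fun x => _) =
    (fun x => f x * 'D_(ebase R i) g x + g x * 'D_(ebase R i) f x)).
  by apply: CkD; apply: IH; [exact: CkW|exact: Ck_derive|exact: CkW|exact: Ck_derive].
by apply/funext => x; exact: (deriveM (Ck_derivable Cf) (Ck_derivable Cg)).
Qed.

Lemma smooth_cst (c : R) : smooth (fun=> c).
Proof. by move=> n; exact: Ck_cst. Qed.

Lemma smoothD f g : smooth f -> smooth g -> smooth (fun x => f x + g x).
Proof. by move=> sf sg n; apply: CkD. Qed.

Lemma smoothM f g : smooth f -> smooth g -> smooth (fun x => f x * g x).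
Proof. by move=> sf sg n; apply: CkM. Qed.

Lemma smoothZ (c : R) f : smooth f -> smooth (fun x => c * f x).
Proof. by apply: smoothM; exact: smooth_cst. Qed.

Lemma smoothN f : smooth f -> smooth (fun x => - f x).
Proof.
move=> /(smoothZ (-1)); rewrite (_ : (fun x : G => _ : R) = (fun x => - f x))//.
by apply/funext => x; rewrite mulN1r.
Qed.

Lemma smooth_sum (I : Type) (r : seq I) (P : pred I) (F : I -> G -> R) :
  (forall l, smooth (F l)) -> smooth (fun x => \sum_(l <- r | P l) F l x).
Proof.
move=> sF; elim: r => [|l r IH].
  rewrite (_ : (fun x : G => _ : R) = (fun=> 0)); first exact: smooth_cst.
  by apply/funext => x; rewrite big_nil.
have [Pl|Pl] := boolP (P l).
  rewrite (_ : (fun x : G => _ : R) = (fun x => F l x + \sum_(l <- r | P l) F l x)).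
    exact: smoothD.
  by apply/funext => x; rewrite big_cons Pl.
rewrite (_ : (fun x : G => _ : R) = (fun x => \sum_(l <- r | P l) F l x))//.
by apply/funext => x; rewrite big_cons (negbTE Pl).
Qed.

Lemma is_derive_coord x v i : is_derive x v (fun y : G => y 0 i) (v 0 i).
Proof.
have E : \forall h \near 0^', h^-1 *: (((fun y : G => y 0 i) \o shift x) (h *: v) - x 0 i) = v 0 i.
  near=> h; rewrite /= !mxE addrK /GRing.scale /= mulKf//.
  by near: h; exact: nbhs_dnbhs_neq.
have H : (fun h => h^-1 *: (((fun y : G => y 0 i) \o shift x) (h *: v) - x 0 i)) @ 0^' --> v 0 i.
  exact: cvg_near_cst.
by apply: DeriveDef; [exact: cvgP H|exact: cvg_lim H].
Unshelve. all: by end_near.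
Qed.

Lemma smooth_coord i : smooth (fun x => x 0 i).
Proof.
have cc : continuous (fun x : G => x 0 i) by move=> x; exact: coord_continuous.
case=> [|n]; split=> //; first by move=> x _; exact: cc.
  by move=> x _; exact: cc.
move=> k; split=> [x _|]; first exact: (@ex_derive _ _ _ _ _ _ _ (is_derive_coord x (ebase R k) i)).
rewrite (_ : (fun x : G => _ : R) = (fun=> ebase R k 0 i)); first exact: Ck_cst.
by apply/funext => x; have [_ ->] := is_derive_coord x (ebase R k) i.
Qed.

Lemma smooth_continuous f : smooth f -> continuous f.
Proof. by move=> /(_ 0%N); exact: Ck_continuous. Qed.

Lemma smooth_partial f i : smooth f -> smooth (fun x => 'D_(ebase R i) f x).
Proof. by move=> sf n; apply: Ck_derive. Qed.

Lemma smooth_derivable_ebase f i x : smooth f -> derivable f x (ebase R i).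
Proof. by move=> /(_ 1%N) sf; exact: Ck_derivable sf. Qed.

(** Smoothness speaks of partial derivatives only; their continuity yields all
    directional derivatives, added one coordinate at a time. *)
Lemma smooth_is_derive f x v : smooth f ->
  is_derive x v f (\sum_i v 0 i * 'D_(ebase R i) f x).
Proof.
move=> sf; rewrite {1}[v]row_sum_delta.
apply: (@big_rec2 _ _ (fun (w : G) (d : R) => is_derive x w f d)).
  by apply: DeriveDef; [exact: derivable0|exact: derive0].
move=> i d w _ dw; apply: is_derive_add => //.
  by move=> y; exact: smooth_derivable_ebase.
exact: (smooth_continuous (smooth_partial i sf)).
Qed.

Lemma smooth_derivable f x v : smooth f -> derivable f x v.
Proof. by move=> sf; have [] := smooth_is_derive x v sf. Qed.

Lemma smooth_deriveE f x v : smooth f ->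
  'D_v f x = \sum_i v 0 i * 'D_(ebase R i) f x.
Proof. by move=> sf; have [] := smooth_is_derive x v sf. Qed.

Lemma smooth_mxM (A B : G -> 'M[R]_8) : smooth_mx A -> smooth_mx B ->
  smooth_mx (fun x => A x *m B x).
Proof.
move=> sA sB i j; rewrite (_ : (fun x : G => _ : R) = (fun x => \sum_k A x i k * B x k j)).
  by apply: smooth_sum => k; apply: smoothM; [exact: sA|exact: sB].
by apply/funext => x; rewrite mxE.
Qed.

Lemma smooth_mxT (A : G -> 'M[R]_8) : smooth_mx A -> smooth_mx (fun x => (A x)^T).
Proof.
move=> sA i j; rewrite (_ : (fun x : G => _ : R) = (fun x => A x j i)); first exact: sA.
by apply/funext => x; rewrite mxE.
Qed.

Lemma smooth_mx_cst (A : 'M[R]_8) : smooth_mx (fun=> A).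
Proof. by move=> i j; exact: smooth_cst. Qed.

Lemma smooth_xdy (c : R) i : smooth (fun x => xdy (c *: x) i).
Proof.
rewrite /xdy; case: (3 <= i < 6)%N; last exact: smooth_cst.
rewrite (_ : (fun x : G => _ : R) = (fun x => c * x 0 (inord (i - 3)))).
  exact/smoothZ/smooth_coord.
by apply/funext => x; rewrite mxE.
Qed.

Lemma smooth_frame (c : R) : smooth_mx (fun x => frame (c *: x)).
Proof.
move=> i k; rewrite (_ : (fun x => _) =
    (fun x => (i == k)%:R + xdy (c *: x) i * (k == iz)%:R)).
  apply: smoothD; first exact: smooth_cst.
  by apply: smoothM; [exact: smooth_xdy|exact: smooth_cst].
by apply/funext => x; rewrite !mxE.
Qed.

Lemma smooth_mx_frame : smooth_mx (@frame R).
Proof.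
move=> i j; have := @smooth_frame 1 i j; congr smooth; apply/funext => x.
by rewrite scale1r.
Qed.

Lemma smooth_mx_frameN : smooth_mx (fun x : G => frame (- x)).
Proof.
move=> i j; have := @smooth_frame (-1) i j; congr smooth; apply/funext => x.
by rewrite scaleN1r.
Qed.

End Smooth.

(** * The exterior derivative in the left-invariant coframe *)

(** Change of frame and coframe: sum_k theta_k a(E_k) = sum_k dx_k a(e_k) when
    E_k = e_k + r_k e_z and theta is the dual coframe. *)
Lemma shear_sum (K : comNzRingType) (A : algType K) (I : finType) (d a : I -> A)
    (r : I -> K) (z : I) : r z = 0 ->
  \sum_k (d k - (z == k)%:R *: \sum_l r l *: d l) * (a k + r k *: a z) =
  \sum_k d k * a k.
Proof.
move=> rz; set xi := \sum_l r l *: d l.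
transitivity (\sum_k (d k * a k + (r k *: d k * a z -
    (z == k)%:R *: (xi * (a k + r k *: a z))))).
  apply: eq_bigr => k _; rewrite mulrBl mulrDr -addrA; congr (_ + (_ - _)).
    by rewrite -scalerAr scalerAl.
  by rewrite -scalerAl.
rewrite big_split sumrB /= -mulr_suml -/xi -[RHS]addr0; congr (_ + _).
rewrite (bigD1 z)//= [X in _ - (_ + X)]big1.
  by rewrite eqxx scale1r rz scale0r !addr0 subrr.
by move=> k; rewrite eq_sym => /negbTE ->; rewrite scale0r.
Qed.

Section FrameCalculus.
Variable R : realType.
Local Notation C := R[i].
Local Notation Lam := (Lam R).
Local Notation G := 'rV[R]_8.
Local Notation dx := (dx R).
Implicit Types (f g h : G -> R) (x y v : G) (i j k : 'I_8) (A B : G -> Lam).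
Implicit Types (F : G -> C).

(** The derivative of f along the left-invariant field E_k. *)
Definition Xf k f x : R := 'D_(row k (frame x)) f x.

Lemma row_frame x k :
  row k (frame x) = ebase R k + xdy x k *: ebase R iz.
Proof.
apply/rowP => j; rewrite !mxE eqxx /= [j == k]eq_sym.
by [].
Qed.

Lemma XfE k f x : smooth f ->
  Xf k f x = 'D_(ebase R k) f x + xdy x k * 'D_(ebase R iz) f x.
Proof.
move=> sf; rewrite /Xf row_frame !(smooth_deriveE x _ sf) mulr_sumr -big_split /=.
by apply: eq_bigr => i _; rewrite !mxE mulrDl mulrA.
Qed.

Lemma smooth_xdy1 i : smooth (fun x : G => xdy x i).
Proof.
have := @smooth_xdy R 1 i; rewrite (_ : (fun x : G => _ : R) = (fun x => xdy x i))//.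
by apply/funext => x; rewrite scale1r.
Qed.

Lemma smooth_Xf k f : smooth f -> smooth (Xf k f).
Proof.
move=> sf; rewrite (_ : Xf k f = (fun x =>
    'D_(ebase R k) f x + xdy x k * 'D_(ebase R iz) f x)).
  apply: smoothD; first exact: smooth_partial.
  by apply: smoothM; [exact: smooth_xdy1|exact: smooth_partial].
by apply/funext => x; exact: XfE.
Qed.

Lemma ReD (z w : C) : complex.Re (z + w) = complex.Re z + complex.Re w.
Proof. by case: z; case: w. Qed.

Lemma ImD (z w : C) : complex.Im (z + w) = complex.Im z + complex.Im w.
Proof. by case: z; case: w. Qed.

Lemma ReM (z w : C) :
  complex.Re (z * w) = complex.Re z * complex.Re w - complex.Im z * complex.Im w.
Proof. by case: z; case: w. Qed.

Lemma ImM (z w : C) :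
  complex.Im (z * w) = complex.Re z * complex.Im w + complex.Im z * complex.Re w.
Proof. by case: z; case: w. Qed.

Definition csmooth F := smooth (fun x => complex.Re (F x)) /\ smooth (fun x => complex.Im (F x)).

(** Derivatives of complex-valued functions, and below of forms, are taken on
    each real component. *)
Definition dirC v F x : C :=
  ('D_v (fun y => complex.Re (F y)) x) +i* ('D_v (fun y => complex.Im (F y)) x).

Lemma eq_smooth f g : f =1 g -> smooth f -> smooth g.
Proof. by move=> /funext ->. Qed.

Lemma csmooth_cst (c : C) : csmooth (fun=> c).
Proof. by split; exact: smooth_cst. Qed.

Lemma csmooth_real f : smooth f -> csmooth (fun x => (f x)%:C).
Proof. by move=> sf; split=> //; exact: smooth_cst. Qed.

Lemma csmoothD F1 F2 : csmooth F1 -> csmooth F2 -> csmooth (fun x => F1 x + F2 x).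
Proof.
move=> [r1 i1] [r2 i2]; split.
  by apply: (eq_smooth _ (smoothD r1 r2)) => x; rewrite ReD.
by apply: (eq_smooth _ (smoothD i1 i2)) => x; rewrite ImD.
Qed.

Lemma csmoothM F1 F2 : csmooth F1 -> csmooth F2 -> csmooth (fun x => F1 x * F2 x).
Proof.
move=> [r1 i1] [r2 i2]; split.
  apply: (eq_smooth _ (smoothD (smoothM r1 r2) (smoothN (smoothM i1 i2)))) => x.
  by rewrite ReM.
apply: (eq_smooth _ (smoothD (smoothM r1 i2) (smoothM i1 r2))) => x.
by rewrite ImM.
Qed.

Lemma csmooth_sum (I : Type) (r : seq I) (P : pred I) (F : I -> G -> C) :
  (forall l, csmooth (F l)) -> csmooth (fun x => \sum_(l <- r | P l) F l x).
Proof.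
move=> sF; split.
  rewrite (_ : (fun x : G => _ : R) =
      (fun x => \sum_(l <- r | P l) complex.Re (F l x))).
    by apply: smooth_sum => l; case: (sF l).
  by apply/funext => x; exact: (raddf_sum (@complex.Re R : {additive C -> R})).
rewrite (_ : (fun x : G => _ : R) =
    (fun x => \sum_(l <- r | P l) complex.Im (F l x))).
  by apply: smooth_sum => l; case: (sF l).
by apply/funext => x; exact: (raddf_sum (@complex.Im R : {additive C -> R})).
Qed.

Lemma dirCD v F1 F2 x : csmooth F1 -> csmooth F2 ->
  dirC v (fun y => F1 y + F2 y) x = dirC v F1 x + dirC v F2 x.
Proof.
move=> [r1 i1] [r2 i2]; rewrite /dirC.
have -> : (fun y => complex.Re (F1 y + F2 y)) =
    (fun y => complex.Re (F1 y)) + (fun y => complex.Re (F2 y)).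
  by apply/funext => y; exact: ReD.
have -> : (fun y => complex.Im (F1 y + F2 y)) =
    (fun y => complex.Im (F1 y)) + (fun y => complex.Im (F2 y)).
  by apply/funext => y; exact: ImD.
by rewrite !deriveD//; exact: smooth_derivable.
Qed.

Lemma eq_dirC v F1 F2 x : F1 =1 F2 -> dirC v F1 x = dirC v F2 x.
Proof. by move=> /funext ->. Qed.

Let complexE' (z : C) : complex.Re z +i* complex.Im z = z. Proof. by case: z. Qed.

Let complex_leibniz (a b c d a' b' c' d' : R) :
  ((a * c' + c * a') - (b * d' + d * b')) +i* ((a * d' + d * a') + (b * c' + c * b'))
  = (a' +i* b') * (c +i* d) + (a +i* b) * (c' +i* d').
Proof. by apply/eqP; rewrite eq_complex /=; apply/andP; split; apply/eqP; ring. Qed.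

Lemma dirCM v F1 F2 x : csmooth F1 -> csmooth F2 ->
  dirC v (fun y => F1 y * F2 y) x = dirC v F1 x * F2 x + F1 x * dirC v F2 x.
Proof.
move=> [r1 i1] [r2 i2]; rewrite /dirC.
have -> : (fun y => complex.Re (F1 y * F2 y)) =
    (fun y => complex.Re (F1 y)) * (fun y => complex.Re (F2 y)) -
    (fun y => complex.Im (F1 y)) * (fun y => complex.Im (F2 y)).
  by apply/funext => y; exact: ReM.
have -> : (fun y => complex.Im (F1 y * F2 y)) =
    (fun y => complex.Re (F1 y)) * (fun y => complex.Im (F2 y)) +
    (fun y => complex.Im (F1 y)) * (fun y => complex.Re (F2 y)).
  by apply/funext => y; exact: ImM.
have [dr1 di1] := (@smooth_derivable _ _ x v r1, @smooth_derivable _ _ x v i1).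
have [dr2 di2] := (@smooth_derivable _ _ x v r2, @smooth_derivable _ _ x v i2).
rewrite (deriveB (derivableM dr1 dr2) (derivableM di1 di2)).
rewrite (deriveD (derivableM dr1 di2) (derivableM di1 dr2)).
rewrite (deriveM dr1 dr2) (deriveM di1 di2) (deriveM dr1 di2) (deriveM di1 dr2).
rewrite -(complexE' (F1 x)) -(complexE' (F2 x)); exact: complex_leibniz.
Qed.

Lemma dirC_cst v (c : C) x : dirC v (fun=> c) x = 0.
Proof. by rewrite /dirC !derive_cst. Qed.

Lemma dirC_real v f x : dirC v (fun y => (f y)%:C) x = ('D_v f x)%:C.
Proof. by rewrite /dirC /= derive_cst. Qed.

Lemma dirC_sum v (I : Type) (r : seq I) (F : I -> G -> C) x :
  (forall l, csmooth (F l)) ->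
  dirC v (fun y => \sum_(l <- r) F l y) x = \sum_(l <- r) dirC v (F l) x.
Proof.
move=> sF; elim: r => [|l r IH].
  rewrite big_nil; apply: etrans (dirC_cst v 0 x).
  by apply: eq_dirC => y; rewrite big_nil.
rewrite big_cons -IH -dirCD//; last exact: csmooth_sum.
by apply: eq_dirC => y; rewrite big_cons.
Qed.

Definition lsmooth A := forall S, csmooth (fun x => A x S).

Definition dirL v A x : Lam := [ffun S => dirC v (fun y => A y S) x].

Lemma dirLE v A x S : dirL v A x S = dirC v (fun y => A y S) x.
Proof. by rewrite ffunE. Qed.

Lemma eq_dirL v A B x : A =1 B -> dirL v A x = dirL v B x.
Proof. by move=> /funext ->. Qed.

Lemma linear_funE (T : Lam -> Lam) a S : linear T ->
  T a S = \sum_U a U * T (dxs R U) S.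
Proof.
move=> Tlin; rewrite {1}(dxs_sum a) (linear_fun_sum _ Tlin) sum_ffunE.
by apply: eq_bigr => U _; rewrite (linear_funZ _ _ Tlin) lamZE.
Qed.

Lemma lsmooth_linear (T : Lam -> Lam) A : linear T -> lsmooth A ->
  lsmooth (fun x => T (A x)).
Proof.
move=> Tlin sA S.
have -> : (fun x => T (A x) S) = (fun x => \sum_U A x U * T (dxs R U) S).
  by apply/funext => x; exact: linear_funE.
by apply: csmooth_sum => U; apply: csmoothM; [exact: sA|exact: csmooth_cst].
Qed.

Lemma dirL_linear v (T : Lam -> Lam) A x : linear T -> lsmooth A ->
  dirL v (fun x => T (A x)) x = T (dirL v A x).
Proof.
move=> Tlin sA; apply/ffunP => S; rewrite dirLE linear_funE//.
have -> : (fun x => T (A x) S) = (fun x => \sum_U A x U * T (dxs R U) S).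
  by apply/funext => y; exact: linear_funE.
rewrite dirC_sum => [|U]; last by apply: csmoothM; [exact: sA|exact: csmooth_cst].
apply: eq_bigr => U _; rewrite dirCM//; last exact: csmooth_cst.
by rewrite dirC_cst mulr0 addr0 dirLE.
Qed.

Lemma lsmoothD A B : lsmooth A -> lsmooth B -> lsmooth (fun x => A x + B x).
Proof.
move=> sA sB S; rewrite (_ : (fun x => _) = (fun x => A x S + B x S)).
  exact: csmoothD.
by apply/funext => x; rewrite lamDE.
Qed.

Lemma lsmoothZ F A : csmooth F -> lsmooth A -> lsmooth (fun x => F x *: A x).
Proof.
move=> sF sA S; rewrite (_ : (fun x => _) = (fun x => F x * A x S)).
  exact: csmoothM.
by apply/funext => x; rewrite lamZE.
Qed.

Lemma dirLD v A B x : lsmooth A -> lsmooth B ->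
  dirL v (fun x => A x + B x) x = dirL v A x + dirL v B x.
Proof.
move=> sA sB; apply/ffunP => S; rewrite lamDE !dirLE -dirCD//.
by apply: eq_dirC => y; rewrite lamDE.
Qed.

Lemma dirLZ v F A x : csmooth F -> lsmooth A ->
  dirL v (fun x => F x *: A x) x = dirC v F x *: A x + F x *: dirL v A x.
Proof.
move=> sF sA; apply/ffunP => S; rewrite lamDE !lamZE !dirLE -dirCM//.
by apply: eq_dirC => y; rewrite lamZE.
Qed.

Lemma lsmooth0 : lsmooth (fun=> 0).
Proof.
move=> S; rewrite (_ : (fun x => _) = (fun=> 0)); first exact: csmooth_cst.
by apply/funext => x; rewrite lam0E.
Qed.

Lemma lsmooth_sum (I : Type) (r : seq I) (A : I -> G -> Lam) :
  (forall l, lsmooth (A l)) -> lsmooth (fun x => \sum_(l <- r) A l x).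
Proof.
move=> sA; elim: r => [|l r IH].
  rewrite (_ : (fun x => _) = (fun=> 0)); first exact: lsmooth0.
  by apply/funext => x; rewrite big_nil.
rewrite (_ : (fun x => _) = (fun x => A l x + \sum_(l <- r) A l x)).
  exact: lsmoothD.
by apply/funext => x; rewrite big_cons.
Qed.

Lemma dirL_sum v (I : Type) (r : seq I) (A : I -> G -> Lam) x :
  (forall l, lsmooth (A l)) ->
  dirL v (fun y => \sum_(l <- r) A l y) x = \sum_(l <- r) dirL v (A l) x.
Proof.
move=> sA; elim: r => [|l r IH].
  rewrite big_nil; apply/ffunP => S; rewrite dirLE lam0E; apply: etrans (dirC_cst v 0 x).
  by apply: eq_dirC => y; rewrite big_nil lam0E.
rewrite big_cons -IH -dirLD//; last exact: lsmooth_sum.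
by apply: eq_dirL => y; rewrite big_cons.
Qed.

Lemma framedE x a : framed x a = a - \sum_k (xdy x k)%:C *: (dx k * contr iz a).
Proof.
rewrite /framed /shear cov_sum mulr_suml; congr (_ - _).
by apply: eq_bigr => k _; rewrite -scalerAl.
Qed.

Lemma extdE (a : Defs.form R) x : extd a x = \sum_i dx i * dirL (ebase R i) a x :> Lam.
Proof. by []. Qed.

(** The derivative along E_k of the coefficients of a form. *)
Definition XL k A x : Lam := dirL (row k (frame x)) A x.

Lemma XLE k A x : lsmooth A ->
  XL k A x = dirL (ebase R k) A x + (xdy x k)%:C *: dirL (ebase R iz) A x.
Proof.
move=> sA; apply/ffunP => S; rewrite lamDE lamZE !dirLE /dirC.
have [sr si] := sA S; have := XfE k x sr; have := XfE k x si.
rewrite /Xf => -> ->; apply/eqP; rewrite eq_complex /= !mul0r subr0 addr0.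
by rewrite !eqxx.
Qed.

(** - d zeta = d (x . dy) = sum_j dx_j /\ dy_j. *)
Lemma sigma_xdy : \sum_i \sum_k (xdy (ebase R i) k)%:C *: (dx i * dx k) = sigma R.
Proof.
have H k : \sum_i (xdy (ebase R i) k)%:C *: (dx i * dx k) =
    if (3 <= k < 6)%N then dx (inord (k - 3)) * dx k else 0.
  rewrite /xdy; case: ifP => _; last by apply: big1 => i _; rewrite scale0r.
  rewrite (bigD1 (inord (k - 3)))//= [X in _ + X]big1 ?addr0.
    by rewrite mxE !eqxx scale1r.
  by move=> i /negbTE iN; rewrite mxE eqxx eq_sym iN scale0r.
rewrite exchange_big; under eq_bigr do rewrite H.
rewrite sum_ord8 !inordK//= !addr0 !add0r /sigma /hor sum_ord3 !inordK//.
by rewrite !scale1r /dxx /partner !inordK.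
Qed.

Lemma xdy_derive v x k : 'D_v (fun y => xdy y k) x = xdy v k.
Proof.
rewrite /xdy; case: (3 <= k < 6)%N; last exact: derive_cst.
by have [_ ->] := is_derive_coord x v (inord (k - 3)).
Qed.

Lemma framed_horizontal x a : contr iz a = 0 -> framed x a = a.
Proof. by move=> a0; rewrite /framed /shear a0 mulr0 subr0. Qed.

Lemma framed_dx x k : framed x (dx k) = dx k - (iz == k)%:R *: cov (fun i => (xdy x i)%:C).
Proof. exact: (dx_morph_dx k (shearP _ _)). Qed.

(** The exterior derivative in the left-invariant coframe: the derivatives of
    the coefficients along the frame, plus the structure equation
    d zeta = - sigma. *)
Definition dinv A x : Lam := \sum_k dx k * XL k A x + dframe (A x).

(** In framed y (A y) = A y - (y . dy) /\ iota_Z A y, either the coefficients of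
    A are differentiated, which gives the sum over the frame by [shear_sum], or
    the form y . dy is, which gives - sigma /\ iota_Z A. *)
Lemma extd_framed A x : lsmooth A ->
  extd (fun y => framed y (A y)) x = framed x (dinv A x) :> Lam.
Proof.
move=> sA; rewrite extdE.
have linT k : linear (fun a : Lam => dx k * contr iz a).
  move=> c a b; rewrite linearP /= mulrDr; congr (_ + _).
  exact: (esym (scalerAr _ _ _)).
have sX k : smooth (fun y => - xdy y k) by apply/smoothN/smooth_xdy1.
have sT k : lsmooth (fun y => (- xdy y k)%:C *: (dx k * contr iz (A y))).
  by apply: lsmoothZ; [exact: csmooth_real|exact: (lsmooth_linear (linT k) sA)].
have E i : dirL (ebase R i) (fun y => framed y (A y)) x =
    framed x (dirL (ebase R i) A x) -
    \sum_k (xdy (ebase R i) k)%:C *: (dx k * contr iz (A x)).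
  transitivity (dirL (ebase R i)
      (fun y => A y + \sum_k (- xdy y k)%:C *: (dx k * contr iz (A y))) x).
    apply: eq_dirL => y; rewrite framedE -sumrN. congr (_ + _).
    by apply: eq_bigr => k _; rewrite rmorphN scaleNr.
  rewrite dirLD//; last exact: lsmooth_sum.
  rewrite dirL_sum// framedE -addrA; congr (_ + _).
  rewrite -opprD -big_split -sumrN /=; apply: eq_bigr => k _.
  rewrite dirLZ; [|exact: csmooth_real|exact: (lsmooth_linear (linT k) sA)].
  rewrite dirC_real (dirL_linear _ _ (linT k) sA).
  have -> : 'D_(ebase R i) (fun y => - xdy y k) x = - xdy (ebase R i) k.
    rewrite -(xdy_derive (ebase R i) x k); apply: deriveN.
    exact/smooth_derivable/smooth_xdy1.
  by rewrite !rmorphN !scaleNr -opprD addrC.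
have [fl _ _] := framedP x; have fM := dx_morphM (framedP x).
have fD a b : framed x (a + b) = framed x a + framed x b.
  by have := fl 1 a b; rewrite !scale1r.
under eq_bigr do rewrite E mulrBr.
rewrite sumrB /dinv fD (linear_fun_sum _ fl); congr (_ + _).
  have rz : (xdy x iz)%:C = 0 :> C by rewrite xdy_iz rmorph0.
  apply: esym; have := @shear_sum _ _ _ dx
    (fun k => framed x (dirL (ebase R k) A x)) (fun k => (xdy x k)%:C) iz rz.
  move=> <-; apply: eq_bigr => k _.
  by rewrite fM framed_dx cov_sum XLE// fD (linear_funZ _ _ fl).
have [_ sH] := central_horizontal_hor (fun=> 1 : C).
have s0 := contr_central_horizontal (central_horizontal_hor (fun=> 1 : C)).
rewrite [RHS]framed_horizontal; last first.
  by rewrite /dframe mulNr linearN /= sH contr_contr mulr0 oppr0.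
rewrite /dframe mulNr -sigma_xdy mulr_suml; congr (- _).
apply: eq_bigr => i _; rewrite mulr_sumr mulr_suml; apply: eq_bigr => k _.
by rewrite -scalerAl -scalerAr mulrA.
Qed.

End FrameCalculus.

(** * Averages along the invariant fields *)

Section InvariantMean.
Variable R : realType.
Local Notation G := 'rV[R]_8.
Implicit Types (u f : G -> R) (p q x : G) (k l : 'I_8) (n M : nat).

Local Notation E k p := (row k (frame p)).
Local Notation ez := (ebase R iz).

Lemma xdyZ (c : R) x k : xdy (c *: x) k = c * xdy x k.
Proof. by rewrite /xdy; case: ifP; rewrite ?mxE ?mulr0. Qed.

Lemma xdy_ez k : xdy ez k = 0.
Proof. by have := @xdy_ebase_iz R 1 k; rewrite scale1r. Qed.

Lemma xdy_row k l p : xdy (E k p) l = xdy (ebase R k) l.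
Proof. by rewrite row_frame xdyD xdyZ xdy_ez mulr0 addr0. Qed.

Lemma xdy_ebase k l : xdy (ebase R k) l = ((3 <= l < 6) && (l - 3 == k))%N%:R.
Proof.
rewrite /xdy; case: ifP => //= /andP[k3 k6]; rewrite mxE eqxx /=.
by rewrite -(inj_eq val_inj) /= inordK// (leq_ltn_trans (leq_subr _ _)).
Qed.

Lemma xdy_ebase_self k : xdy (ebase R k) k = 0.
Proof.
by rewrite xdy_ebase; case: k => -[|[|[|[|[|[|[|[|//]]]]]]]].
Qed.

(** Moving along E_k changes E_l by a multiple of the central direction: the
    group has step 2. *)
Lemma row_frame_shift k l p (a : R) :
  E l (p + a *: E k p) = E l p + (a * xdy (ebase R k) l) *: ez.
Proof.
by rewrite [LHS]row_frame xdyD xdyZ xdy_row scalerDl addrA -row_frame.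
Qed.

Lemma row_frame_flow k p (a : R) : E k (p + a *: E k p) = E k p.
Proof. by rewrite row_frame_shift xdy_ebase_self mulr0 scale0r addr0. Qed.

Variable h : R.
(** The central direction has weight 2: with the step h^2, the commutator of
    the steps along E_k and E_l is a whole number of central steps
    ([comm_step]). *)
Definition step k : R := if k == iz then h * h else h.
Local Notation s := step.

Definition diff k u p : R := u (p + s k *: E k p) - u p.

(** A mean along the flow of E_k, whose orbits are straight lines in these
    coordinates ([row_frame_flow]). *)
Definition avg k M u p : R :=
  M%:R^-1 * \sum_(n < M) u (p + (n%:R * s k) *: E k p).

(** The structure constant: [E_k, E_l] = comm k l E_z. *)
Definition comm k l : R := xdy (ebase R k) l - xdy (ebase R l) k.

Lemma comm_step k l : s k * s l * comm k l = h * h * comm k l.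
Proof.
rewrite /comm !xdy_ebase /step; case: eqP => [->|_].
  rewrite /iz inordK//= subr0.
  case: (l : nat) (ltn_ord l) => [|[|[|[|[|[|[|[|//]]]]]]]] _ //=; rewrite ?mulr0//.
case: eqP => [->|_ //].
rewrite /iz inordK//=; case: (k : nat) (ltn_ord k) => [|[|[|[|[|[|[|[|//]]]]]]]] _ //=; rewrite ?subr0 ?mulr0//.
Qed.

Lemma avg_le k M u (C : R) p : (0 < M)%N -> (forall q, u q <= C) -> avg k M u p <= C.
Proof.
move=> M0 uC; rewrite /avg mulrC ler_pdivrMr ?ltr0n//.
apply: (@le_trans _ _ (\sum_(n < M) C)); first by apply: ler_sum => n _; exact: uC.
by rewrite sumr_const card_ord mulr_natr.
Qed.

Lemma avg_ge k M u (C : R) p : (0 < M)%N -> (forall q, C <= u q) -> C <= avg k M u p.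
Proof.
move=> M0 uC; rewrite /avg mulrC ler_pdivlMr ?ltr0n//.
apply: (@le_trans _ _ (\sum_(n < M) C)); last by apply: ler_sum => n _; exact: uC.
by rewrite sumr_const card_ord mulr_natr.
Qed.

Lemma avg_norm k M u (C : R) p : (0 < M)%N ->
  (forall q, `|u q| <= C) -> `|avg k M u p| <= C.
Proof.
move=> M0 uC; rewrite ler_norml avg_le ?avg_ge// => q.
  by have := uC q; rewrite ler_norml => /andP[].
by have := uC q; rewrite ler_norml => /andP[].
Qed.

(** The sum of the differences telescopes along the flow. *)
Lemma avg_diff_norm k M u (C : R) p : (0 < M)%N ->
  (forall q, `|u q| <= C) -> `|avg k M (diff k u) p| <= 2 * C / M%:R.
Proof.
move=> M0 uC.
have -> : avg k M (diff k u) p = M%:R^-1 * (u (p + (M%:R * s k) *: E k p) - u p).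
  rewrite /avg; congr (_ * _).
  pose F n := u (p + (n%:R * s k) *: E k p).
  rewrite (_ : u p = F 0%N); last by rewrite /F mul0r scale0r addr0.
  rewrite -/(F M) -(telescope_sumr F (leq0n M)) big_mkord; apply: eq_bigr => n _.
  by rewrite /diff row_frame_flow -addrA -scalerDl /F -natr1 mulrDl mul1r.
rewrite normrM mulrC normfV [`|M%:R|]ger0_norm// ler_wpM2r ?invr_ge0//.
by rewrite (le_trans (ler_normB _ _))// mulr2n mulrDl mul1r lerD.
Qed.

Lemma shift_norm u (d : R) n q : (forall q, `|u (q + (h * h) *: ez) - u q| <= d) ->
  `|u (q + (n%:R * (h * h)) *: ez) - u q| <= n%:R * d.
Proof.
move=> ud; elim: n => [|n IH].
  by rewrite !mul0r scale0r addr0 subrr normr0.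
set q' := q + (n%:R * (h * h)) *: ez in IH *.
have -> : q + (n.+1%:R * (h * h)) *: ez = q' + (h * h) *: ez.
  by rewrite /q' -addrA -scalerDl -natr1 mulrDl mul1r.
rewrite -(subrKA (u q')) -natr1 mulrDl mul1r (le_trans (ler_normD _ _))//.
by rewrite [X in X <= _]addrC lerD.
Qed.

(** Averaging along E_k commutes with the difference along E_l up to a central
    displacement of n commutators, n < M. *)
Lemma avg_diff_comm k l M u (d : R) p : (0 < M)%N ->
  (forall n q, (n < M)%N ->
     `|u (q + (n%:R * (h * h) * comm k l) *: ez) - u q| <= d) ->
  `|avg k M (diff l u) p - diff l (avg k M u) p| <= d.
Proof.
move=> M0 ud; rewrite /diff /avg -mulrBr -mulrBr -!sumrB.
rewrite normrM normfV [`|M%:R|]ger0_norm// mulrC ler_pdivrMr ?ltr0n//.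
rewrite (le_trans (ler_norm_sum _ _ _))//.
rewrite mulr_natr -[M in _ *+ M]card_ord -sumr_const; apply: ler_sum => n _.
rewrite opprB subrKA; set q := p + s l *: E l p.
have -> : p + (n%:R * s k) *: E k p + s l *: E l (p + (n%:R * s k) *: E k p) =
    q + (n%:R * s k) *: E k q + (n%:R * (h * h) * comm k l) *: ez.
  have c1 : s l * (n%:R * s k * xdy (ebase R k) l) =
      n%:R * s k * (s l * xdy (ebase R l) k) + n%:R * (h * h) * comm k l.
    by rewrite -[_ * (h * h) * _]mulrA -comm_step /comm; ring.
  rewrite /q !row_frame_shift !scalerDr !scalerA c1 scalerDl !addrA.
  by rewrite [p + _ + _]addrAC.
exact: ud.
Qed.

Lemma avg_sum k M (I : Type) (r : seq I) (P : pred I) (F : I -> G -> R) p :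
  avg k M (fun q => \sum_(i <- r | P i) F i q) p = \sum_(i <- r | P i) avg k M (F i) p.
Proof. by rewrite /avg exchange_big mulr_sumr. Qed.

Lemma comm_cases k l : [\/ comm k l = 0, comm k l = 1 | comm k l = -1].
Proof.
rewrite /comm !xdy_ebase; do 2 case: (_ && _); rewrite /= ?subrr ?subr0 ?sub0r;
  by [constructor 1|constructor 2|constructor 3].
Qed.

Lemma comm_iz l : comm iz l = 0.
Proof.
rewrite /comm !xdy_ebase /iz inordK//=.
by case: l => -[|[|[|[|[|[|[|[|//]]]]]]]] /= _; rewrite subrr.
Qed.

Variable C : R.
Hypothesis C0 : 0 <= C.

(** The invariant of the induction that removes the directions: K is the set of
    those that are left, and e the error accumulated so far. *)
Definition almost_sub (K : {set 'I_8}) (c e : R) (u : 'I_8 -> G -> R) :=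
  (forall k q, `|u k q| <= C) /\
  forall q, c <= \sum_(k in K) diff k (u k) q + e.

(** Averaging along E_k removes the direction k: its difference becomes
    O(1/M), and the other differences of the averages are the averages of the
    differences up to d each. *)
Lemma avg_remove (K : {set 'I_8}) k c e d (u : 'I_8 -> G -> R) M : (0 < M)%N -> k \in K ->
  almost_sub K c e u ->
  (forall l n q, (n < M)%N ->
     `|u l (q + (n%:R * (h * h) * comm k l) *: ez) - u l q| <= d) ->
  almost_sub (K :\ k)%SET c (e + 2 * C / M%:R + 8 * d) (fun l => avg k M (u l)).
Proof.
move=> M0 kK [uC uc] ud.
have d0 : 0 <= d by apply: le_trans (normr_ge0 _) (ud k 0%N 0 M0).
split=> [l q|q]; first exact: avg_norm.
have := @avg_ge k M _ c q M0 (fun q => uc q).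
have -> : avg k M (fun q => \sum_(l in K) diff l (u l) q + e) q =
    \sum_(l in K) avg k M (diff l (u l)) q + e.
  rewrite -avg_sum /avg big_split /= mulrDr; congr (_ + _).
  by rewrite sumr_const card_ord -[e *+ M]mulr_natl mulKf// pnatr_eq0 -lt0n.
move=> /le_trans; apply; rewrite (big_setD1 k)//= -!addrA [X in _ <= X]addrA.
have H1 : avg k M (diff k (u k)) q <= 2 * C / M%:R.
  exact: le_trans (ler_norm _) (avg_diff_norm _ _ M0 (uC k)).
have H2 : \sum_(l in (K :\ k)%SET) avg k M (diff l (u l)) q <=
    \sum_(l in (K :\ k)%SET) diff l (avg k M (u l)) q + 8 * d.
  apply: (@le_trans _ _ (\sum_(l in (K :\ k)%SET) (diff l (avg k M (u l)) q + d))).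
    apply: ler_sum => l _; rewrite -lerBlDl.
    exact: le_trans (ler_norm _) (avg_diff_comm q M0 (ud l)).
  rewrite big_split /= lerD2l sumr_const -[d *+ _]mulr_natl ler_wpM2r// ler_nat.
  by rewrite (leq_trans (max_card _))// card_ord.
lra.
Qed.

(** Central steps commute with the averages. *)
Lemma avg_almost_periodic k M u (d : R) q : (0 < M)%N ->
  (forall q, `|u (q + (h * h) *: ez) - u q| <= d) ->
  `|avg k M u (q + (h * h) *: ez) - avg k M u q| <= d.
Proof.
move=> M0 ud; rewrite /avg -mulrBr -sumrB.
rewrite normrM normfV [`|M%:R|]ger0_norm// mulrC ler_pdivrMr ?ltr0n//.
rewrite (le_trans (ler_norm_sum _ _ _))//.
rewrite mulr_natr -[M in _ *+ M]card_ord -sumr_const; apply: ler_sum => n _.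
have -> : E k (q + (h * h) *: ez) = E k q.
  by rewrite !row_frame xdyD xdyZ xdy_ez mulr0 addr0.
by rewrite addrAC; exact: ud.
Qed.

(** The directions are removed one at a time.  The number M of steps is fixed by
    the error wanted in the end; the central displacements of the commutators
    are at most M steps, so the induction hypothesis is used with an error
    smaller than e by a factor of order M. *)
Lemma exists_almost_sub (K : {set 'I_8}) c :
  (forall e : R, 0 < e -> exists u : 'I_8 -> G -> R, almost_sub (~: [set iz])%SET c e u /\
     forall l q, `|u l (q + (h * h) *: ez) - u l q| <= e) ->
  K \subset (~: [set iz])%SET ->
  forall e : R, 0 < e -> exists u : 'I_8 -> G -> R, almost_sub K c e u /\
     forall l q, `|u l (q + (h * h) *: ez) - u l q| <= e.
Proof.
move=> H0; have [n] := ubnP #|(~: [set iz] :\: K)%SET|; elim: n K => // n IH K.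
rewrite ltnS => Kn KS e e0.
have [KE|/finset.set0Pn[k]] := eqVneq (~: [set iz] :\: K)%SET finset.set0.
  suff -> : K = (~: [set iz])%SET by exact: H0.
  by apply/eqP; rewrite finset.eqEsubset KS -finset.setD_eq0 KE eqxx.
rewrite inE => /andP[kK kS].
(* The telescoped difference, at most 2 C / M, takes a quarter of e. *)
pose M := (Num.bound (8 * C / e)).+1.
have M0 : (0 < M)%N by [].
have MC : 2 * C / M%:R <= e / 4.
  rewrite ler_pdivrMr ?ltr0n//.
  have : 8 * C / e <= M%:R.
    have := archi_boundP (divr_ge0 (mulr_ge0 (ler0n R 8) C0) (ltW e0)).
    by move=> /ltW/le_trans; apply; rewrite ler_nat.
  rewrite ler_pdivrMr//; lra.
(* The eight commutator errors, each at most M e', take another quarter. *)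
pose e' := e / (32 * M%:R).
have Mr : (1 : R) <= M%:R by rewrite ler1n.
have e'0 : 0 < e' by rewrite divr_gt0// mulr_gt0// ltr0n.
have e'e : 32 * (M%:R * e') = e by rewrite /e' mulrA mulrC divfK// mulf_neq0// pnatr_eq0.
have := IH (k |: K)%SET _ _ e' e'0; case.
- rewrite (leq_trans _ Kn)//; apply: proper_card; apply/properP; split.
    by apply/fintype.subsetP => l; rewrite !inE negb_or -andbA => /and3P[_ -> ->].
  by exists k; rewrite !inE ?eqxx//= kK; move: kS; rewrite !inE.
- by rewrite finset.subUset finset.sub1set kS.
move=> u [uS up].
have ud l m q : (m < M)%N ->
    `|u l (q + (m%:R * (h * h) * comm k l) *: ez) - u l q| <= M%:R * e'.
  move=> mM; have mle : m%:R * e' <= M%:R * e'.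
    by rewrite ler_wpM2r ?(ltW e'0)// ler_nat ltnW.
  have [->|->|->] := comm_cases k l.
  - by rewrite mulr0 scale0r addr0 subrr normr0 mulr_ge0// ltW.
  - by rewrite mulr1 (le_trans (shift_norm m q (up l))).
  rewrite mulrN1; set q' := q + _ *: ez.
  have qE : q = q' + (m%:R * (h * h)) *: ez by rewrite /q' scaleNr subrK.
  rewrite [X in _ - u l X]qE distrC.
  exact: le_trans (shift_norm m q' (up l)) mle.
have kKU : k \in (k |: K)%SET by rewrite !inE eqxx.
have := avg_remove M0 kKU uS ud; rewrite finset.setU1K// => uS'.
exists (fun l => avg k M (u l)); split; last first.
  move=> l q; apply: (@le_trans _ _ e'); first exact: avg_almost_periodic.
  nra.
split; first by case: uS'.
move=> q; case: uS' => _ /(_ q) /le_trans; apply; rewrite lerD2l.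
nra.
Qed.

(** The central direction is averaged first: this commutes with everything, and
    leaves functions that are almost invariant under a central step, as
    [exists_almost_sub] requires.  When no direction is left, c is at most an
    arbitrarily small error. *)
Lemma no_positive_sum_diff (c : R) (u : 'I_8 -> G -> R) : 0 < c ->
  (forall k q, `|u k q| <= C) ->
  ~ (forall q, c <= \sum_k diff k (u k) q).
Proof.
move=> c0 uC uc.
have H0 (e : R) : 0 < e -> exists u : 'I_8 -> G -> R, almost_sub (~: [set iz])%SET c e u /\
     forall l q, `|u l (q + (h * h) *: ez) - u l q| <= e.
  move=> e0; pose M := (Num.bound (2 * C / e)).+1.
  have M0 : (0 < M)%N by [].
  have MC : 2 * C / M%:R <= e.
    rewrite ler_pdivrMr ?ltr0n//.
    have : 2 * C / e <= M%:R.
      have := archi_boundP (divr_ge0 (mulr_ge0 (ler0n R 2) C0) (ltW e0)).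
      by move=> /ltW/le_trans; apply; rewrite ler_nat.
    by rewrite ler_pdivrMr// [M%:R * e]mulrC.
  exists (fun l => avg iz M (u l)); split.
    have uS : almost_sub finset.setT c 0 u.
      by split=> // q; rewrite addr0; under eq_bigl do rewrite inE.
    have := @avg_remove finset.setT iz c 0 0 u M M0 _ uS; case.
    - by rewrite inE.
    - by move=> l m q _; rewrite comm_iz mulr0 scale0r addr0 subrr normr0.
    move=> aC ac; rewrite -finset.setTD; split=> // q.
    by apply: le_trans (ac q) _; rewrite lerD2l add0r mulr0 addr0.
  move=> l q; have -> : avg iz M (u l) (q + (h * h) *: ez) - avg iz M (u l) q =
      diff iz (avg iz M (u l)) q.
    by rewrite /diff row_frame xdy_iz scale0r addr0 /step eqxx.
  have : `|avg iz M (diff iz (u l)) q - diff iz (avg iz M (u l)) q| <= 0.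
    apply: avg_diff_comm => // m q' _.
    by rewrite comm_iz mulr0 scale0r addr0 subrr normr0.
  rewrite normr_le0 subr_eq0 => /eqP <-.
  exact: le_trans (avg_diff_norm iz q M0 (uC l)) MC.
have c20 : 0 < c / 2 by rewrite divr_gt0.
have [u' [[_ /(_ 0)]]] := exists_almost_sub H0 (finset.sub0set _) c20.
rewrite big_set0 add0r => cle _.
by move: cle c0; lra.
Qed.

End InvariantMean.

(** * Divergences on a compact quotient *)

Section DivergenceMean.
Local Open Scope quotient_scope.

Variable R : realType.
Local Notation G := 'rV[R]_8.
Implicit Types (f g : G -> R) (p q x : G) (k l : 'I_8).
Variable Gamma : discrete_subgroup R.
Hypothesis Mcompact : compact [set: nilmanifold Gamma].

Definition Gamma_invariant f := forall c, dsg_set Gamma c -> forall p, f (hmul c p) = f p.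

(** An invariant continuous function descends to the compact quotient. *)
Lemma invariant_bounded f : continuous f -> Gamma_invariant f ->
  exists2 C, 0 <= C & forall p, `|f p| <= C.
Proof.
move=> cf fI; pose Q := {eq_quot (orbit_equiv Gamma)}.
have piP (p q : G) : (\pi_Q p = \pi_Q q) -> f p = f q.
  by move=> /eqquotP /asboolP[c Gc ->]; rewrite fI.
have cfr : continuous (f \o repr : nilmanifold Gamma -> R).
  by apply: repr_comp_continuous => // a b /eqP/piP ->.
have := continuous_compact (continuous_subspaceT cfr) Mcompact.
move=> /compact_bounded[B [Breal HB]].
exists (`|B| + 1); first by rewrite addr_ge0.
move=> p; have -> : f p = (f \o repr) (\pi_Q p).
  by apply: piP; rewrite reprK.
apply: HB; last by exists (\pi_Q p).
by rewrite (le_lt_trans (ler_norm B))// ltrDl.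
Qed.

(** The fields E_k are invariant under left translations. *)
Lemma Xf_invariant k f : Gamma_invariant f -> Gamma_invariant (Xf k f).
Proof.
move=> fI c Gc p; rewrite /Xf.
rewrite /derive (_ : (fun h : R => _) = (fun h : R =>
  h^-1 *: ((f \o shift p) (h *: row k (frame p)) - f p)))//.
apply/funext => h /=; rewrite fI//; congr (_ *: (_ - _)).
rewrite -[RHS](fI c Gc); congr f.
rewrite frame_hmul frameC row_mul !hmul_frame mulmxDl -scalemxAl addrCA.
by [].
Qed.

(** Taylor formula of order 2 along the flow of E_k, where E_k is constant, by
    two applications of the mean value theorem. *)
Lemma flow_estimate k f C p s : smooth f -> (forall q, `|Xf k (Xf k f) q| <= C) ->
  `|f (p + s *: row k (frame p)) - f p - s * Xf k f p| <= C * (`|s| * `|s|).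
Proof.
move=> sf fC; set E := row k (frame p).
have flow g : smooth g -> forall t : R,
    is_derive t 1 (fun t => g (p + t *: E)) (Xf k g (p + t *: E)).
  move=> sg t; rewrite /Xf row_frame_flow; apply: is_derive_line.
  by move=> q; exact: smooth_derivable.
have [xi xis E1] := mvt_sym s (flow f sf).
have [eta etaxi E2] := mvt_sym xi (flow _ (smooth_Xf k sf)).
move: E1 E2; rewrite !scale0r !addr0 => -> E2.
rewrite [_ * s]mulrC -mulrBr E2 normrM mulrC normrM -mulrA ler_pM ?mulr_ge0//.
by rewrite ler_wpM2r.
Qed.

(** A divergence with a positive lower bound would give functions v_k / step
    whose differences along the flows have a positive sum, up to the Taylor
    errors, which are small because v_k and its second derivatives are bounded
    on the compact quotient. *)
Lemma no_positive_divergence (c : R) (v : 'I_8 -> G -> R) : 0 < c ->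
  (forall k, smooth (v k)) -> (forall k, Gamma_invariant (v k)) ->
  ~ (forall p, c <= \sum_k Xf k (v k) p).
Proof.
move=> c0 sv vI vc.
have [C C0 HC] : exists2 C : R, 0 <= C & forall k p,
    `|v k p| <= C /\ `|Xf k (Xf k (v k)) p| <= C.
  have H k : exists C, 0 <= C /\ forall p, `|v k p| <= C /\ `|Xf k (Xf k (v k)) p| <= C.
    have [C1 C10 H1] := invariant_bounded (smooth_continuous (sv k)) (vI k).
    have [C2 C20 H2] := invariant_bounded
      (smooth_continuous (smooth_Xf k (smooth_Xf k (sv k))))
      (Xf_invariant k (Xf_invariant k (vI k))).
    exists (C1 + C2); split; first exact: addr_ge0.
    by move=> p; split; [apply: le_trans (H1 p) _|apply: le_trans (H2 p) _];
      rewrite ?lerDl ?lerDr.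
  have /choice[C HC] := H; exists (\sum_k C k).
    by apply: sumr_ge0 => k _; case: (HC k).
  move=> k p; have [_ /(_ p)[H1 H2]] := HC k.
  have CS : C k <= \sum_k C k.
    by rewrite (bigD1 k)//= lerDl; apply: sumr_ge0 => l _; case: (HC l).
  by split; [apply: le_trans H1 CS|apply: le_trans H2 CS].
(* The eight Taylor errors C h add up to at most c / 2. *)
pose h := Num.min 1 (c / (16 * (C + 1))).
have C1 : 0 < 16 * (C + 1) by rewrite mulr_gt0// ltr_wpDl.
have h0 : 0 < h by rewrite lt_min ltr01 divr_gt0.
have h1 : h <= 1 by rewrite ge_min lexx.
have hc : 8 * (C * h) <= c / 2.
  have : h <= c / (16 * (C + 1)) by rewrite ge_min lexx orbT.
  rewrite ler_pdivlMr//; nra.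
have s0 k : 0 < step h k by rewrite /step; case: ifP => _; rewrite ?mulr_gt0.
have sh k : step h k <= h.
  by rewrite /step; case: ifP => _ //; rewrite ger_pMr.
have hhs k : h * h <= step h k by rewrite /step; case: ifP => _ //; rewrite ger_pMr.
pose u k p := v k p / step h k.
apply: (@no_positive_sum_diff R h (C / (h * h)) _ (c / 2) u).
- by rewrite divr_ge0// mulr_ge0// ltW.
- by rewrite divr_gt0.
- move=> k q; rewrite /u normrM normfV [`|step h k|]gtr0_norm//.
  rewrite ler_pM ?invr_ge0 ?(ltW (s0 k))//; first by case: (HC k q).
  by rewrite lef_pV2 ?posrE ?mulr_gt0.
move=> q; have E k : Xf k (v k) q <= diff h k (u k) q + C * h.
  have sk := s0 k.
  have := flow_estimate q (step h k) (sv k) (fun q => (HC k q).2).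
  rewrite (gtr0_norm sk) ; rewrite ler_norml => /andP[+ _].
  have Cs : C * (step h k * step h k) <= step h k * (C * h).
    by rewrite [leRHS]mulrCA ler_wpM2l// ler_wpM2l// ltW.
  move=> A; rewrite -(ler_pM2l sk) mulrDr (_ : step h k * diff h k (u k) q =
    v k (q + step h k *: row k (frame q)) - v k q); first by move: A Cs; lra.
  by rewrite /diff /u -mulrBl mulrC divfK// gt_eqF.
have : \sum_k Xf k (v k) q <= \sum_k (diff h k (u k) q + C * h).
  by apply: ler_sum => k _; exact: E.
rewrite big_split sumr_const card_ord /= -[C * h *+ 8]mulr_natl.
by move: (vc q) hc; lra.
Qed.

End DivergenceMean.

(** * Non-existence of SKT metrics *)

Section LinearClasses.
Variable R : realType.
Local Notation C := R[i].
Local Notation Lam := (Lam R).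
Local Notation G := 'rV[R]_8.
Variable P : (G -> R) -> Prop.

(** A linear space of functions, given by its membership predicate.  Smooth
    invariant functions and divergences are both handled as such, on the
    coefficients of forms. *)
Definition linear_class :=
  [/\ P (fun=> 0), forall f g, P f -> P g -> P (fun x => f x + g x) &
      forall (c : R) f, P f -> P (fun x => c * f x)].

Definition complex_in (F : G -> C) :=
  P (fun x => complex.Re (F x)) /\ P (fun x => complex.Im (F x)).

Definition form_in (A : G -> Lam) := forall S, complex_in (fun x => A x S).

Hypothesis Plin : linear_class.

Lemma eq_class f g : f =1 g -> P f -> P g.
Proof. by move=> /funext ->. Qed.

Lemma eq_complex_in F1 F2 : F1 =1 F2 -> complex_in F1 -> complex_in F2.
Proof. by move=> /funext ->. Qed.

Lemma complex_in0 : complex_in (fun=> 0).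
Proof. by case: Plin => P0 _ _; split; exact: P0. Qed.

Lemma complex_inD F1 F2 : complex_in F1 -> complex_in F2 ->
  complex_in (fun x => F1 x + F2 x).
Proof.
case: Plin => _ PD _ [r1 i1] [r2 i2]; split.
  by apply: (eq_class _ (PD _ _ r1 r2)) => x; rewrite ReD.
by apply: (eq_class _ (PD _ _ i1 i2)) => x; rewrite ImD.
Qed.

Lemma complex_inZ (c : C) F : complex_in F -> complex_in (fun x => F x * c).
Proof.
case: Plin => _ PD PZ [r s]; split.
  apply: (eq_class _ (PD _ _ (PZ (complex.Re c) _ r) (PZ (- complex.Im c) _ s))) => x.
  by rewrite ReM mulNr; congr (_ - _); exact: mulrC.
apply: (eq_class _ (PD _ _ (PZ (complex.Im c) _ r) (PZ (complex.Re c) _ s))) => x.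
by rewrite ImM; congr (_ + _); exact: mulrC.
Qed.

Lemma form_in_sum (I : Type) (r : seq I) (A : I -> G -> Lam) :
  (forall l, form_in (A l)) -> form_in (fun x => \sum_(l <- r) A l x).
Proof.
move=> PA S; elim: r => [|l r IH].
  by apply: (eq_complex_in _ complex_in0) => x; rewrite big_nil lam0E.
by apply: (eq_complex_in _ (complex_inD (PA l S) IH)) => x; rewrite big_cons lamDE.
Qed.

Lemma eq_form_in A B : A =1 B -> form_in A -> form_in B.
Proof. by move=> /funext ->. Qed.

Lemma form_inD A B : form_in A -> form_in B -> form_in (fun x => A x + B x).
Proof.
move=> PA PB S.
by apply: (eq_complex_in _ (complex_inD (PA S) (PB S))) => x; rewrite lamDE.
Qed.

Lemma form_in_linear (T : Lam -> Lam) A : linear T -> form_in A ->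
  form_in (fun x => T (A x)).
Proof.
move=> Tlin PA S.
apply: (@eq_complex_in (fun x => \sum_U A x U * T (dxs R U) S)).
  by move=> x; rewrite -linear_funE.
elim: (index_enum _) => [|U r IH].
  by apply: (eq_complex_in _ complex_in0) => x; rewrite big_nil.
apply: (eq_complex_in _ (complex_inD (complex_inZ (T (dxs R U) S) (PA U)) IH)) => x.
by rewrite big_cons.
Qed.

Lemma form_in_const f (a : Lam) : P f -> form_in (fun x => (f x)%:C *: a).
Proof.
case: Plin => P0 _ _ Pf S.
apply: (@eq_complex_in (fun x => (f x)%:C * a S)) => [x|]; first by rewrite lamZE.
by apply: complex_inZ; split.
Qed.

End LinearClasses.

Section InvariantCalculus.
Variable R : realType.
Local Notation C := R[i].
Local Notation Lam := (Lam R).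
Local Notation G := 'rV[R]_8.
Local Notation Jc := (Jframe R).
Local Notation dx := (dx R).
Variable Gamma : discrete_subgroup R.
Implicit Types (f g : G -> R) (x : G) (k : 'I_8) (A : G -> Lam).

Definition inv_smooth f := smooth f /\ Gamma_invariant Gamma f.

Definition divergence f := exists v : 'I_8 -> G -> R,
  (forall k, inv_smooth (v k)) /\ forall x, f x = \sum_k Xf k (v k) x.

Lemma inv_smooth_class : linear_class inv_smooth.
Proof.
split.
- by split=> //; exact: smooth_cst.
- move=> f g [sf fI] [sg gI]; split; first exact: smoothD.
  by move=> c Gc p; rewrite fI// gI.
- move=> c f [sf fI]; split; first exact: smoothZ.
  by move=> d Gd p; rewrite fI.
Qed.

Lemma XfD k f g x : smooth f -> smooth g ->
  Xf k (fun x => f x + g x) x = Xf k f x + Xf k g x.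
Proof. by move=> sf sg; apply: deriveD; exact: smooth_derivable. Qed.

Lemma XfZ k c f x : smooth f -> Xf k (fun x => c * f x) x = c * Xf k f x.
Proof. by move=> sf; apply: deriveZ; exact: smooth_derivable. Qed.

Lemma divergence_class : linear_class divergence.
Proof.
have [I0 ID IZ] := inv_smooth_class; split.
- exists (fun _ _ => 0); split=> // x; rewrite big1// => k _; exact: derive_cst.
- move=> f g [v [vS fE]] [w [wS gE]]; exists (fun k x => v k x + w k x); split.
    by move=> k; exact: ID.
  move=> x; rewrite fE gE -big_split; apply: eq_bigr => k _.
  by rewrite XfD//; [case: (vS k)|case: (wS k)].
- move=> c f [v [vS fE]]; exists (fun k x => c * v k x); split.
    by move=> k; exact: IZ.
  move=> x; rewrite fE mulr_sumr; apply: eq_bigr => k _.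
  by rewrite XfZ//; case: (vS k).
Qed.

Lemma inv_smooth_Xf k f : inv_smooth f -> inv_smooth (Xf k f).
Proof. by move=> [sf fI]; split; [exact: smooth_Xf|exact: Xf_invariant]. Qed.

Lemma divergence_Xf k f : inv_smooth f -> divergence (Xf k f).
Proof.
move=> fS; have [I0 _ _] := inv_smooth_class.
exists (fun l => if l == k then f else (fun=> 0)); split=> [l|x].
  by case: ifP.
rewrite (bigD1 k)//= eqxx big1 ?addr0// => l /negbTE ->; exact: derive_cst.
Qed.

Local Notation inv_form := (form_in inv_smooth).
Local Notation div_form := (form_in divergence).

Lemma inv_form_smooth A : inv_form A -> lsmooth A.
Proof. by move=> AS S; have [[? _] [? _]] := AS S. Qed.

Lemma inv_form_XL k A : inv_form A -> inv_form (XL k A).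
Proof.
move=> AS S; have [r s] := AS S.
apply: (@eq_complex_in _ _ (fun x => Xf k (fun y => complex.Re (A y S)) x +i*
    Xf k (fun y => complex.Im (A y S)) x)) => [x|]; first by rewrite /XL dirLE.
by split; exact: inv_smooth_Xf.
Qed.

Lemma div_form_XL k A : inv_form A -> div_form (XL k A).
Proof.
move=> AS S; have [r s] := AS S.
apply: (@eq_complex_in _ _ (fun x => Xf k (fun y => complex.Re (A y S)) x +i*
    Xf k (fun y => complex.Im (A y S)) x)) => [x|]; first by rewrite /XL dirLE.
by split; exact: divergence_Xf.
Qed.

Let mul_linear (a : Lam) : linear (fun b : Lam => a * b).
Proof.
by move=> c b d; rewrite mulrDr; congr (_ + _); exact: (esym (scalerAr _ _ _)).
Qed.

Lemma inv_form_dinv A : inv_form A -> inv_form (dinv A).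
Proof.
move=> AS; apply: (form_inD inv_smooth_class).
  apply: (form_in_sum inv_smooth_class) => k.
  apply: (form_in_linear inv_smooth_class (mul_linear (dx k))).
  exact: inv_form_XL.
exact: (form_in_linear inv_smooth_class (@dframe_linear R)).
Qed.

(** Modulo divergences, the exterior derivative of an invariant form only
    retains the structure equation. *)
Lemma div_form_dinv A : inv_form A ->
  div_form (fun x => dinv A x - dframe (A x)).
Proof.
move=> AS; apply: (@eq_form_in _ _ (fun x => \sum_k dx k * XL k A x)) => [x|].
  by rewrite /dinv addrK.
apply: (form_in_sum divergence_class) => k.
apply: (form_in_linear divergence_class (mul_linear (dx k))).
exact: div_form_XL.
Qed.

(** The part of the exterior derivative in the coframe that changes the type
    (p, q) into (r p, s q), as for [proj_dframe]. *)
Definition proj_dinv (r s : nat -> nat) A x : Lam := \sum_(p < 5) \sum_(q < 5)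
  ext_bidegree Jc (r p) (s q) (dinv (fun y => ext_bidegree Jc p q (A y)) x).

Let Blin p q := @ext_bidegree_linear R Jc p q.

Let comp_linear (T U : Lam -> Lam) : linear T -> linear U -> linear (fun a => T (U a)).
Proof. by move=> Tl Ul c a b; rewrite Ul Tl. Qed.

Lemma proj_dframe_linear r s : linear (@proj_dframe R r s).
Proof.
move=> c a b; rewrite /proj_dframe scaler_sumr -big_split; apply: eq_bigr => p _.
rewrite scaler_sumr -big_split; apply: eq_bigr => q _ /=.
exact: (comp_linear (Blin _ _) (comp_linear (@dframe_linear R) (Blin _ _))).
Qed.

Lemma inv_form_proj_dinv r s A : inv_form A -> inv_form (proj_dinv r s A).
Proof.
move=> AS; apply: (form_in_sum inv_smooth_class) => p.
apply: (form_in_sum inv_smooth_class) => q.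
apply: (form_in_linear inv_smooth_class (Blin _ _)); apply: inv_form_dinv.
exact: (form_in_linear inv_smooth_class (Blin _ _)).
Qed.

Lemma div_form_proj_dinv r s A : inv_form A ->
  div_form (fun x => proj_dinv r s A x - proj_dframe r s (A x)).
Proof.
move=> AS; apply: (@eq_form_in _ _ (fun x => \sum_(p < 5) \sum_(q < 5)
    ext_bidegree Jc (r p) (s q) (dinv (fun y => ext_bidegree Jc p q (A y)) x -
      dframe (ext_bidegree Jc p q (A x))))) => [x|].
  rewrite /proj_dinv /proj_dframe -sumrB; apply: eq_bigr => p _.
  rewrite -sumrB; apply: eq_bigr => q _.
  by rewrite addrC -scaleN1r Blin scaleN1r addrC.
apply: (form_in_sum divergence_class) => p.
apply: (form_in_sum divergence_class) => q.
apply: (form_in_linear divergence_class (Blin _ _)).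
apply: (@div_form_dinv (fun y => ext_bidegree Jc p q (A y))).
exact: (form_in_linear inv_smooth_class (Blin _ _)).
Qed.

Lemma proj_framed (r s : nat -> nat) A x : lsmooth A ->
  (forall p, (p < 5)%N -> (r p < 9)%N) -> (forall q, (q < 5)%N -> (s q < 9)%N) ->
  \sum_(p < 5) \sum_(q < 5) (bidegree (@Jfield R) (r p) (s q)
    (extd (bidegree (@Jfield R) p q (fun x => framed x (A x)))) x : Lam) =
  framed x (proj_dinv r s A x).
Proof.
move=> sA r9 s9; have [fl _ _] := framedP x; have lt9 (p : 'I_5) : (p < 9)%N.
  exact: ltn_trans (ltn_ord p) _.
rewrite /proj_dinv (linear_fun_sum _ fl); apply: eq_bigr => p _.
rewrite (linear_fun_sum _ fl); apply: eq_bigr => q _.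
rewrite /bidegree -bidegree_framed ?r9 ?s9//.
congr (ext_bidegree _ _ _ _); rewrite -extd_framed; last exact: lsmooth_linear.
by congr (extd _ x); apply/funext => y; rewrite bidegree_framed.
Qed.

Lemma succ_lt9 p : (p < 5)%N -> (p.+1 < 9)%N.
Proof. by move=> p5; exact: (@leq_ltn_trans 5). Qed.

Lemma lt9_of_lt5 p : (p < 5)%N -> (p < 9)%N.
Proof. by move=> p5; exact: ltn_trans p5 _. Qed.

Lemma del_framed A : lsmooth A ->
  del (@Jfield R) (fun x => framed x (A x)) = (fun x => framed x (proj_dinv S id A x)).
Proof.
move=> sA; apply/funext => x.
exact: (@proj_framed S id A x sA succ_lt9 lt9_of_lt5).
Qed.

Lemma delbar_framed A : lsmooth A ->
  delbar (@Jfield R) (fun x => framed x (A x)) =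
  (fun x => framed x (proj_dinv id S A x)).
Proof.
move=> sA; apply/funext => x.
exact: (@proj_framed id S A x sA lt9_of_lt5 succ_lt9).
Qed.

Lemma framed_eq0 x a : framed x a = 0 -> a = 0.
Proof.
move=> /eqP; rewrite subr_eq0 => /eqP aE; have := aE.
suff -> : contr iz a = 0 by rewrite mulr0.
by rewrite aE contr_cov xdy_iz rmorph0 scale0r sub0r contr_contr mulr0 oppr0.
Qed.

(** Both del and delbar, in the coframe, differ from their constant-coefficient
    versions by divergences, and constant-coefficient operators preserve
    divergences. *)
Lemma deldelbar_framed_eq0 A : inv_form A ->
  (forall x, del (@Jfield R) (delbar (@Jfield R) (fun x => framed x (A x))) x = 0) ->
  div_form (fun x => delframe (delbarframe (A x))).
Proof.
move=> AS H; have sA := inv_form_smooth AS.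
have BS := inv_form_proj_dinv id S AS; have sB := inv_form_smooth BS.
have E x : proj_dinv S id (proj_dinv id S A) x = 0.
  by apply: (@framed_eq0 x); rewrite -(H x) delbar_framed// del_framed.
have D1 := div_form_proj_dinv S id BS.
have D2 := form_in_linear divergence_class (proj_dframe_linear S id)
  (div_form_proj_dinv id S AS).
have N1 : linear (fun a : Lam => - a) by move=> c a b; rewrite opprD scalerN.
apply: (eq_form_in _ (form_in_linear divergence_class N1
  (form_inD divergence_class D1 D2))) => x.
have L := proj_dframe_linear S id.
have -> : proj_dframe S id (proj_dinv id S A x - proj_dframe id S (A x)) =
    proj_dframe S id (proj_dinv id S A x) -
    proj_dframe S id (proj_dframe id S (A x)).
  by rewrite addrC -scaleN1r L scaleN1r addrC.
by rewrite E sub0r addKr opprK.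
Qed.

End InvariantCalculus.

Section NoSKT.
Variable R : realType.
Local Notation C := R[i].
Local Notation Lam := (Lam R).
Local Notation G := 'rV[R]_8.
Local Notation Jc := (Jframe R).
Local Notation dx := (dx R).
Implicit Types (x : G) (i j k : 'I_8).

Lemma prod_dx_neq0 (r : seq 'I_8) : uniq r ->
  \prod_(i <- r) dx i != 0.
Proof.
move=> ur; suff [c c0 ->] : exists2 c : C, c != 0 &
    \prod_(i <- r) dx i = c *: dxs R [set i in r]%SET.
  rewrite scaler_eq0 negb_or c0 /=; apply/eqP => /ffunP/(_ [set i in r]%SET).
  by rewrite lam0E => /eqP; rewrite dxsE eqxx oner_eq0.
elim: r ur => [|i r IH] /=.
  exists 1; first exact: oner_neq0.
  by rewrite big_nil scale1r -dxs0; congr (dxs R _).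
move=> /andP[ir /IH[c c0 E]]; exists (c * insert_sign R i [set j in r]%SET).
  rewrite mulf_neq0//; apply/eqP => s0.
  have := insert_sign_sqr R i [set j in r]%SET.
  by rewrite s0 mul0r => /eqP; rewrite eq_sym oner_eq0.
rewrite big_cons E -scalerAr dx_dxs inE (negbTE ir) scalerA; congr (_ *: dxs R _).
by apply/setP => j; rewrite !inE.
Qed.

(** Its product with dx_2 /\ dy_2 is twice the horizontal volume form. *)
Lemma sigma_sqr_neq0 : sigma R * sigma R * 1 != 0.
Proof.
pose w (j : 'I_3) : C := (j == inord 2)%:R.
suff : sigma R * sigma R * hor w != 0 by apply: contraNneq; rewrite mulr1 => ->; rewrite mul0r.
rewrite /sigma hor_mul3 scaler_eq0 negb_or; apply/andP; split.
  by rewrite /w eqxx -![_ == inord 2](inj_eq val_inj) /= !inordK.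
rewrite /dxx /partner !inordK//=.
have := @prod_dx_neq0 [:: inord 0; inord 3; inord 1; inord 4; inord 2; inord 5].
rewrite !big_cons big_nil mulr1 !mulrA; apply.
by rewrite -(map_inj_uniq val_inj) /= !inordK.
Qed.

Variable Gamma : discrete_subgroup R.
Hypothesis Mcompact : compact [set: nilmanifold Gamma].
Variable g : G -> 'M[R]_8.
Hypothesis gherm : hermitian_metric Gamma (@Jfield R) g.

(** The matrix of g in the frame, with smooth Gamma-invariant entries. *)
Let K x : 'M[R]_8 := frame x *m g x *m (frame x)^T.

(** Left translations are affine in these coordinates. *)
Lemma dleftE c x v : dleft c x v = v *m frame c.
Proof.
rewrite /dleft /derive; apply: cvg_lim => //.
have E : \forall h \near 0^', h^-1 *: ((hmul c \o shift x) (h *: v) - hmul c x) = v *m frame c.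
  near=> h; rewrite /= !hmul_frame mulmxDl -scalemxAl addrCA addrK scalerA mulVf ?scale1r//.
  by near: h; exact: nbhs_dnbhs_neq.
exact: cvg_near_cst E.
Unshelve. all: by end_near.
Qed.

Lemma bil_mulmx (A B : 'M[R]_8) u v :
  bil A (u *m B) (v *m B) = bil (B *m A *m B^T) u v.
Proof. by rewrite /bil trmx_mul !mulmxA. Qed.

Let bil_inj (A B : 'M[R]_8) : (forall u v, bil A u v = bil B u v) -> A = B.
Proof.
move=> H; apply/matrixP => i j; have := H (ebase R i) (ebase R j).
by rewrite /bil /ebase !trmx_delta -!rowE -!colE !mxE.
Qed.

Let g_sym x : (g x)^T = g x.
Proof.
case: gherm => _ gs _ _ _; apply: bil_inj => u v.
have T (A : 'M[R]_1) : A 0 0 = A^T 0 0 by rewrite mxE.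
by rewrite [RHS]gs /bil [RHS]T !trmx_mul trmxK mulmxA.
Qed.

Let g_J x : Jfield x *m g x *m (Jfield x)^T = g x.
Proof.
case: gherm => _ _ _ gJ _; apply: bil_inj => u v.
by rewrite -[RHS]gJ bil_mulmx.
Qed.

Let mx_anti (A B : 'M[R]_8) : A *m A = - 1%:M -> B^T = B ->
  A *m B *m A^T = B -> (A *m B)^T = - (A *m B).
Proof.
move=> AA BT AB; rewrite trmx_mul BT -[in RHS]AB !mulmxA AA.
by rewrite !mulNmx mul1mx opprK.
Qed.

Lemma Jg_anti x : (Jfield x *m g x)^T = - (Jfield x *m g x).
Proof. exact: mx_anti (Jfield_sqr x) (g_sym x) (g_J x). Qed.

Let K_sym x : (K x)^T = K x.
Proof. by rewrite /K !trmx_mul trmxK g_sym mulmxA. Qed.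

Let frame_J x : frame x *m Jfield x = Jc *m frame x.
Proof. by rewrite /Jfield !mulmxA frameVK mul1mx. Qed.

Let K_J x : Jc *m K x *m Jc^T = K x.
Proof.
have E (F A B : 'M[R]_8) : F *m A = Jc *m F ->
    A *m B *m A^T = B -> Jc *m (F *m B *m F^T) *m Jc^T = F *m B *m F^T.
  move=> FA AB; rewrite -{2}AB !mulmxA FA -!mulmxA -trmx_mul.
  by rewrite -[in RHS]trmx_mul FA trmx_mul.
exact: E (frame_J x) (g_J x).
Qed.

(** The matrix of the fundamental form in the frame. *)
Let W x := frame x *m (Jfield x *m g x) *m (frame x)^T.

Let W_K x : W x = Jc *m K x.
Proof.
have E (F A B : 'M[R]_8) : F *m A = Jc *m F ->
    F *m (A *m B) *m F^T = Jc *m (F *m B *m F^T).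
  by move=> FA; rewrite !mulmxA FA.
exact: E (frame_J x).
Qed.

Let W_anti x : (W x)^T = - W x.
Proof. by rewrite W_K; apply: mx_anti; [exact: Jframe_sqr|exact: K_sym|exact: K_J]. Qed.

Let W_J x : Jc *m W x *m Jc^T = W x.
Proof. by rewrite W_K -(mulmxA Jc (Jc *m K x)) K_J. Qed.

Let K_bil x i j : K x i j = bil (g x) (row i (frame x)) (row j (frame x)).
Proof.
rewrite /K /bil tr_row -row_mul [LHS]mxE [RHS]mxE; apply: eq_bigr => k _.
by rewrite [row _ _ _ _]mxE [col _ _ _ _]mxE.
Qed.

Let K_inv_smooth i j : inv_smooth Gamma (fun x => K x i j).
Proof.
case: gherm => gs _ _ _ gI; split.
  exact: (smooth_mxM (smooth_mxM (@smooth_mx_frame R) gs) (smooth_mxT (@smooth_mx_frame R))).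
move=> c Gc x; rewrite !K_bil frame_hmul frameC !row_mul.
by rewrite -!(dleftE c x) gI.
Qed.

Let A x : Lam := form2 (map_mx (real_complex R) (W x)).

Let A_inv : form_in (inv_smooth Gamma) A.
Proof.
have cl := inv_smooth_class Gamma; have [_ _ IZ] := cl.
apply: (@eq_form_in _ _ (fun x => \sum_i \sum_j
    (W x i j)%:C *: (2^-1 *: (dx i * dx j)))) => [x|].
  rewrite /A /form2 scaler_sumr; apply: eq_bigr => i _.
  rewrite scaler_sumr; apply: eq_bigr => j _.
  by rewrite [(map_mx _ _) i j]mxE [LHS]scalerA [RHS]scalerA [2^-1 * _]mulrC.
apply: (form_in_sum cl) => i; apply: (form_in_sum cl) => j.
apply: (form_in_const cl); apply: (eq_class _ (IZ (Jsign R i) _ (K_inv_smooth (partner i) j))).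
by move=> x; rewrite W_K mulJframe.
Qed.

Let K_it_pos x : 0 < K x it it.
Proof.
case: gherm => _ _ gp _ _; rewrite K_bil; apply: gp; apply/eqP => /rowP/(_ it).
by rewrite !mxE eqxx /iz -(inj_eq val_inj) /= !inordK//= mulr0 addr0 => /eqP; rewrite oner_eq0.
Qed.

(** Contracting the fundamental form with Z leaves the 1-form lambda with
    lambda(Z) = 0 and lambda(T) = g(T, T).  By [deldelbarframe] with u = 1, the
    form del delbar Omega is (i / 2) g(T, T) sigma^2 modulo divergences, so
    under the SKT condition g(T, T) is a divergence. *)
Lemma not_SKT : ~ SKT (@Jfield R) g.
Proof.
move=> skt.
have AE : fundamental_form (@Jfield R) g = fun x => framed x (A x).
  by apply/funext => x; apply: framed_fundamental_form; exact: Jg_anti.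
have dA := deldelbar_framed_eq0 A_inv.
have {}dA : form_in (divergence Gamma) (fun x => delframe (delbarframe (A x))).
  by apply: dA => x; rewrite -AE; exact: skt.
have WE x : W x it it = 0 /\ W x iz iz = 0 /\ W x iz it = K x it it.
  have p67 : partner iz = it by apply: val_inj; rewrite /partner /= !inordK.
  split; last split.
  - have /matrixP/(_ it it) := W_anti x; rewrite !mxE => /eqP.
    by rewrite -addr_eq0 -mulr2n mulrn_eq0 /= => /eqP.
  - have /matrixP/(_ iz iz) := W_anti x; rewrite !mxE => /eqP.
    by rewrite -addr_eq0 -mulr2n mulrn_eq0 /= => /eqP.
  - by rewrite W_K mulJframe p67 /Jsign inordK//= mul1r.
have ddA x : delframe (delbarframe (A x)) =
    ('i%C * (K x it it)%:C / 2) *: (sigma R * sigma R * 1).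
  have WCJ : map_mx (real_complex R) Jc *m map_mx (real_complex R) (W x) *m
      (map_mx (real_complex R) Jc)^T = map_mx (real_complex R) (W x).
    by rewrite map_trmx -!map_mxM W_J.
  have WCa : (map_mx (real_complex R) (W x))^T = - map_mx (real_complex R) (W x).
    by rewrite map_trmx W_anti map_mxN.
  have cA : contr iz (A x) = 1 * cov (fun j => map_mx (real_complex R) (W x) iz j).
    by rewrite mul1r; exact: contr_form2.
  rewrite (@deldelbarframe R 0 1 _ (A x) _ (central_horizontal1 R) (has_type1 _) (form2_type WCJ) cA)//.
  by have [_ [W66 W67]] := WE x; rewrite [(map_mx _ _) iz iz]mxE [(map_mx _ _) iz it]mxE W66 W67 rmorph0 add0r.
have [S0 S0N] : exists S0, (sigma R * sigma R * 1 : Lam) S0 != 0.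
  apply/existsP; apply: contraNT (@sigma_sqr_neq0) => /existsPn H.
  by apply/eqP/ffunP => U; rewrite lam0E; apply/eqP; have := H U; rewrite negbK.
have dK : divergence Gamma (fun x => K x it it).
  set z := (sigma R * sigma R * 1 : Lam) S0 in S0N.
  have [r _] := complex_inZ (divergence_class Gamma) (2 / ('i%C * z)) (dA S0).
  apply: (eq_class _ r) => x; rewrite ddA lamZE -/z.
  have -> : 'i%C * (K x it it)%:C / 2 * z * (2 / ('i%C * z)) = (K x it it)%:C.
    by field; rewrite S0N /=; exact: neq0Ci.
  by [].
have [v [vS vE]] := dK.
have [Ks KI] := K_inv_smooth it it.
have Kc := smooth_continuous Ks.
(* A bound of the inverse of g(T, T) is a positive lower bound of g(T, T). *)
have [B B0 HB] : exists2 B, 0 <= B & forall p, `|(K p it it)^-1| <= B.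
  apply: (invariant_bounded Mcompact); last by move=> c Gc p; rewrite (KI c Gc p).
  by move=> p; exact: (cvgV (lt0r_neq0 (K_it_pos p)) (Kc p)).
apply: (@no_positive_divergence R Gamma Mcompact (B + 1)^-1 v).
- by rewrite invr_gt0 ltr_wpDl.
- by move=> k; case: (vS k).
- by move=> k; case: (vS k).
move=> p; rewrite -vE -[leRHS]invrK lef_pV2 ?posrE ?invr_gt0//; last by rewrite ltr_wpDl.
rewrite (le_trans (ler_norm _))// (le_trans (HB p))// lerDl.
by [].
Qed.

End NoSKT.

(** * A global holomorphic chart *)

Section HolomorphicChart.
Variable R : realType.
Local Notation G := 'rV[R]_8.
Implicit Types (x y v w : G) (i j k : 'I_8).

(** The real parts of the holomorphic coordinates are x_0, x_1, x_2, z and their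
    imaginary parts are y_0, y_1, - y_2 and t minus a quadratic function:
    [chart_lin] reorders the coordinates accordingly. *)
Definition chart_perm j : 'I_8 := inord (nth 0%N [:: 0; 1; 2; 6; 3; 4; 5; 7]%N j).
Definition chart_perm_inv j : 'I_8 := inord (nth 0%N [:: 0; 1; 2; 4; 5; 6; 3; 7]%N j).
Definition chart_sign j : R := if j == inord 6 then -1 else 1.

Definition Jquad x y : R := x 0 (inord 0) * y 0 (inord 0) +
  x 0 (inord 1) * y 0 (inord 1) - x 0 (inord 2) * y 0 (inord 2).

Definition chart_lin x : G := \row_j (chart_sign j * x 0 (chart_perm j)).
Definition chart_lin_inv x : G :=
  \row_j (chart_sign (chart_perm_inv j) * x 0 (chart_perm_inv j)).

Definition chart x : G := chart_lin x - (Jquad x x / 2) *: ebase R it.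
Definition chart_inv w : G := chart_lin_inv (w + (Jquad w w / 2) *: ebase R it).

Lemma chart_permK j : chart_perm (chart_perm_inv j) = j.
Proof. by apply: val_inj; elim/ord8P : j; rewrite /chart_perm /chart_perm_inv !inordK. Qed.

Lemma chart_perm_invK j : chart_perm_inv (chart_perm j) = j.
Proof. by apply: val_inj; elim/ord8P : j; rewrite /chart_perm /chart_perm_inv !inordK. Qed.

Lemma chart_sign_sqr j : chart_sign j * chart_sign j = 1.
Proof. by rewrite /chart_sign; case: ifP; rewrite ?mulrNN mulr1. Qed.

Lemma chart_linK : cancel chart_lin chart_lin_inv.
Proof. by move=> x; apply/rowP => j; rewrite !mxE chart_permK mulrA chart_sign_sqr mul1r. Qed.

Lemma chart_lin_invK : cancel chart_lin_inv chart_lin.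
Proof. by move=> x; apply/rowP => j; rewrite !mxE chart_perm_invK mulrA chart_sign_sqr mul1r. Qed.

Lemma ebase_at i j : ebase R i 0 j = (j == i)%:R.
Proof. by rewrite mxE eqxx. Qed.

(** The quadratic correction only involves x_0, x_1, x_2, which the chart
    preserves; this is why subtracting it is invertible. *)
Lemma Jquad_chart x : Jquad (chart x) (chart x) = Jquad x x.
Proof.
have E (k : nat) : (k < 3)%N -> chart x 0 (inord k) = x 0 (inord k).
  move=> k3; rewrite /chart /chart_lin !mxE /chart_sign /chart_perm -!(inj_eq val_inj) /=.
  by case: k k3 => [|[|[|k]]] // _; rewrite !inordK//= mulr0 subr0 mul1r.
by rewrite /Jquad !E.
Qed.

Lemma chartK : cancel chart chart_inv.
Proof. by move=> x; rewrite /chart_inv Jquad_chart /chart subrK chart_linK. Qed.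

Lemma chart_invK : cancel chart_inv chart.
Proof.
move=> w; rewrite /chart {1}/chart_inv chart_lin_invK.
suff -> : Jquad (chart_inv w) (chart_inv w) = Jquad w w by rewrite addrK.
have E (k : nat) : (k < 3)%N -> chart_inv w 0 (inord k) = w 0 (inord k).
  move=> k3; rewrite /chart_inv /chart_lin_inv !mxE /chart_sign /chart_perm_inv -!(inj_eq val_inj) /=.
  by case: k k3 => [|[|[|k]]] // _; rewrite !inordK//= mulr0 addr0 mul1r.
by rewrite /Jquad !E.
Qed.

Lemma smooth_Jquad : smooth (fun x => Jquad x x).
Proof.
have s i : smooth (fun x => x 0 i * x 0 i) by apply: smoothM; exact: smooth_coord.
exact: smoothD (smoothD (s _) (s _)) (smoothN (s _)).
Qed.

Lemma chart_at x j : chart x 0 j =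
  chart_sign j * x 0 (chart_perm j) - Jquad x x / 2 * (j == it)%:R.
Proof. by rewrite -ebase_at /chart mxE [X in X + _]mxE [X in _ + X]mxE [X in _ - X]mxE. Qed.

Lemma chart_inv_at w j : let i := chart_perm_inv j in
  chart_inv w 0 j = chart_sign i * (w 0 i + Jquad w w / 2 * (i == it)%:R).
Proof.
rewrite /= -ebase_at /chart_inv /chart_lin_inv mxE; congr (_ * _).
by rewrite [LHS]mxE; congr (_ + _); rewrite mxE.
Qed.

Lemma smooth_chart j : smooth (fun x => chart x 0 j).
Proof.
apply: (eq_smooth _ (smoothD (smoothZ (chart_sign j) (@smooth_coord R (chart_perm j)))
  (smoothZ (- (j == it)%:R / 2) smooth_Jquad))) => x.
by rewrite chart_at; congr (_ + _); field.
Qed.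

Lemma smooth_chart_inv j : smooth (fun x => chart_inv x 0 j).
Proof.
pose i := chart_perm_inv j.
apply: (eq_smooth _ (smoothZ (chart_sign i) (smoothD (@smooth_coord R i)
  (smoothZ ((i == it)%:R / 2) smooth_Jquad)))) => x.
by rewrite chart_inv_at; congr (_ * (_ + _)); field.
Qed.

(** The chart is a polynomial of degree 2, so its derivatives can be read off
    from an exact expansion. *)
Lemma derive_quadratic (f : G -> G) x v (a b : G) :
  (forall h : R, f (h *: v + x) - f x = h *: a + (h * h) *: b) -> 'D_v f x = a.
Proof.
move=> H; rewrite /derive; apply: cvg_lim => //.
apply/cvgrPdist_lt => e e0; near=> h.
have h0 : h != 0 by near: h; exact: nbhs_dnbhs_neq.
rewrite /= H scalerDr !scalerA mulVf// scale1r mulrA mulVf// mul1r.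
rewrite opprD addrA subrr add0r normrN normrZ.
have hs : `|h| < e / (`|b| + 1).
  by near: h; apply: dnbhs0_lt; rewrite divr_gt0// ltr_wpDl.
rewrite (@le_lt_trans _ _ (`|h| * (`|b| + 1)))//.
  by rewrite ler_wpM2l// lerDl.
by rewrite -ltr_pdivlMr// ltr_wpDl.
Unshelve. all: by end_near.
Qed.

Lemma derive_chart x v :
  'D_v chart x = chart_lin v - Jquad x v *: ebase R it.
Proof.
apply: (@derive_quadratic _ _ _ _ (- (Jquad v v / 2) *: ebase R it)) => h.
by apply/rowP => j; rewrite /chart /chart_lin /Jquad !mxE; field.
Qed.

Lemma row_mulJ0 v (n : nat) : (n < 4)%N ->
  (v *m J0 R) 0 (inord n) = - v 0 (inord (n + 4)) /\
  (v *m J0 R) 0 (inord (n + 4)) = v 0 (inord n).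
Proof.
move=> n4; have n8 : (n + 4 < 8)%N by rewrite (ltn_add2r 4 n 4).
have lE : inord n = lshift 4 (Ordinal n4) :> 'I_8.
  by apply: val_inj; rewrite /= inordK// (ltn_trans n4).
have rE : inord (n + 4) = rshift 4 (Ordinal n4) :> 'I_8.
  by apply: val_inj; rewrite /= inordK// addnC.
have JE : v *m J0 R = row_mx (- rsubmx (v : 'rV_(4 + 4))) (lsubmx (v : 'rV_(4 + 4))).
  have := mul_row_block (lsubmx (v : 'rV_(4 + 4))) (rsubmx (v : 'rV_(4 + 4)))
    0 1%:M (- 1%:M) (0 : 'M[R]_4).
  by rewrite hsubmxK !mulmx0 mulmx1 add0r addr0 mulmxN mulmx1.
rewrite JE lE rE; split.
  by apply: (etrans (row_mxEl _ _ _ _)); rewrite !mxE.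
by apply: (etrans (row_mxEr _ _ _ _)); rewrite mxE.
Qed.

Lemma row_mulJfield v x (u := v *m frame (- x)) : v *m Jfield x =
  u *m Jframe R + (\sum_i (u *m Jframe R) 0 i * xdy x i) *: delta_mx 0 iz.
Proof. by rewrite /Jfield !mulmxA mul_frame. Qed.

(** In the direction E_(y_j), the coordinate z + i (t - eps . x^2 / 2) has the
    derivative x_j, and in the direction E_(x_j) it has - i eps_j x_j; these are
    related by J E_(x_j) = eps_j E_(y_j). *)
Lemma chart_holomorphic x v :
  'D_(v *m Jfield x) chart x = 'D_v chart x *m J0 R.
Proof.
rewrite !derive_chart; apply/rowP => j.
have U k : (v *m frame (- x)) 0 k = v 0 k - (\sum_i v 0 i * xdy x i) * (k == iz)%:R.
  rewrite mul_frame !mxE eqxx /= -mulNr -sumrN; congr (_ + _ * _).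
  by apply: eq_bigr => i _; rewrite xdyN mulrN.
have VJ k : (v *m Jfield x) 0 k = - Jsign R k * (v *m frame (- x)) 0 (partner k) +
    (\sum_i - Jsign R i * (v *m frame (- x)) 0 (partner i) * xdy x i) * (k == iz)%:R.
  rewrite row_mulJfield mxE row_mulJframe [X in _ + X = _]mxE [delta_mx _ _ _ _]mxE.
  rewrite eqxx /=; congr (_ + _ * _).
  by apply: eq_bigr => i _; rewrite row_mulJframe.
have X1 : \sum_i v 0 i * xdy x i = v 0 (inord 3) * x 0 (inord 0) +
    v 0 (inord 4) * x 0 (inord 1) + v 0 (inord 5) * x 0 (inord 2).
  by rewrite sum_ord8 /xdy !inordK//= !mulr0 !addr0 !add0r.
have VJE n : (n < 8)%N -> (v *m Jfield x) 0 (inord n) = nth 0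
    [:: - v 0 (inord 3); - v 0 (inord 4); v 0 (inord 5);
        v 0 (inord 0); v 0 (inord 1); - v 0 (inord 2);
        - v 0 (inord 7) + Jquad x v;
        v 0 (inord 6) - (v 0 (inord 3) * x 0 (inord 0) +
          v 0 (inord 4) * x 0 (inord 1) + v 0 (inord 5) * x 0 (inord 2))] n.
  move=> n8; rewrite VJ; have zE i : (i == iz) = (i == 6 :> nat).
    by rewrite -(inj_eq val_inj) /= inordK.
  rewrite sum_ord8 /xdy !U !zE /Jsign /partner.
  case: n n8 => [|[|[|[|[|[|[|[|//]]]]]]]] _;
    rewrite !inordK//= ?X1 /Jquad; ring.
have DE w (n : nat) : (n < 8)%N -> (chart_lin w - Jquad x w *: ebase R it) 0 (inord n) =
    nth 0 [:: w 0 (inord 0); w 0 (inord 1); w 0 (inord 2); w 0 (inord 6);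
     w 0 (inord 3); w 0 (inord 4); - w 0 (inord 5); w 0 (inord 7) - Jquad x w] n.
  move=> n8; rewrite !mxE eqxx /= /chart_sign /chart_perm -!(inj_eq val_inj) /=.
  case: n n8 => [|[|[|[|[|[|[|[|//]]]]]]]] _; rewrite !inordK//=; ring.
set w := chart_lin v - _.
have [[a0 a4] [a1 a5] [a2 a6] [a3 a7]] : [/\ (w *m J0 R) 0 (inord 0) = - w 0 (inord 4) /\
    (w *m J0 R) 0 (inord 4) = w 0 (inord 0),
   (w *m J0 R) 0 (inord 1) = - w 0 (inord 5) /\
    (w *m J0 R) 0 (inord 5) = w 0 (inord 1),
   (w *m J0 R) 0 (inord 2) = - w 0 (inord 6) /\
    (w *m J0 R) 0 (inord 6) = w 0 (inord 2) &
   (w *m J0 R) 0 (inord 3) = - w 0 (inord 7) /\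
    (w *m J0 R) 0 (inord 7) = w 0 (inord 3)].
  by split; [exact: (@row_mulJ0 w 0)|exact: (@row_mulJ0 w 1)|
    exact: (@row_mulJ0 w 2)|exact: (@row_mulJ0 w 3)].
elim/ord8P : j; rewrite (a0, a1, a2, a3, a4, a5, a6, a7) !DE//= !VJE//= /Jquad ?VJE//=; ring.
Qed.

End HolomorphicChart.

(** * Balanced and Gauduchon metrics *)

Lemma half_pairs (F : fieldType) (V : lmodType F) (a b c d : V) : 2 != 0 :> F ->
  2^-1 *: (a + b + c + a + b + c + d + d) = a + b + c + d :> V.
Proof.
move=> two0; apply: (scalerI two0); rewrite scalerA divff// scale1r scaler_nat mulr2n.
by rewrite [RHS]addrACA !addrA.
Qed.

Section Existence.
Variable R : realType.
Local Notation C := R[i].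
Local Notation Lam := (Lam R).
Local Notation G := 'rV[R]_8.
Local Notation Jc := (Jframe R).
Local Notation dx := (dx R).
Variable Gamma : discrete_subgroup R.
Implicit Types (x : G) (i j : 'I_8).

Lemma Jfield_complex_structure : complex_structure Gamma (@Jfield R).
Proof.
split.
- exact: smooth_mxM (smooth_mxM (@smooth_mx_frameN R) (smooth_mx_cst _)) (@smooth_mx_frame R).
- exact: Jfield_sqr.
- by move=> c _ x v; rewrite !dleftE Jfield_invariant.
move=> x; exists setT, setT, (@chart R), (@chart_inv R); split.
  by split=> //; exact: openT.
split=> //.
- by move=> y _; split=> //; exact: chartK.
- by move=> w _; split=> //; exact: chart_invK.
- by move=> j; exact: smooth_chart.
- by move=> j; exact: smooth_chart_inv.
- by move=> y v _; exact: chart_holomorphic.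
Qed.

Lemma gfield_hermitian (m : 'I_8 -> R) : (forall i, 0 < m i) ->
  (forall i, m (partner i) = m i) ->
  hermitian_metric Gamma (@Jfield R) (gfield m).
Proof.
move=> m0 mp; split.
- exact: smooth_mxM (smooth_mxM (@smooth_mx_frameN R) (smooth_mx_cst _))
    (smooth_mxT (@smooth_mx_frameN R)).
- by move=> x u v; exact: gfield_sym.
- by move=> x v; exact: gfield_pos.
- by move=> x u v; exact: gfield_J.
- by move=> c _ x u v; rewrite !dleftE gfield_invariant.
Qed.

Section Metric.
Variable m : 'I_8 -> R.
Hypothesis m_gt0 : forall i, 0 < m i.
Hypothesis m_partner : forall i, m (partner i) = m i.
Hypothesis m_iz : m iz = 1.

(** The coefficient of dx_j /\ dy_j in the fundamental form of a diagonal
    metric: the sign is that of J on the plane of X_j and Y_j. *)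
Definition kahler_coef (j : 'I_3) : C := (Jsign R (inord j) * m (inord j))%:C.
Local Notation Om := (Omega_frame kahler_coef).

(** The coefficients of an index and of its partner give the same form, as both
    the sign of J and the area form change sign. *)
Lemma form2_Jframe_diag :
  form2 (map_mx (real_complex R) (Jc *m diag_mx (\row_i m i))) = Om.
Proof.
pose c i : C := (Jsign R i * m i)%:C.
pose f i : Lam := c i *: dxx R i.
have fp i : f (partner i) = f i.
  by rewrite /f dxx_partner /c m_partner Jsign_partner mulNr rmorphN scaleNr scalerN opprK.
have E : form2 (map_mx (real_complex R) (Jc *m diag_mx (\row_i m i))) =
    2^-1 *: \sum_i f i.
  rewrite /form2; congr (_ *: _); apply: eq_bigr => i _.
  rewrite (bigD1 (partner i))//= big1 ?addr0 => [|j /negbTE jN].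
    by rewrite [(map_mx _ _) _ _]mxE mulJframe !mxE eqxx mulr1n m_partner.
  rewrite [(map_mx _ _) _ _]mxE mulJframe !mxE eq_sym jN mulr0n mulr0.
  by rewrite rmorph0 scale0r.
rewrite E sum_ord8.
have p0 n : (n < 8)%N -> partner (inord n) = inord (nth 0%N [:: 3; 4; 5; 0; 1; 2; 7; 6]%N n).
  by move=> n8; rewrite /partner inordK.
rewrite -[f (inord 3)]fp -[f (inord 4)]fp -[f (inord 5)]fp -[f (inord 7)]fp !p0//=.
have fz : f iz = dxx R iz by rewrite /f /c m_iz /Jsign inordK//= mulr1 scale1r.
have fk n : (n < 3)%N ->
    kahler_coef (inord n) *: dxx R (inord (inord n : 'I_3)) = f (inord n).
  by move=> n3; rewrite /kahler_coef /f /c inordK.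
rewrite /Omega_frame /hor sum_ord3 !fk// -/iz fz.
exact: half_pairs.
Qed.

Lemma fundamental_form_gfield :
  fundamental_form (@Jfield R) (gfield m) = fun x => framed x Om.
Proof.
apply/funext => x.
have H := gfield_hermitian m_gt0 m_partner.
rewrite framed_fundamental_form; last exact: Jg_anti H x.
rewrite -form2_Jframe_diag; congr (framed x (form2 (map_mx _ _))).
rewrite /Jfield /gfield -!mulmxA -trmx_mul frameVK trmx1 mulmx1.
by rewrite (mulmxA (frame x) (frame (- x))) frameVK mul1mx (mulmxA (frame x)) frameVK mul1mx.
Qed.

Lemma wedge_pow_framed k x :
  wedge_pow k (fun x => framed x Om) x = framed x (iter k ( *%R Om) 1).
Proof.
elim: k => [|k IH]; first by rewrite framed1.
by rewrite /= framedM -IH.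
Qed.

Lemma XL_cst k (a : Lam) x : XL k (fun=> a) x = 0.
Proof. by apply/ffunP => S; rewrite /XL dirLE dirC_cst lam0E. Qed.

Lemma lsmooth_cst (a : Lam) : lsmooth (fun=> a).
Proof. by move=> S; exact: csmooth_cst. Qed.

Lemma dinv_cst (a : Lam) x : dinv (fun=> a) x = dframe a.
Proof.
by rewrite /dinv big1 ?add0r// => k _; rewrite XL_cst mulr0.
Qed.

Lemma balanced_gfield :
  let w := kahler_coef in
  w (inord 0) * w (inord 1) + w (inord 0) * w (inord 2) +
    w (inord 1) * w (inord 2) = 0 ->
  balanced (@Jfield R) (gfield m).
Proof.
move=> w e2 x; rewrite fundamental_form_gfield.
rewrite (_ : wedge_pow _ _ = fun x => framed x (iter 3 ( *%R Om) 1)); last first.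
  by apply/funext => y; exact: wedge_pow_framed.
rewrite (extd_framed _ (@lsmooth_cst _)) dinv_cst dframe_Omega3//.
by rewrite -[X in framed x X](scale0r (0 : Lam)) (linear_funZ _ _ (framed_linear x)) scale0r.
Qed.

Lemma gauduchon_gfield k :
  let w := kahler_coef in
  w (inord 0) + w (inord 1) + w (inord 2) = 0 -> k = 1%N \/ k = 2%N ->
  gauduchon k (@Jfield R) (gfield m).
Proof.
move=> w e1 k12 x; rewrite fundamental_form_gfield.
have WP n : wedge_pow n (fun x => framed x Om) = fun x => framed x (iter n ( *%R Om) 1).
  by apply/funext => y; exact: wedge_pow_framed.
rewrite !WP.
rewrite (delbar_framed (@lsmooth_cst _)) (_ : proj_dinv id S _ = fun=> delbarframe (iter k ( *%R Om) 1)); last first.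
  apply/funext => y; apply: eq_bigr => p _; apply: eq_bigr => q _.
  by rewrite dinv_cst.
rewrite (del_framed (@lsmooth_cst _)).
rewrite (_ : proj_dinv S id _ x = delframe (delbarframe (iter k ( *%R Om) 1))); last first.
  by apply: eq_bigr => p _; apply: eq_bigr => q _; rewrite dinv_cst.
apply: etrans (esym (framedM _ _ _)) _; rewrite ddc_Omega_wedge//.
by rewrite -[X in framed x X](scale0r (0 : Lam)) (linear_funZ _ _ (framed_linear x)) scale0r.
Qed.

End Metric.

Definition diag_coef (a b c : R) i : R := nth 0 [:: a; b; c; a; b; c; 1; 1] i.

Lemma diag_coef_gt0 a b c i : 0 < a -> 0 < b -> 0 < c -> 0 < diag_coef a b c i.
Proof. by move=> *; elim/ord8P : i; rewrite /diag_coef !inordK. Qed.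

Lemma diag_coef_partner a b c i : diag_coef a b c (partner i) = diag_coef a b c i.
Proof. by elim/ord8P : i; rewrite /diag_coef /partner !inordK. Qed.

Lemma diag_coef_iz a b c : diag_coef a b c iz = 1.
Proof. by rewrite /diag_coef inordK. Qed.

Lemma kahler_coef_diag a b c :
  [/\ kahler_coef (diag_coef a b c) (inord 0) = a%:C,
      kahler_coef (diag_coef a b c) (inord 1) = b%:C &
      kahler_coef (diag_coef a b c) (inord 2) = - c%:C].
Proof.
rewrite /kahler_coef /diag_coef /Jsign !inordK//= !mul1r mulN1r rmorphN.
by [].
Qed.

End Existence.

Theorem corollary4p10 (R : realType) (Gamma : discrete_subgroup R)
    (Mcompact : compact [set: nilmanifold Gamma]) :
  exists J : 'rV[R]_8 -> 'M[R]_8,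
    complex_structure Gamma J /\
    ~ (exists g, hermitian_metric Gamma J g /\ SKT J g) /\
    (exists g, hermitian_metric Gamma J g /\ balanced J g) /\
    (forall k : nat, k = 1%N \/ k = 2%N ->
       exists g, hermitian_metric Gamma J g /\ gauduchon k J g).
Proof.
exists (@Jfield R); split; first exact: Jfield_complex_structure.
split; first by move=> [g [gh]]; exact: (not_SKT Mcompact gh).
have two0 : 0 < 2 :> R by [].
split.
  exists (gfield (diag_coef 2 2 1)); split.
    apply: gfield_hermitian; last exact: diag_coef_partner.
    by move=> i; exact: diag_coef_gt0.
  have [w0 w1 w2] := kahler_coef_diag (2 : R) 2 1.
  apply: (balanced_gfield Gamma) => /=.
  - by move=> i; exact: diag_coef_gt0.
  - exact: diag_coef_partner.
  - exact: diag_coef_iz.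
  rewrite w0 w1 w2 -!rmorphN -!rmorphM -!rmorphD /= -[RHS](rmorph0 (real_complex R)).
  by congr (_%:C); ring.
move=> k k12; exists (gfield (diag_coef 1 1 2)); split.
  apply: gfield_hermitian; last exact: diag_coef_partner.
  by move=> i; exact: diag_coef_gt0.
have [w0 w1 w2] := kahler_coef_diag (1 : R) 1 2.
apply: (gauduchon_gfield Gamma _ _ _ _ k12) => /=.
- by move=> i; exact: diag_coef_gt0.
- exact: diag_coef_partner.
- exact: diag_coef_iz.
rewrite w0 w1 w2 -rmorphN -!rmorphD /= -[RHS](rmorph0 (real_complex R)).
by congr (_%:C); ring.
Qed.
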